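(* Consider the aggregation tree with nodes $\tau=\{\varnothing,(1),(1,1),(1,2),(2)\}$, discrete leaf distribution functions $F_{1,1},F_{1,2},F_2$, and bivariate copulas $C_1$ (for the children $(1,1),(1,2)$ of node $(1)$) and $C_\varnothing$ (for the children $(1),(2)$ of the root), where $C_1$ and $C_\varnothing$ are absolutely continuous with densities $c_1,c_\varnothing$ satisfying, for $I\in\{1,\varnothing\}$, \[ \lim_{\delta\to 0}\ \sup_{t\in\mathbb{R}}\int_{U_\delta(B_I(t))} c_I(u_1,u_2)\,du_1\,du_2=0 . \] Let $\boldsymbol{X}_\varnothing=(X_{1,1},X_{1,2},X_2)$ be the tree dependent random vector of this model, with distribution function $F_\tau$. For $n\in\mathbb{N}$ let $\boldsymbol{X}_\varnothing^{(k:n)}=(X_{1,1}^{(k:n)},X_{1,2}^{(k:n)},X_2^{(k:n)})$, $k=1,\ldots,n$, be the vectors output at the root by the modified reordering algorithm (MRA) with parameter $n$, and set $X_1^{(k:n)}=X_{1,1}^{(k:n)}+X_{1,2}^{(k:n)}$. Then for every $n$ the vectors $\boldsymbol{X}_\varnothing^{(1:n)},\ldots,\boldsymbol{X}_\varnothing^{(n:n)}$ are i.i.d.; each satisfies the conditional independence \[ (X_{1,1}^{(k:n)},X_{1,2}^{(k:n)},X_1^{(k:n)})\perp (X_2^{(k:n)},X_1^{(k:n)}+X_2^{(k:n)})\ \big|\ X_1^{(k:n)}; \] $\boldsymbol{X}_\varnothing^{(1:n)}$ converges in distribution to $\boldsymbol{X}_\varnothing$ as $n\to\infty$; and if $F_\tau^n$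 denotes the empirical distribution function of $\boldsymbol{X}_\varnothing^{(1:n)},\ldots,\boldsymbol{X}_\varnothing^{(n:n)}$, then \[ \lim_{n\to\infty}\sup_{\boldsymbol{x}\in\mathbb{R}^3}\left|F_\tau^n(\boldsymbol{x})-F_\tau(\boldsymbol{x})\right|=0\quad P\text{-a.s.} \]
   Context: Distributions of the model: $G_1(x_1,x_2)=C_1(F_{1,1}(x_1),F_{1,2}(x_2))$, $F_1$ the distribution function of $x_1+x_2$ under $G_1$, and $G_\varnothing(y_1,y_2)=C_\varnothing(F_1(y_1),F_2(y_2))$. For $I\in\{1,\varnothing\}$ with children distribution functions $F_{I,1},F_{I,2}$ (i.e. $F_{1,1},F_{1,2}$ for $I=1$ and $F_1,F_2$ for $I=\varnothing$): $B_I(t)=\{(F_{I,1}(x_1),F_{I,2}(x_2)):x_1+x_2=t\}$ and $U_\delta(B_I(t))$ is the set of points of $[0,1]^2$ at Euclidean distance $<\delta$ from $B_I(t)$. Tree dependent vector: a random vector $(X_{1,1},X_{1,2},X_2)$ with $X_{1,1}\sim F_{1,1}$, $X_{1,2}\sim F_{1,2}$, $X_2\sim F_2$, $P[X_{1,1}\le x_1,X_{1,2}\le x_2]=G_1(x_1,x_2)$, and with $X_1:=X_{1,1}+X_{1,2}$, $P[X_1\le y_1,X_2\le y_2]=G_\varnothing(y_1,y_2)$, and such that $(X_{1,1},X_{1,2},X_1)\perp(X_2,X_1+X_2)\mid X_1$; its distribution is unique. MRA with parameter $n$: a call at a node returns a random batch of $n$ items; different calls use independent randomness. At a leaf $J$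 the batch is $n$ i.i.d. draws from $F_J$. At a branching node $I$ with children $(I,1),(I,2)$: for each $\ell=1,\ldots,n$, independently over $\ell$, obtain for each child an independent batch $({}^{\ell}X_{I,i}^k,{}^{\ell}\boldsymbol{X}_{I,i}^k)_{k=1}^n$ by an independent call at the child (for a leaf child, $\boldsymbol{X}=X$; for a branching child, ${}^{\ell}\boldsymbol{X}_{I,i}^k$ is the vector of leaf values and ${}^{\ell}X_{I,i}^k$ their sum), and $n$ i.i.d. samples ${}^{\ell}\boldsymbol{U}_I^k=({}^{\ell}U_I^{k,1},{}^{\ell}U_I^{k,2})\sim C_I$. Let ${}^{\ell}p_{I,i}(k)$ be the rank of ${}^{\ell}U_I^{k,i}$ among ${}^{\ell}U_I^{1,i},\ldots,{}^{\ell}U_I^{n,i}$, ${}^{\ell}q_{I,i}$ the permutation with ${}^{\ell}q_{I,i}(k)$ the rank of ${}^{\ell}X_{I,i}^k$ among ${}^{\ell}X_{I,i}^1,\ldots,{}^{\ell}X_{I,i}^n$ (ties broken so that it is a permutation), and $\sigma^{\ell}={}^{\ell}q_{I,2}^{-1}\circ{}^{\ell}p_{I,2}\circ{}^{\ell}p_{I,1}^{-1}\circ{}^{\ell}q_{I,1}$. The output batch at $I$ is, for $k=1,\ldots,n$: the vector of leaf values $\boldsymbol{X}_I^k=({}^{k}\boldsymbol{X}_{I,1}^{k},{}^{k}\boldsymbol{X}_{I,2}^{\sigma^k(k)})$ (concatenation) and $X_I^k={}^{k}X_{I,1}^{k}+{}^{k}X_{I,2}^{\sigma^k(k)}$. The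 vectors $\boldsymbol{X}_\varnothing^{(k:n)}$ are the vectors $\boldsymbol{X}_\varnothing^k$ of the batch returned at the root.
   Formalization: Ties among the values being ranked are broken uniformly at random, by independent uniform variables; under an arbitrary rule, such as breaking ties by index, the output vectors need not be identically distributed nor converge to the tree dependent vector. *)

(* Defs.v *)
From HB Require Import structures.
From mathcomp Require Import all_boot all_order all_algebra.
From mathcomp Require Import all_classical all_reals all_analysis.
From Stdlib Require List.
Set Implicit Arguments.
Unset Strict Implicit.
Unset Printing Implicit Defensive.
Import Order.TTheory GRing.Theory Num.Theory numFieldNormedType.Exports.
Local Open Scope classical_set_scope.
Local Open Scope ring_scope.

Definition discrete_cdf (R : realType) (F : R -> R) : Prop :=
  exists (a p : nat -> R),
    (forall i, 0 <= p i) /\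
    ((fun N => \sum_(i < N) p i) @ \oo --> (1 : R)) /\
    (forall x, (fun N => \sum_(i < N) (if a i <= x then p i else 0)) @ \oo
                 --> F x).

Definition is_copula (R : realType) (C : R -> R -> R) : Prop :=
  (forall u, 0 <= u <= 1 ->
     C u 0 = 0 /\ C 0 u = 0 /\ C u 1 = u /\ C 1 u = u) /\
  (forall u1 u2 v1 v2, 0 <= u1 -> 0 <= u2 -> v1 <= 1 -> v2 <= 1 ->
     u1 <= v1 -> u2 <= v2 ->
     0 <= C v1 v2 - C u1 v2 - C v1 u2 + C u1 u2).

Definition unit_sq (R : realType) : set (R * R) :=
  `[(0:R), 1]%classic `*` `[(0:R), 1]%classic.

Definition rect (R : realType) (u1 u2 : R) : set (R * R) :=
  `[(0:R), u1]%classic `*` `[(0:R), u2]%classic.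

Definition leb2 (R : realType) := ((@lebesgue_measure R) \x (@lebesgue_measure R))%E.

Definition copula_density (R : realType) (C c : R -> R -> R) : Prop :=
  measurable_fun setT (fun z : R * R => c z.1 z.2) /\
  (forall z : R * R, 0 <= c z.1 z.2) /\
  (forall u1 u2, 0 <= u1 <= 1 -> 0 <= u2 <= 1 ->
     (C u1 u2)%:E = (\int[@leb2 R]_(z in rect u1 u2) (c z.1 z.2)%:E)%E).

Definition Bset (R : realType) (F1 F2 : R -> R) (t : R) : set (R * R) :=
  [set z | exists x1 x2, x1 + x2 = t /\ z = (F1 x1, F2 x2)].

Definition Udelta (R : realType) (delta : R) (B : set (R * R)) : set (R * R) :=
  [set u | @unit_sq R u /\
     exists b, B b /\ Num.sqrt ((u.1 - b.1) ^+ 2 + (u.2 - b.2) ^+ 2) < delta].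

Definition density_condition (R : realType) (c : R -> R -> R) (F1 F2 : R -> R)
  : Prop :=
  forall eps : R, 0 < eps -> exists d0 : R, 0 < d0 /\
    forall delta : R, 0 < delta -> delta < d0 -> forall t : R,
      (\int[@leb2 R]_(z in Udelta delta (Bset F1 F2 t)) (c z.1 z.2)%:E
         <= eps%:E)%E.


Definition rv_events (T : Type) (dU : measure_display)
  (U : measurableType dU) (X : T -> U) : set (set T) :=
  [set X @^-1` B | B in [set B : set U | measurable B]].

Definition mutual_indep (R : realType) (d : measure_display)
  (T : measurableType d) (P : probability T R) (I : Type)
  (E : I -> set (set T)) : Prop :=
  forall (J : seq I) (A : I -> set T), List.NoDup J ->
    (forall i, List.In i J -> E i (A i)) ->
    P (\bigcap_(i in [set i | List.In i J]) A i) = (\prod_(i <- J) P (A i))%E.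

(* conditional independence of X and Y given a discrete random variable Z:
   for every atom z, P(X in A, Y in B | Z = z) = P(X in A | Z = z) P(Y in B | Z = z),
   written multiplicatively (trivial when P(Z = z) = 0). *)
Definition cond_indep_discrete (R : realType) (d : measure_display)
  (T : measurableType d) (P : probability T R)
  (d1 d2 : measure_display) (T1 : measurableType d1) (T2 : measurableType d2)
  (X : T -> T1) (Y : T -> T2) (Z : T -> R) : Prop :=
  forall (A : set T1) (B : set T2) (z : R), measurable A -> measurable B ->
    (P (X @^-1` A `&` Y @^-1` B `&` Z @^-1` [set z]) * P (Z @^-1` [set z])
     = P (X @^-1` A `&` Z @^-1` [set z]) * P (Y @^-1` B `&` Z @^-1` [set z]))%E.

Definition tree_dependent (R : realType) (d : measure_display)
  (T : measurableType d) (Q : probability T R)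
  (F11 F12 F2 F1 : R -> R) (C1 C0 : R -> R -> R)
  (Z11 Z12 Z2 : T -> R) : Prop :=
  [/\ measurable_fun setT Z11 /\ measurable_fun setT Z12 /\ measurable_fun setT Z2,
   (forall x, Q [set w | Z11 w <= x] = (F11 x)%:E) /\
   (forall x, Q [set w | Z12 w <= x] = (F12 x)%:E) /\
   (forall x, Q [set w | Z2 w <= x] = (F2 x)%:E),
   (forall x1 x2, Q [set w | Z11 w <= x1 /\ Z12 w <= x2]
                   = (C1 (F11 x1) (F12 x2))%:E),
   (forall y1 y2, Q [set w | Z11 w + Z12 w <= y1 /\ Z2 w <= y2]
                   = (C0 (F1 y1) (F2 y2))%:E) &
   cond_indep_discrete Q
     (fun w => (Z11 w, Z12 w, Z11 w + Z12 w))
     (fun w => (Z2 w, Z11 w + Z12 w + Z2 w))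
     (fun w => Z11 w + Z12 w)].

Definition sum_cdf_under (R : realType) (F11 F12 : R -> R) (C1 : R -> R -> R)
  (F1 : R -> R) : Prop :=
  forall (d : measure_display) (T : measurableType d) (Q : probability T R)
         (Y1 Y2 : T -> R),
    measurable_fun setT Y1 -> measurable_fun setT Y2 ->
    (forall x1 x2, Q [set w | Y1 w <= x1 /\ Y2 w <= x2]
                    = (C1 (F11 x1) (F12 x2))%:E) ->
    forall t, Q [set w | Y1 w + Y2 w <= t] = (F1 t)%:E.

Definition key_lt (R : realType) (x t : nat -> R) (j k : nat) : bool :=
  (x j < x k) || ((x j == x k) && ((t j < t k) || ((t j == t k) && (j < k)%N))).

Definition rank (R : realType) (n : nat) (x t : nat -> R) (k : nat) : nat :=
  count (fun j => key_lt x t j k) (iota 0 n).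

Definition invrank (R : realType) (n : nat) (x t : nat -> R) (r : nat) : nat :=
  find (fun j => rank n x t j == r) (iota 0 n).

(* sigma = q2^-1 o p2 o p1^-1 o q1, where q_i are ranks of the child values
   (x1 with tie breakers t1, x2 with tie breakers t2) and p_i are the ranks
   of the copula sample coordinates u1, u2 *)
Definition sigma_perm (R : realType) (n : nat) (x1 t1 u1 u2 x2 t2 : nat -> R)
  (k : nat) : nat :=
  invrank n x2 t2 (rank n u2 (fun=> 0) (invrank n u1 (fun=> 0) (rank n x1 t1 k))).

(* All randomness used by the MRA, for all parameters n.
   Indices: n = parameter, l = iteration at the root, l' = iteration at
   node (1), k = position in a batch.
   A n l l' k ~ F11, B n l l' k ~ F12 : leaf samples at (1,1), (1,2);
   (V1, V2) n l l' k ~ C1 : copula samples at node (1);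
   D n l k ~ F2 : leaf samples at (2);
   (W1, W2) n l k ~ C0 : copula samples at the root;
   TA, TB, TD, T1 : i.i.d. uniform tie breakers for ranking A, B, D and the
   node-(1) sums at the root. *)
Record mra_rand (R : realType) (T : Type) := MraRand {
  rA : nat -> nat -> nat -> nat -> T -> R;
  rTA : nat -> nat -> nat -> nat -> T -> R;
  rB : nat -> nat -> nat -> nat -> T -> R;
  rTB : nat -> nat -> nat -> nat -> T -> R;
  rV1 : nat -> nat -> nat -> nat -> T -> R;
  rV2 : nat -> nat -> nat -> nat -> T -> R;
  rD : nat -> nat -> nat -> T -> R;
  rTD : nat -> nat -> nat -> T -> R;
  rW1 : nat -> nat -> nat -> T -> R;
  rW2 : nat -> nat -> nat -> T -> R;
  rT1 : nat -> nat -> nat -> T -> R }.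

Definition node1_out (R : realType) (T : Type) (M : mra_rand R T)
  (n l j : nat) (w : T) : R * R :=
  (rA M n l j j w,
   rB M n l j
     (sigma_perm n (fun k => rA M n l j k w) (fun k => rTA M n l j k w)
                   (fun k => rV1 M n l j k w) (fun k => rV2 M n l j k w)
                   (fun k => rB M n l j k w) (fun k => rTB M n l j k w) j) w).

Definition mra_out (R : realType) (T : Type) (M : mra_rand R T)
  (n k : nat) (w : T) : R * R * R :=
  let S := fun j => (node1_out M n k j w).1 + (node1_out M n k j w).2 in
  let s := sigma_perm n S (fun j => rT1 M n k j w)
             (fun j => rW1 M n k j w) (fun j => rW2 M n k j w)
             (fun j => rD M n k j w) (fun j => rTD M n k j w) k in
  ((node1_out M n k k w).1, (node1_out M n k k w).2, rD M n k s w).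

Inductive mra_src :=
| SA of nat & nat & nat & nat | STA of nat & nat & nat & nat
| SB of nat & nat & nat & nat | STB of nat & nat & nat & nat
| SV of nat & nat & nat & nat
| SD of nat & nat & nat | STD of nat & nat & nat
| SW of nat & nat & nat | ST1 of nat & nat & nat.

Definition mra_events (R : realType) (d : measure_display) (T : measurableType d)
  (M : mra_rand R T) (s : mra_src) : set (set T) :=
  match s with
  | SA n l l' k => rv_events (rA M n l l' k)
  | STA n l l' k => rv_events (rTA M n l l' k)
  | SB n l l' k => rv_events (rB M n l l' k)
  | STB n l l' k => rv_events (rTB M n l l' k)
  | SV n l l' k => rv_events (fun w => (rV1 M n l l' k w, rV2 M n l l' k w))
  | SD n l k => rv_events (rD M n l k)
  | STD n l k => rv_events (rTD M n l k)
  | SW n l k => rv_events (fun w => (rW1 M n l k w, rW2 M n l k w))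
  | ST1 n l k => rv_events (rT1 M n l k)
  end.

Definition unif01 (R : realType) (d : measure_display) (T : measurableType d)
  (P : probability T R) (X : T -> R) : Prop :=
  measurable_fun setT X /\
  forall x : R, 0 <= x <= 1 -> P [set w | X w <= x] = x%:E.

Definition has_cdf (R : realType) (d : measure_display) (T : measurableType d)
  (P : probability T R) (X : T -> R) (F : R -> R) : Prop :=
  measurable_fun setT X /\ forall x : R, P [set w | X w <= x] = (F x)%:E.

Definition has_copula (R : realType) (d : measure_display) (T : measurableType d)
  (P : probability T R) (X Y : T -> R) (C : R -> R -> R) : Prop :=
  measurable_fun setT X /\ measurable_fun setT Y /\
  forall u1 u2 : R, 0 <= u1 <= 1 -> 0 <= u2 <= 1 ->
    P [set w | X w <= u1 /\ Y w <= u2] = (C u1 u2)%:E.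

Definition mra_law (R : realType) (d : measure_display) (T : measurableType d)
  (P : probability T R) (F11 F12 F2 : R -> R) (C1 C0 : R -> R -> R)
  (M : mra_rand R T) : Prop :=
  [/\ forall n l l' k, has_cdf P (rA M n l l' k) F11 /\ has_cdf P (rB M n l l' k) F12
        /\ unif01 P (rTA M n l l' k) /\ unif01 P (rTB M n l l' k)
        /\ has_copula P (rV1 M n l l' k) (rV2 M n l l' k) C1,
      forall n l k, has_cdf P (rD M n l k) F2 /\ unif01 P (rTD M n l k)
        /\ unif01 P (rT1 M n l k) /\ has_copula P (rW1 M n l k) (rW2 M n l k) C0 &
      mutual_indep P (mra_events M)].

Definition le3 (R : realType) (y x : R * R * R) : Prop :=
  y.1.1 <= x.1.1 /\ y.1.2 <= x.1.2 /\ y.2 <= x.2.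

Definition cdf3 (R : realType) (d : measure_display) (T : measurableType d)
  (P : probability T R) (Y : T -> R * R * R) (x : R * R * R) : R :=
  fine (P [set w | le3 (Y w) x]).

Definition empirical_cdf (R : realType) (T : Type) (M : mra_rand R T)
  (n : nat) (w : T) (x : R * R * R) : R :=
  (\sum_(k < n) (if `[< le3 (mra_out M n k w) x >] then 1 else 0)) / n%:R.

(* Main.v *)
(** Reordering replaces the k-th copula sample by the pair of order statistics of the two
    child batches whose ranks are the ranks of its coordinates.  Hence the number of
    positions whose reordered pair lies below a given corner differs from the number of
    copula samples below the point [(u, v)] by at most the deviations of four binomial
    counts, and exchangeability of the first child's batch makes the corner probability the
    same at every position.  With the fourth-moment bound for binomial counts this gives
    convergence of all corner probabilities, hence of all atoms, at each node.  At the root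
    the second output depends on node (1) only through the sum at position k and through
    independent randomness, so the atoms of the output vector are obtained from those of
    the two nodes by conditional independence.  The limit law is discrete, so convergence of
    atoms upgrades to total variation (Scheffe); the same upgrade applied to the empirical
    measures, whose atoms converge almost surely by Borel-Cantelli, gives the uniform
    convergence of the empirical distribution functions. *)
Require Import Defs.
From HB Require Import structures.
From mathcomp Require Import all_boot all_order all_algebra.
From mathcomp Require Import all_classical all_reals all_analysis.
From mathcomp Require Import measurable_realfun.
From mathcomp Require Import ring lra.
Import Order.TTheory GRing.Theory Num.Theory numFieldNormedType.Exports.
Local Open Scope classical_set_scope.
Local Open Scope ring_scope.
Set Implicit Arguments.
Unset Strict Implicit.
Unset Printing Implicit Defensive.

(** * Independence of generated sigma-algebras *)

(** The samples for parameter [n] are not an initial piece of those for [n + 1], so no strong law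
    along one fixed sequence is at hand: almost sure statements must come from tail bounds summable
    in [n]. This is why fourth moments are used; they give order [n^-2], whereas a variance bound
    gives only [n^-1]. Counts at the root are binomial because entry [j] of the batch of node (1) is
    taken from that node's own iteration [j]; the entries of one reordered batch would depend on
    each other. Exchangeability rests on the tie breakers: discrete values tie, and a rank that
    falls back on the position is not symmetric, but uniform tie breakers are almost surely
    distinct. Corners are needed with weak and strict inequalities, since an atom is the alternating
    sum of four of them; strict corners are left limits, controlled by the Lipschitz property of
    copulas. At the root the first marginal is the law of the sum at node (1), and the event that
    this sum is below a level may contain infinitely many atoms, so node (1) is brought to total
    variation before the root is treated. *)

Lemma nodup_exists (I : Type) (J : seq I) :
  exists J', List.NoDup J' /\ forall i, List.In i J' <-> List.In i J.
Proof.
elim: J => [|i J [J' [ndJ' JJ']]]; first by exists nil; split => //; constructor.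
(* Index types such as [mra_src] are plain types, so membership is decided classically. *)
have [iJ|niJ] := pselect (List.In i J').
  by exists J'; split => // k; split => [/JJ'|[<- //|/JJ' //]]; right.
exists (i :: J'); split; first by constructor.
by move=> k /=; rewrite JJ'.
Qed.

Section independence.
Context (R : realType) (d : measure_display) (T : measurableType d).
Variable P : probability T R.

(** The restriction [mrestr P mB] and the multiple of [P] by [P B] are finite measures; agreeing on
    a π-system that contains the whole space, they agree on the sigma-algebra it generates. *)
Lemma indep_generated_l (G : set (set T)) (B : set T) :
  G `<=` measurable -> setI_closed G -> G setT -> measurable B ->
  (forall A, G A -> P (A `&` B) = (P A * P B)%E) ->
  forall A, <<s G >> A -> P (A `&` B) = (P A * P B)%E.
Proof.
move=> mG GI GT mB GB A sA.
have PBfin : P B = (fine (P B))%:E by rewrite fineK// fin_num_measure.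
have r0 : 0 <= fine (P B) by rewrite fine_ge0.
have -> : P (A `&` B) = mrestr P mB A by [].
have -> : (P A * P B = mscale (NngNum r0) P A)%E.
  by rewrite /mscale /= {1}PBfin muleC.
apply: (g_sigma_algebra_measure_unique G mG (fun=> setT)) => //.
- by apply/seteqP; split => // x _; exists 0%N.
- move=> C GC; transitivity (P C * P B)%E; first exact: GB.
  by rewrite /= /mscale /= {1}PBfin muleC.
- by move=> _; rewrite /= /mrestr /= setTI PBfin ltry.
Qed.

Lemma indep_generated (G1 G2 : set (set T)) :
  G1 `<=` measurable -> setI_closed G1 -> G1 setT ->
  G2 `<=` measurable -> setI_closed G2 -> G2 setT ->
  (forall A B, G1 A -> G2 B -> P (A `&` B) = (P A * P B)%E) ->
  forall A B, <<s G1 >> A -> <<s G2 >> B -> P (A `&` B) = (P A * P B)%E.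
Proof.
move=> m1 I1 T1 m2 I2 T2 G12 A B sA sB.
have sm2 := smallest_sub (@sigma_algebra_measurable _ T) m2.
apply: (@indep_generated_l G1) => //; first exact: sm2.
move=> A' GA'; rewrite setIC muleC.
apply: (@indep_generated_l G2) => //; first exact: m1.
by move=> B' GB'; rewrite setIC muleC G12.
Qed.

Definition subgen (I : Type) (E : I -> set (set T)) (D : set I) : set (set T) :=
  [set X | exists2 i, D i & E i X].

Lemma mutual_indep_inj (I K : Type) (E : I -> set (set T)) (F : K -> set (set T))
    (k : K -> I) : injective k -> (forall x, F x `<=` E (k x)) ->
  mutual_indep P E -> mutual_indep P F.
Proof.
move=> kinj FE indE J A ndJ FA.
(* Off the image of [k] this intersection is empty-indexed, hence the whole space; on the image,
   injectivity leaves the single set [A x]. *)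
pose B i := \bigcap_(x in [set x | k x = i]) A x.
have BE x : B (k x) = A x.
  by apply/seteqP; split => [w|w Aw y /kinj -> //]; apply.
have := @indE (map k J) B; rewrite big_map.
have -> : (\prod_(j <- J) P (B (k j)) = \prod_(j <- J) P (A j))%E.
  by apply: eq_bigr => j _; rewrite BE.
move=> <-.
- congr (P _); apply/seteqP; split => w h.
    move=> i /List.in_map_iff[x [<- xJ]]; rewrite BE; exact: h.
  by move=> x xJ; rewrite -BE; apply: h; exact: List.in_map.
- elim: J ndJ {FA} => [|x J IH] ndJ /=; first by constructor.
  inversion ndJ as [|? ? nxJ ndJ']; subst; constructor; last exact: IH.
  by move=> /List.in_map_iff[y [/kinj ->]].
- by move=> i /List.in_map_iff[x [<- xJ]]; rewrite BE; apply: FE; exact: FA.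
Qed.

Section groups.
Variables (I : Type) (E : I -> set (set T)).
Hypotheses (ET : forall i, E i setT) (EI : forall i, setI_closed (E i)).
Hypothesis Em : forall i, E i `<=` measurable.
Hypothesis indE : mutual_indep P E.

(** The family is total and trivial off [J], so that two cylinders intersect by intersecting their
    families index by index. Cylinders form the π-system behind [subgen E D]. *)
Let cylinder (D : set I) : set (set T) :=
  [set X | exists J (A : I -> set T),
     [/\ forall i, E i (A i), forall i, ~ List.In i J -> A i = setT,
         forall i, List.In i J -> D i & X = \bigcap_i A i]].

Let cylinderT D : cylinder D setT.
Proof.
exists nil, (fun=> setT); split => //.
by apply/seteqP; split => // x _ i _.
Qed.

Let cylinderI D : setI_closed (cylinder D).
Proof.
move=> X Y [J [A [EA nA JD ->]]] [J' [A' [EA' nA' JD' ->]]].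
exists (J ++ J')%SEQ, (fun i => A i `&` A' i); split.
- by move=> i; exact: EI.
- move=> i /List.in_app_iff nJ; rewrite nA ?nA' ?setTI//.
    by move=> h; apply: nJ; right.
  by move=> h; apply: nJ; left.
- by move=> i /List.in_app_iff [/JD|/JD'].
- by rewrite bigcapI.
Qed.

Let bigcap_off (J : seq I) (A : I -> set T) :
  (forall i, ~ List.In i J -> A i = setT) ->
  \bigcap_i A i = \bigcap_(i in [set i | List.In i J]) A i.
Proof.
move=> nA; apply/seteqP; split => x h i; first by move=> _; exact: h.
by move=> _; have [iJ|/nA ->//] := pselect (List.In i J); exact: h.
Qed.

Let bigcap_mutual (J : seq I) (A : I -> set T) : List.NoDup J ->
  (forall i, E i (A i)) -> (forall i, ~ List.In i J -> A i = setT) ->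
  P (\bigcap_i A i) = (\prod_(i <- J) P (A i))%E.
Proof. by move=> ndJ EA nA; rewrite (bigcap_off nA) indE. Qed.

Let measurable_listcap (J : seq I) (A : I -> set T) :
  (forall i, measurable (A i)) ->
  measurable (\bigcap_(i in [set i | List.In i J]) A i).
Proof.
move=> mA; elim: J => [|i J IH].
  by rewrite (_ : \bigcap_(i in _) _ = setT)//; apply/seteqP; split => // x _ i [].
rewrite (_ : \bigcap_(i in _) _ =
    A i `&` \bigcap_(i in [set i | List.In i J]) A i).
  exact: measurableI.
apply/seteqP; split => [x h|x [h1 h2] k /= [<-//|]]; last exact: h2.
by split => [|k kJ]; apply: h => /=; [left|right].
Qed.

Let cylinder_measurable D : cylinder D `<=` measurable.
Proof.
move=> X [J [A [EA nA JD ->]]]; rewrite (bigcap_off nA).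
by apply: measurable_listcap => i; apply/Em/EA.
Qed.

Let eq_In_prod (J : seq I) (F G : I -> \bar R) :
  (forall i, List.In i J -> F i = G i) ->
  (\prod_(i <- J) F i = \prod_(i <- J) G i)%E.
Proof.
elim: J => [|i J IH] FG; first by rewrite !big_nil.
rewrite !big_cons FG/=; last by left.
by rewrite IH// => k kJ; apply: FG; right.
Qed.

(** Disjointness of [D] and [D'] makes the concatenated supports duplicate-free, so a single product
    over them factors; on each half the other family is trivial. *)
Let cylinder_indep (D D' : set I) : (forall i, D i -> D' i -> False) ->
  forall X Y, cylinder D X -> cylinder D' Y -> P (X `&` Y) = (P X * P Y)%E.
Proof.
move=> DD' X Y [J0 [A [EA nA JD ->]]] [J0' [A' [EA' nA' JD' ->]]].
have [J [ndJ JJ0]] := nodup_exists J0.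
have [J' [ndJ' JJ0']] := nodup_exists J0'.
have {}nA i : ~ List.In i J -> A i = setT by rewrite JJ0; exact: nA.
have {}nA' i : ~ List.In i J' -> A' i = setT by rewrite JJ0'; exact: nA'.
have {}JD i : List.In i J -> D i by rewrite JJ0; exact: JD.
have {}JD' i : List.In i J' -> D' i by rewrite JJ0'; exact: JD'.
rewrite -bigcapI (@bigcap_mutual (J ++ J')%SEQ (fun i => A i `&` A' i)).
- rewrite big_cat/= (bigcap_mutual ndJ EA nA) (bigcap_mutual ndJ' EA' nA').
  congr (_ * _)%E; apply: eq_In_prod => i iJ.
    by rewrite nA' ?setIT// => /JD'; apply: DD'; exact: JD.
  by rewrite nA ?setTI// => /JD /DD'; apply; exact: JD'.
- elim: (J) ndJ (JD) => [|i K IH] //= ndJ KD; inversion ndJ as [|? ? niK ndK]; subst.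
  constructor; last by apply: IH => // k kK; apply: KD; right.
  move=> /List.in_app_iff[//|/JD']; apply: DD'; apply: KD; by left.
- by move=> i; exact: EI.
- move=> i nJ; rewrite nA ?nA' ?setTI//.
    by move=> h; apply: nJ; apply/List.in_app_iff; right.
  by move=> h; apply: nJ; apply/List.in_app_iff; left.
Qed.

Let sub_cylinder (D : set I) : <<s subgen E D >> `<=` <<s cylinder D >>.
Proof.
apply: sub_sigma_algebra2 => X [i Di EiX].
exists [:: i], (fun k => if pselect (k = i) then X else setT); split.
- by move=> k; case: pselect => [ki|nki] /=; [rewrite ki|exact: ET].

- by move=> k nki; case: pselect => // ki; case: nki; left.
- by move=> k [<-|].
- apply/seteqP; split => [x Xx k _|x /(_ i Logic.I)]; first by case: pselect.
  by case: pselect.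
Qed.

Lemma indep_disjoint_groups (D D' : set I) (A B : set T) :
  (forall i, D i -> D' i -> False) ->
  <<s subgen E D >> A -> <<s subgen E D' >> B ->
  P (A `&` B) = (P A * P B)%E.
Proof.
move=> DD' /sub_cylinder sA /sub_cylinder sB.
by apply: (indep_generated _ _ _ _ _ _ (cylinder_indep DD') sA sB).
Qed.

(** Independence by blocks: [gamma] names the block of a source, and events of [F k] may use only
    block [k]. This turns independence of elementary samples into independence of batch entries and
    of output vectors. *)
Lemma mutual_indep_groups (K : Type) (gamma : I -> K) (F : K -> set (set T)) :
  (forall k, F k `<=` <<s subgen E [set i | gamma i = k] >>) ->
  mutual_indep P F.
Proof.
move=> FE J A ndJ FA.
have sE D : sigma_algebra setT <<s subgen E D >> by exact: smallest_sigma_algebra.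
have sub (D D' : set I) : D `<=` D' -> <<s subgen E D >> `<=` <<s subgen E D' >>.
  by move=> DD'; apply: sub_sigma_algebra2 => X [i Di EX]; exists i => //; exact: DD'.
(* The induction must also record which sources the partial intersection uses; only then is it
   independent of the block added next. *)
suff [] : P (\bigcap_(i in [set i | List.In i J]) A i) = (\prod_(i <- J) P (A i))%E
    /\ <<s subgen E [set i | List.In (gamma i) J] >>
         (\bigcap_(i in [set i | List.In i J]) A i) by [].
elim: J ndJ FA => [|k J IH] ndJ FA.
  rewrite (_ : \bigcap_(i in _) _ = setT); last first.
    by apply/seteqP; split => // x _ i [].
  split; first by rewrite big_nil probability_setT.
  exact: (@measurableT _ (g_sigma_algebraType (subgen E _))).
inversion ndJ as [|? ? nkJ ndJ']; subst.
have [IH1 IH2] := IH ndJ' (fun i iJ => FA i (or_intror iJ)).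
have Ak : F k (A k) by apply: FA; left.
rewrite (_ : \bigcap_(i in _) _ =
    A k `&` \bigcap_(i in [set i | List.In i J]) A i); last first.
  apply/seteqP; split => [x h|x [h1 h2] i /= [<-//|]]; last exact: h2.
  by split => [|i iJ]; apply: h => /=; [left|right].
split.
  rewrite big_cons -IH1; apply: (@indep_disjoint_groups [set i | gamma i = k] _ _ _ _ _ IH2).
    by move=> i /= ->.
  exact: FE.
apply: (@measurableI _ (g_sigma_algebraType (subgen E _))).
  by apply: sub (FE _ _ Ak) => i /= ->; left.
by apply: sub IH2 => i /=; right.
Qed.

End groups.
End independence.

(** * Ranks and reordering *)

Lemma count_iota_card (n : nat) (p : pred nat) :
  count p (iota 0 n) = #|[pred j : 'I_n | p j]|.
Proof.
rewrite -sum1_count -[n in iota 0 n]subn0 -/(index_iota 0 n) big_mkord sum1_card.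
by apply: eq_card => j; rewrite !inE.
Qed.

Lemma count_iota_sum (R : realType) (n : nat) (p : pred nat) :
  (count p (iota 0 n))%:R = \sum_(k < n) (p k)%:R :> R.
Proof.
rewrite count_iota_card -sum1_card natr_sum big_mkcond/=.
by apply: eq_bigr => k _; rewrite inE; case: (p k).
Qed.

Section ranks.
Context (R : realType) (n : nat).
Implicit Types x t u : nat -> R.

Lemma key_lt_irr x t j : key_lt x t j j = false.
Proof. by rewrite /key_lt !ltxx ltnn !andbF. Qed.

Lemma key_lt_trans x t : transitive (key_lt x t).
Proof.
move=> k j l; rewrite /key_lt.
case/orP => [jk|/andP[/eqP jk]].
  case/orP => [kl|/andP[/eqP kl _]]; first by rewrite (lt_trans jk kl).
  by rewrite -kl jk.
rewrite jk; case/orP => [tjk|/andP[/eqP tjk jk']].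
  case/orP => [->//|/andP[-> /orP[tkl|/andP[/eqP <-]]]].
    by rewrite (lt_trans tjk tkl) orbT.
  by rewrite tjk orbT.
case/orP => [->//|/andP[-> /orP[tkl|/andP[/eqP tkl kl]]]].
  by rewrite tjk tkl orbT.
by rewrite tjk tkl eqxx (ltn_trans jk' kl) !orbT.
Qed.

Lemma key_lt_total x t j k : j != k -> key_lt x t j k || key_lt x t k j.
Proof.
rewrite /key_lt; case: (ltgtP (x j) (x k)) => //= _.
by case: (ltgtP (t j) (t k)) => //= _; rewrite neq_ltn.
Qed.

Lemma rank_mono x t (j k : 'I_n) : key_lt x t j k -> (rank n x t j < rank n x t k)%N.
Proof.
move=> jk; rewrite /rank !count_iota_card; apply: proper_card.
apply/properP; split.
  by apply/fintype.subsetP => i; rewrite !inE => ij; exact: key_lt_trans jk.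
by exists j; rewrite !inE// key_lt_irr.
Qed.

Lemma rank_inj x t (j k : 'I_n) : rank n x t j = rank n x t k -> j = k.
Proof.
move=> jk; apply/val_inj/eqP; apply: contraT => /= neq.
by case/orP: (key_lt_total x t neq) => /rank_mono; rewrite jk ltnn.
Qed.

Lemma rank_lt x t (k : 'I_n) : (rank n x t k < n)%N.
Proof.
rewrite /rank count_iota_card -[X in (_ < X)%N]card_ord; apply: proper_card.
apply/properP; split; first by apply/fintype.subsetP => i _.
by exists k; rewrite !inE// key_lt_irr.
Qed.

Definition rank_ord x t (k : 'I_n) : 'I_n := Ordinal (rank_lt x t k).

Lemma rank_ord_inj x t : injective (rank_ord x t).
Proof. by move=> j k [] /rank_inj. Qed.

Lemma invrankP x t (r : 'I_n) :
  exists k : 'I_n, invrank n x t r = k /\ rank n x t k = r.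
Proof.
have [k kr] : exists k, rank_ord x t k = r.
  by exists (invF (@rank_ord_inj x t) r); rewrite f_invF.
have hk : has (fun j => rank n x t j == r) (iota 0 n).
  apply/hasP; exists (k : nat); first by rewrite mem_iota/= add0n.
  by rewrite -kr.
have lt : (invrank n x t r < n)%N by rewrite /invrank -[X in (_ < X)%N](size_iota 0) -has_find.
exists (Ordinal lt); split => //.
by have /eqP := nth_find 0%N hk; rewrite nth_iota.
Qed.

Lemma rankK x t (k : 'I_n) : invrank n x t (rank n x t k) = k.
Proof.
have [j [jE /esym]] := invrankP x t (rank_ord x t k).
by move=> /rank_inj kj; rewrite {2}kj -jE.
Qed.

Definition down_closed x t (D : pred nat) :=
  forall j k : 'I_n, D k -> key_lt x t j k -> D j.

(** Keys are totally ordered, so a set closed under smaller keys is an initial segment, and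
    membership only compares the rank with the size of the set. *)
Lemma down_closed_rank x t D (j : 'I_n) : down_closed x t D ->
  D j = (rank n x t j < count D (iota 0 n))%N.
Proof.
move=> dD; rewrite /rank !count_iota_card; have [Dj|nDj] := boolP (D j).
  apply/esym/proper_card/properP; split.
    by apply/fintype.subsetP => i; rewrite !inE; exact: dD.
  by exists j; rewrite !inE// key_lt_irr.
apply/esym/negbTE; rewrite -leqNgt; apply: subset_leq_card.
apply/fintype.subsetP => i; rewrite !inE => Di.
have ij : val i != val j by apply: contraNneq nDj => <-.
by case/orP: (key_lt_total x t ij) => // /(dD _ _ Di) Dj; rewrite Dj in nDj.
Qed.

Lemma count_rank x t (p : pred nat) :
  count (fun k => p (rank n x t k)) (iota 0 n) = count p (iota 0 n).
Proof.
rewrite !count_iota_card -(fintype.card_image (@rank_ord_inj x t)).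
apply: eq_card => j; rewrite !inE; apply/fintype.imageP/idP => [[k] /[!inE] pk ->//|pj].
exists (invF (@rank_ord_inj x t) j); rewrite ?f_invF// inE/=.
by rewrite -[rank _ _ _ _]/(val (rank_ord x t _)) f_invF.
Qed.

Lemma count_ltn c : (c <= n)%N -> count (fun k => k < c)%N (iota 0 n) = c.
Proof.
move=> cn; rewrite -{1}(subnKC cn) iotaD count_cat add0n.
rewrite (@eq_in_count _ _ predT) => [|i]; last by rewrite mem_iota/= add0n.
rewrite count_predT size_iota (@eq_in_count _ _ pred0) ?count_pred0 ?addn0// => i.
by rewrite mem_iota => /andP[]; rewrite leqNgt => /negbTE.
Qed.

Lemma count_le_n (p : pred nat) : (count p (iota 0 n) <= n)%N.
Proof. by rewrite -[X in (_ <= X)%N](size_iota 0) count_size. Qed.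

(* [sigma_perm] turns the [k]-th copula sample into the pair of order statistics
   whose ranks are the ranks of its two coordinates. *)
Lemma count_sigma x1 t1 u1 u2 x2 t2 D1 D2 :
  down_closed x1 t1 D1 -> down_closed x2 t2 D2 ->
  count (fun j => D1 j && D2 (sigma_perm n x1 t1 u1 u2 x2 t2 j)) (iota 0 n) =
  count (fun k => (rank n u1 (fun=> 0%R) k < count D1 (iota 0 n))%N &&
                  (rank n u2 (fun=> 0%R) k < count D2 (iota 0 n))%N) (iota 0 n).
Proof.
move=> d1 d2; set c1 := count D1 _; set c2 := count D2 _.
pose o : nat -> R := fun=> 0.
pose q := fun r => (r < c1)%N && (rank n u2 o (invrank n u1 o r) < c2)%N.
transitivity (count (fun j => q (rank n x1 t1 j)) (iota 0 n)).
  apply: eq_in_count => j; rewrite mem_iota add0n/= => jn.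
  have [k [kE kr]] := invrankP u1 o (rank_ord x1 t1 (Ordinal jn)).
  have [l [lE lr]] := invrankP x2 t2 (rank_ord u2 o k).
  rewrite /q /sigma_perm -/o [invrank n u1 o _]kE [invrank n x2 t2 _]lE.
  by rewrite (@down_closed_rank _ _ _ (Ordinal jn) d1) (down_closed_rank _ d2) lr.
(* The ranks of the first child run once through all [r], and so do the ranks of [u1]; substituting
   the latter for [r] cancels [invrank n u1]. *)
rewrite count_rank -(count_rank u1 o q); apply: eq_in_count => k.
by rewrite mem_iota add0n/= => kn; rewrite /q (@rankK _ _ (Ordinal kn)).
Qed.

(** Ranks take each value below [n] exactly once, so the two threshold indicators differ at exactly
    as many positions as the thresholds differ. *)
Lemma sum_rank_diff x t c c' : (c <= n)%N -> (c' <= n)%N ->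
  \sum_(k < n) `|(rank n x t k < c)%N%:R - (rank n x t k < c')%N%:R| =
  `|c%:R - c'%:R| :> R.
Proof.
wlog cc' : c c' / (c <= c')%N.
  move=> H; case/orP: (leq_total c c') => cc' cn cn'; first exact: H.
  by rewrite distrC -H//; apply: eq_bigr => k _; rewrite distrC.
move=> cn cn'; transitivity
  (\sum_(k < n) ((rank n x t k < c')%N%:R - (rank n x t k < c)%N%:R) : R).
  apply: eq_bigr => k _; have [rc|rc] := ltnP (rank n x t k) c.
    by rewrite (leq_trans rc cc') subrr normr0.
  by rewrite sub0r normrN subr0 normr_nat.
rewrite sumrB -!(@count_iota_sum R n (fun k => rank n x t k < _)%N).
rewrite !(count_rank x t (fun k => k < _)%N) !count_ltn//.
by rewrite distrC ger0_norm// subr_ge0 ler_nat.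
Qed.

(** By [count_sigma] both counts run over the copula samples and differ only in their two rank
    thresholds. A product of indicators changes by at most the sum of the changes of its factors,
    and [sum_rank_diff] adds these up. *)
Lemma count_sigma_approx x1 t1 u1 u2 x2 t2 D1 D2 E1 E2 :
  down_closed x1 t1 D1 -> down_closed x2 t2 D2 ->
  down_closed u1 (fun=> 0%R) E1 -> down_closed u2 (fun=> 0%R) E2 ->
  `|(count (fun j => D1 j && D2 (sigma_perm n x1 t1 u1 u2 x2 t2 j)) (iota 0 n))%:R
    - (count (fun k => E1 k && E2 k) (iota 0 n))%:R| <=
  `|(count D1 (iota 0 n))%:R - (count E1 (iota 0 n))%:R| +
  `|(count D2 (iota 0 n))%:R - (count E2 (iota 0 n))%:R| :> R.
Proof.
move=> d1 d2 e1 e2; rewrite count_sigma//.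
rewrite -[X in _ <= X + _](sum_rank_diff u1 (fun=> 0%R)) ?count_le_n//.
rewrite -[X in _ <= _ + X](sum_rank_diff u2 (fun=> 0%R)) ?count_le_n//.
rewrite [X in X - _]count_iota_sum [X in _ - X]count_iota_sum -sumrB -big_split/=.
apply: le_trans (ler_norm_sum _ _ _) _; apply: ler_sum => k _.
rewrite (down_closed_rank k e1) (down_closed_rank k e2).
by do 4![case: (_ < _)%N] => /=; 
  rewrite ?subrr ?subr0 ?sub0r ?normrN ?normr0 ?normr1 ?addr0 ?add0r ?lexx// ler_wpDr.
Qed.

Lemma sigma_perm_lt x1 t1 u1 u2 x2 t2 (j : 'I_n) :
  (sigma_perm n x1 t1 u1 u2 x2 t2 j < n)%N.
Proof.
rewrite /sigma_perm.
have [k [/= -> _]] := invrankP u1 (fun=> 0%R) (rank_ord x1 t1 j).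
by have [l [/= -> _]] := invrankP x2 t2 (rank_ord u2 (fun=> 0%R) k).
Qed.

(** The position enters [key_lt] only when both value and tie breaker coincide; without such double
    ties, permuting the batch permutes the ranks. *)
Lemma rank_relabel x t (pi : 'I_n -> 'I_n) (s : nat -> nat) (j : 'I_n) :
  injective pi ->
  (forall i : 'I_n, s i = pi i) ->
  (forall i : 'I_n, i != pi j -> ~ (x i = x (pi j) /\ t i = t (pi j))) ->
  rank n (x \o s) (t \o s) j = rank n x t (pi j).
Proof.
move=> pi_inj spi noties; rewrite /rank !count_iota_card.
rewrite -(fintype.card_image pi_inj); apply: eq_card => i.
have kE (k : 'I_n) : key_lt (x \o s) (t \o s) k j = key_lt x t (pi k) (pi j).
  rewrite /key_lt /= !spi; have [->|kj] := eqVneq k j; first by rewrite !ltnn.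
  have /noties : pi k != pi j by rewrite (inj_eq pi_inj).
  by case: eqP => //= ->; case: eqP => //= -> [].
apply/fintype.imageP/idP => [[k] /[!inE]|/[!inE]]; first by rewrite kE => ? ->.
by move=> ij; exists (invF pi_inj i); rewrite ?inE ?kE f_invF.
Qed.

End ranks.

(** * Probabilities and binomial moments *)

Lemma measurable_preimage d d' (T : measurableType d) (U : measurableType d')
    (f : T -> U) (A : set U) :
  measurable_fun setT f -> measurable A -> measurable (f @^-1` A).
Proof. by move=> mf mA; rewrite -[X in measurable X]setTI; exact: mf. Qed.

(** * Measurability of functions with countably many values *)

Section countable_valued.
Context (d : measure_display) (T : measurableType d).

(** Measurability for the discrete sigma-algebra on the codomain; ranks, inverse ranks and counts
    then compose through arbitrary maps. *)
Definition sets_measurable (X : Type) (f : T -> X) :=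
  forall S : set X, measurable (f @^-1` S).

Lemma sets_measurable_cst (X : Type) (x : X) : sets_measurable (fun=> x).
Proof.
move=> S; have [Sx|nSx] := pselect (S x).
  by rewrite (_ : _ @^-1` _ = setT)//; apply/seteqP; split.
by rewrite (_ : _ @^-1` _ = set0)//; apply/seteqP; split.
Qed.

Lemma sets_measurable_bool (b : T -> bool) :
  measurable [set w | b w] -> sets_measurable b.
Proof.
move=> mb S.
rewrite (_ : _ @^-1` _ = ([set w | b w] `&` (fun=> true) @^-1` S) `|`
  (~` [set w | b w] `&` (fun=> false) @^-1` S)).
  apply: measurableU; apply: measurableI => //; last 2 first.
  - exact: measurableC.
  - exact: sets_measurable_cst.
  exact: sets_measurable_cst.
apply/seteqP; split => w /=.
  by case: (b w) => ?; [left|right].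
by case: (b w) => -[] [].
Qed.

(** Partition by the countably many values of [f]. This covers evaluation at a random index, as in
    the reordered second child. *)
Lemma sets_measurable_fun (X : countType) d' (Y : measurableType d')
    (f : T -> X) (g : X -> T -> Y) :
  sets_measurable f -> (forall x, measurable_fun setT (g x)) ->
  measurable_fun setT (fun w => g (f w) w).
Proof.
move=> mf mg _ S mS; rewrite setTI (_ : _ @^-1` S =
    \bigcup_x (f @^-1` [set x] `&` g x @^-1` S)).
  apply: countable_bigcupT_measurable => // x; apply: measurableI; first exact: mf.
  by rewrite -[X in measurable X]setTI; exact: mg.
by apply/seteqP; split => [w Sw|w [x _ [/= -> //]]]; exists (f w).
Qed.

Lemma sets_measurable_bind (X : countType) (Y : Type) (f : T -> X) (g : X -> T -> Y) :
  sets_measurable f -> (forall x, sets_measurable (g x)) ->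
  sets_measurable (fun w => g (f w) w).
Proof.
move=> mf mg S; rewrite (_ : _ @^-1` S =
    \bigcup_x (f @^-1` [set x] `&` g x @^-1` S)).
  by apply: countable_bigcupT_measurable => // x; apply: measurableI; [exact: mf|exact: mg].
by apply/seteqP; split => [w Sw|w [x _ [/= -> //]]]; exists (f w).
Qed.

Lemma sets_measurable2 (X Y : countType) (Z : Type) (h : X -> Y -> Z)
    (f : T -> X) (g : T -> Y) :
  sets_measurable f -> sets_measurable g ->
  sets_measurable (fun w => h (f w) (g w)).
Proof.
move=> mf mg; apply: (sets_measurable_bind (g := fun x w => h x (g w))) => // x.
apply: (sets_measurable_bind (g := fun y _ => h x y)) => // y.
exact: sets_measurable_cst.
Qed.

Lemma sets_measurable_count (b : nat -> T -> bool) (s : seq nat) :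
  (forall k, sets_measurable (b k)) ->
  sets_measurable (fun w => count (fun k => b k w) s).
Proof.
move=> mb; elim: s => [|k s IH] /=; first exact: sets_measurable_cst.
exact: (sets_measurable2 (fun (x : bool) y => (x + y)%N)).
Qed.

Lemma sets_measurable_find (b : nat -> T -> bool) (s : seq nat) :
  (forall k, sets_measurable (b k)) ->
  sets_measurable (fun w => find (fun k => b k w) s).
Proof.
move=> mb; elim: s => [|k s IH] /=; first exact: sets_measurable_cst.
exact: (sets_measurable2 (fun (x : bool) y => if x then 0%N else y.+1)).
Qed.

End countable_valued.

Section prob.
Context (R : realType) (d : measure_display) (T : measurableType d).
Variable P : probability T R.

Definition pr (A : set T) : R := fine (P A).

Lemma prE A : measurable A -> P A = (pr A)%:E.
Proof. by move=> mA; rewrite /pr fineK// fin_num_measure. Qed.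

Lemma pr_ge0 A : 0 <= pr A. Proof. by rewrite fine_ge0. Qed.

Lemma pr_setT : pr setT = 1. Proof. by rewrite /pr probability_setT. Qed.

Lemma pr_set0 : pr set0 = 0. Proof. by rewrite /pr measure0. Qed.

Lemma pr_setID A B : measurable A -> measurable B ->
  pr A = pr (A `&` B) + pr (A `\` B).
Proof.
move=> mA mB; apply: EFin_inj.
rewrite EFinD -!prE//; [|exact: measurableD|exact: measurableI].
by rewrite addeC; exact: measureDI.
Qed.

Lemma pr_le A B : measurable A -> measurable B -> A `<=` B -> pr A <= pr B.
Proof.
move=> mA mB AB; rewrite [leRHS](pr_setID mB mA) setIC setIidl//.
by rewrite lerDl pr_ge0.
Qed.

Lemma pr_le1 A : measurable A -> pr A <= 1.
Proof. by move=> mA; rewrite -pr_setT; apply: pr_le. Qed.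

Lemma pr_setC A : measurable A -> pr (~` A) = 1 - pr A.
Proof.
by move=> mA; rewrite -pr_setT (pr_setID measurableT mA) setTI setTD addrC addKr.
Qed.

Lemma pr_setU A B : measurable A -> measurable B ->
  pr (A `|` B) <= pr A + pr B.
Proof.
move=> mA mB; rewrite (@pr_setID _ A)//; last exact: measurableU.
rewrite setUK lerD2l; apply: pr_le => //.
  by apply: measurableD => //; exact: measurableU.
by move=> w [[]].
Qed.

Lemma pr_setU_disj A B : measurable A -> measurable B -> A `&` B = set0 ->
  pr (A `|` B) = pr A + pr B.
Proof.
move=> mA mB AB0; rewrite (@pr_setID _ A)//; last exact: measurableU.
by rewrite setUK setDUl setDv set0U (_ : B `\` A = B)//
  setDE setIidl// => w Bw Aw; rewrite -[False]/(set0 w) -AB0.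
Qed.

Lemma pr_indep A B : measurable A -> measurable B ->
  P (A `&` B) = (P A * P B)%E -> pr (A `&` B) = pr A * pr B.
Proof.
move=> mA mB h; apply: EFin_inj.
by rewrite EFinM -!prE//; exact: measurableI.
Qed.

End prob.

Section binomial_moments.
Context (R : realType) (p : R).
Hypothesis p01 : 0 <= p <= 1.

(* Expectation of [phi] under the binomial distribution with parameters [m, p]. *)
Fixpoint binE (m : nat) (phi : nat -> R) : R :=
  if m is m'.+1 then (1 - p) * binE m' phi + p * binE m' (phi \o S) else phi 0%N.

Lemma binE_linear m a b phi psi :
  binE m (fun r => a * phi r + b * psi r) = a * binE m phi + b * binE m psi.
Proof.
elim: m phi psi => [//|m IH] phi psi /=.
by rewrite IH (_ : _ \o S = fun r => a * (phi \o S) r + b * (psi \o S) r)// IH; ring.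
Qed.

Lemma eq_binE m phi psi : phi =1 psi -> binE m phi = binE m psi.
Proof. by move=> /funext ->. Qed.

Lemma binE_cst m c : binE m (fun=> c) = c.
Proof.
elim: m => [//|m IH] /=; rewrite (_ : _ \o S = fun=> c)// IH; ring.
Qed.

Lemma ler_binE m phi psi : (forall r, phi r <= psi r) ->
  binE m phi <= binE m psi.
Proof.
elim: m phi psi => [|m IH] phi psi le //=.
have [p0 p1] := andP p01.
by apply: lerD; apply: ler_wpM2l; rewrite ?subr_ge0//; apply: IH => r; exact: le.
Qed.

(** The moments are treated together because conditioning on one trial expresses the fourth centred
    moment through the first and second as well. *)
Lemma binE_moments m :
  [/\ binE m (fun r => r%:R - m%:R * p) = 0,
      binE m (fun r => (r%:R - m%:R * p) ^+ 2) = m%:R * (p * (1 - p)) &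
      binE m (fun r => (r%:R - m%:R * p) ^+ 4) <= m%:R ^+ 2].
Proof.
have [p0 p1] := andP p01.
elim: m => [|m [IH1 IH2 IH4]]; first by rewrite /= !mul0r subrr !expr0n.
pose x r : R := r%:R - m%:R * p.
have x1 (r : nat) : r%:R - m.+1%:R * p = x r - p by rewrite /x -natr1; ring.
have xS (r : nat) : r.+1%:R - m.+1%:R * p = x r + (1 - p).
  by rewrite /x -!natr1; ring.
have lin3 a b c phi psi : binE m (fun r => a * phi r + b * psi r + c) =
    a * binE m phi + b * binE m psi + c.
  transitivity (binE m (fun r => 1 * (a * phi r + b * psi r) + c * 1)).
    by apply: eq_binE => r; rewrite mul1r mulr1.
  by rewrite binE_linear binE_linear binE_cst mul1r mulr1.
rewrite -/x in IH1 IH2 IH4; split => /=.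
- rewrite (@eq_binE _ _ (fun r => 1 * x r + 0 * x r + (- p))); last first.
    by move=> r; rewrite x1; ring.
  rewrite (@eq_binE _ (_ \o S) (fun r => 1 * x r + 0 * x r + (1 - p))); last first.
    by move=> r /=; rewrite xS; ring.
  by rewrite !lin3 IH1; ring.
- rewrite (@eq_binE _ _ (fun r => 1 * x r ^+ 2 + (- 2 * p) * x r + p ^+ 2)); last first.
    by move=> r; rewrite x1; ring.
  rewrite (@eq_binE _ (_ \o S)
    (fun r => 1 * x r ^+ 2 + (2 * (1 - p)) * x r + (1 - p) ^+ 2)); last first.
    by move=> r /=; rewrite xS; ring.
  by rewrite !lin3 IH1 IH2 -natr1; ring.
- have quartic a4 a3 a2 a1 a0 : binE m (fun r =>
      a4 * x r ^+ 4 + a3 * x r ^+ 3 + a2 * x r ^+ 2 + a1 * x r + a0) =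
      a4 * binE m (fun r => x r ^+ 4) + a3 * binE m (fun r => x r ^+ 3) +
      a2 * binE m (fun r => x r ^+ 2) + a1 * binE m x + a0.
    transitivity (binE m (fun r => 1 * (1 * (a4 * x r ^+ 4 + a3 * x r ^+ 3) +
        1 * (a2 * x r ^+ 2 + a1 * x r)) + a0 * 1)).
      by apply: eq_binE => r; ring.
    by rewrite !binE_linear binE_cst; ring.
  rewrite (@eq_binE _ _ (fun r => 1 * x r ^+ 4 + (- (4 * p)) * x r ^+ 3 +
    (6 * p ^+ 2) * x r ^+ 2 + (- (4 * p ^+ 3)) * x r + p ^+ 4)); last first.
    by move=> r; rewrite x1; ring.
  rewrite (@eq_binE _ (_ \o S) (fun r => 1 * x r ^+ 4 + (4 * (1 - p)) * x r ^+ 3 +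
    (6 * (1 - p) ^+ 2) * x r ^+ 2 + (4 * (1 - p) ^+ 3) * x r + (1 - p) ^+ 4));
    last first.
    by move=> r /=; rewrite xS; ring.
  rewrite !quartic IH1 IH2.
  (* The third moment enters with coefficient [- 4 p (1 - p) + 4 p (1 - p) = 0], so its value is
     irrelevant. The increment of the fourth moment is [6 m (p (1 - p))^2] plus the term bounded in
     [p4], which is below [2 m + 1] since [p (1 - p) <= 1 / 4]. *)
  set c := binE m (fun r => x r ^+ 3).
  have m0 : 0 <= m%:R :> R by [].
  have pq : p * (1 - p) <= 1 / 4 by have := sqr_ge0 (p - 1 / 2); lra.
  have pq0 : 0 <= p * (1 - p) by rewrite mulr_ge0// subr_ge0.
  have pq2 : (p * (1 - p)) * (p * (1 - p)) <= 1 / 16.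
    have -> : 1 / 16 = 1 / 4 * (1 / 4) :> R by field.
    exact: ler_pM.
  have p4 : (1 - p) * p ^+ 4 + p * (1 - p) ^+ 4 <= p * (1 - p).
    have -> : (1 - p) * p ^+ 4 + p * (1 - p) ^+ 4 =
      p * (1 - p) * (1 - 3 * (p * (1 - p))) by ring.
    by rewrite -[leRHS]mulr1 ler_wpM2l//; lra.
  have mpq : m%:R * ((p * (1 - p)) * (p * (1 - p))) <= m%:R * (1 / 16) by rewrite ler_wpM2l.
  rewrite -natr1; nra.
Qed.

End binomial_moments.

(** * Fourth-moment concentration of success counts *)

Section concentration.
Context (R : realType) (d : measure_display) (T : measurableType d).
Variable P : probability T R.
Variables (D : nat -> T -> bool) (p : R) (n : nat).
Hypothesis mD : forall k, measurable [set w | D k w].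
Hypothesis indD : mutual_indep P (fun k => [set [set w | D k w]]).
Hypothesis pD : forall k, (k < n)%N -> pr P [set w | D k w] = p.
Hypothesis p01 : 0 <= p <= 1.

Local Notation N m w := (count (fun k => D k w) (iota 0 m)).
Local Notation inter J := (\bigcap_(k in [set k : nat | List.In k J]) [set w | D k w]).

Let inter_cons m J : inter (m :: J) = [set w | D m w] `&` inter J.
Proof.
apply/seteqP; split => [x h|x [h1 h2] k /= [<-//|]]; last exact: h2.
by split => [|k kJ]; apply: h => /=; [left|right].
Qed.

Let measurable_inter J : measurable (inter J).
Proof.
elim: J => [|k J IH]; last by rewrite inter_cons; exact: measurableI.
by rewrite (_ : inter _ = setT)//; apply/seteqP; split => // x _ i [].
Qed.

Let measurable_N m (S : pred nat) : measurable [set w | S (N m w)].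
Proof.
apply: (@sets_measurable_count _ _ _ (iota 0 m) _ [set r | S r]) => k.
exact: sets_measurable_bool.
Qed.

Let inter_step m J : (m < n)%N -> List.NoDup J ->
  (forall k, List.In k J -> (m < k)%N) ->
  pr P (inter (m :: J)) = p * pr P (inter J).
Proof.
move=> mn ndJ mJ.
have nd : List.NoDup (m :: J) by constructor => // /mJ; rewrite ltnn.
rewrite -(pD mn); apply: EFin_inj; rewrite EFinM -!prE//.
rewrite (indD nd); last by move=> k _.
by rewrite (indD ndJ) ?big_cons//; move=> k _.
Qed.

(** Only success events belong to the independent family, so failure of trial [m] is reached as a
    difference. For this the induction carries along the event that all later trials in [J]
    succeed. *)
Lemma count_binomial m J (S : pred nat) : (m <= n)%N -> List.NoDup J ->
  (forall k, List.In k J -> (m <= k)%N) ->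
  pr P ([set w | S (N m w)] `&` inter J) =
  binE p m (fun r => (S r)%:R) * pr P (inter J).
Proof.
elim: m J S => [|m IH] J S mn ndJ mJ.
  rewrite /=; have [S0|nS0] := boolP (S 0%N).
    rewrite mul1r; congr (pr P _); apply/seteqP; split; first by move=> w [].
    by move=> w.
  rewrite mul0r (_ : _ `&` _ = set0) ?pr_set0//.
  by apply/seteqP; split => // w [].
have mJ' k : List.In k J -> (m <= k)%N by move=> /mJ /ltnW.
have ndmJ : List.NoDup (m :: J) by constructor => // /mJ; rewrite ltnn.
have mmJ k : List.In k (m :: J) -> (m <= k)%N by case=> [<-//|/mJ'].
have NS w : N m.+1 w = (N m w + D m w)%N by rewrite -addn1 iotaD count_cat/= addn0.
have -> : [set w | S (N m.+1 w)] = [set w | S (N m w + D m w)%N].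
  by apply/funext => w; rewrite /mkset NS.
rewrite (@pr_setID _ _ _ _ _ [set w | D m w])//; last first.
  apply: measurableI => //; have := measurable_N m.+1 S.
  by congr measurable; apply/funext => w; rewrite /mkset NS.
rewrite [X in pr P X + _](_ : _ = [set w | (S \o succn) (N m w)] `&` inter (m :: J)); last first.
  rewrite inter_cons; apply/seteqP; split => w /=.
    by case=> -[Sw Jw] Dw; rewrite Dw addn1 in Sw.
  by case=> Sw [Dw Jw]; rewrite Dw addn1.
rewrite [X in _ + pr P X](_ : _ =
    ([set w | S (N m w)] `&` inter J) `\` [set w | D m w]); last first.
  apply/seteqP; split => w /=.
    by case=> -[Sw Jw] /negP/negbTE Dw; rewrite Dw addn0 in Sw; split => //; rewrite Dw.
  by case=> -[Sw Jw] /negP/negbTE Dw; rewrite Dw addn0; split => // -[].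
have := @pr_setID _ _ _ P ([set w | S (N m w)] `&` inter J) _
  (measurableI _ _ (measurable_N m S) (measurable_inter J)) (mD m).
rewrite -setIA (setIC (inter J)) -inter_cons.
rewrite !IH// ?(ltnW mn)// inter_step// => h.
have -> : pr P (([set w | S (N m w)] `&` inter J) `\` [set w | D m w]) =
  binE p m (fun r => (S r)%:R) * pr P (inter J)
  - binE p m (fun r => (S r)%:R) * (p * pr P (inter J)) by rewrite h; ring.
by rewrite /=; ring.
Qed.

(** Markov's inequality for the fourth power of the deviation, whose expectation is at most
    [n^2]. *)
Lemma count_concentration (eps : R) : (0 < n)%N -> 0 < eps ->
  pr P [set w | eps * n%:R <= `|(N n w)%:R - n%:R * p|] <= (eps ^+ 4 * n%:R ^+ 2)^-1.
Proof.
move=> n0 e0; pose S : pred nat := fun r => eps * n%:R <= `|r%:R - n%:R * p|.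
have inter0 : inter nil = setT by apply/seteqP; split => // x _ i [].
have := @count_binomial n nil S (leqnn n) (List.NoDup_nil _) (fun _ => False_ind _).
rewrite inter0 setIT pr_setT mulr1 => ->.
have n0' : 0 < n%:R :> R by rewrite ltr0n.
have en : 0 < eps * n%:R by rewrite mulr_gt0.
pose c := ((eps * n%:R) ^+ 4)^-1.
apply: (@le_trans _ _ (binE p n (fun r => c * (r%:R - n%:R * p) ^+ 4 + 0 * 0))).
  apply: ler_binE => // r; rewrite mul0r addr0.
  have c0 : 0 <= c by rewrite invr_ge0 exprn_ge0// ltW.
  have [Sr|_] := boolP (S r); last by rewrite mulr_ge0// exprn_even_ge0.
  rewrite /c mulrC ler_pdivlMr ?exprn_gt0// mul1r.
  rewrite -[leRHS]ger0_norm ?exprn_even_ge0// normrX.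
  by rewrite ler_pXn2r// ?nnegrE ?ltW.
rewrite binE_linear mul0r addr0.
have [_ _ m4] := binE_moments p01 n.
apply: (@le_trans _ _ (c * n%:R ^+ 2)).
  by rewrite ler_wpM2l// invr_ge0 exprn_ge0// ltW.
rewrite /c le_eqVlt; apply/orP; left; apply/eqP; field.
by rewrite !gt_eqF.
Qed.

End concentration.

(** * Joint laws of independent families *)

Section joint_law.
Context (R : realType) (I : Type).
Implicit Types (J : seq I).

Definition le2 (y x : R * R) := (y.1 <= x.1) && (y.2 <= x.2).

(** Scalar sources are pairs with second coordinate 0, so that one index type carries scalars,
    copula samples and outputs of node (1) alike. *)
Definition orthants : set (set (I -> R * R)) :=
  [set X | exists J a, X = [set f | forall i, List.In i J -> le2 (f i) (a i)]].

Definition coords := g_sigma_algebraType orthants.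

Lemma orthantsI : setI_closed orthants.
Proof.
move=> _ _ [J [a ->]] [J' [a' ->]].
(* Where both orthants constrain an index the bounds combine by [min]; elsewhere the only bound
   present is kept. *)
pose b i := if `[< List.In i J >] then
    if `[< List.In i J' >] then (Num.min (a i).1 (a' i).1, Num.min (a i).2 (a' i).2)
    else a i else a' i.
exists (J ++ J')%SEQ, b; apply/seteqP; split => f /=.
  move=> [fJ fJ'] i; rewrite /b => /List.in_app_iff iJJ'.
  case: asboolP => iJ; last by case: iJJ' => // /fJ'.
  case: asboolP => iJ'; last exact: fJ.
  have /andP[f1 f2] := fJ _ iJ; have /andP[f1' f2'] := fJ' _ iJ'.
  by rewrite /le2 /= !le_min f1 f2 f1' f2'.
move=> fb; split => i iJ.
  have := fb i (List.in_or_app _ _ _ (or_introl iJ)); rewrite /b.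
  case: asboolP => // _; case: asboolP => // iJ'.
  by rewrite /le2 /= !le_min => /andP[/andP[-> _] /andP[-> _]].
have := fb i (List.in_or_app _ _ _ (or_intror iJ)); rewrite /b.
case: asboolP => // iJ'; case: asboolP => // _.
by rewrite /le2 /= !le_min => /andP[/andP[_ ->] /andP[_ ->]].
Qed.

Lemma measurable_fun_le d (T : measurableType d) (f : T -> R) :
  (forall x, measurable [set w | f w <= x]) -> measurable_fun setT f.
Proof.
move=> mf; apply: (measurability _ (RGenOInfty.measurableE R)).
move=> _ [_ [x ->] <-]; rewrite setTI.
rewrite (_ : _ @^-1` _ = ~` [set w | f w <= x]); first exact: measurableC.
by apply/seteqP; split => w /=; rewrite in_itv/= andbT ltNge => /negP.
Qed.

Lemma measurable_fun_le2 d (T : measurableType d) (f : T -> R * R) :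
  (forall a, measurable [set w | le2 (f w) a]) -> measurable_fun setT f.
Proof.
move=> mf; apply/measurable_fun_pairP; split; apply: measurable_fun_le => x /=.
  rewrite (_ : [set _ | _] = \bigcup_m [set w | le2 (f w) (x, m%:R)]).
    exact: bigcupT_measurable.
  apply/seteqP; split => w /=; last by case=> m _ /andP[].
  have [m mx] : exists m : nat, (f w).2 <= m%:R.
    by exists (Num.truncn `|(f w).2|).+1; apply/ltW/(le_lt_trans (ler_norm _))/truncnS_gt.
  by exists m => //; apply/andP.
rewrite (_ : [set _ | _] = \bigcup_m [set w | le2 (f w) (m%:R, x)]).
  exact: bigcupT_measurable.
apply/seteqP; split => w /=; last by case=> m _ /andP[].
have [m mx] : exists m : nat, (f w).1 <= m%:R.
  by exists (Num.truncn `|(f w).1|).+1; apply/ltW/(le_lt_trans (ler_norm _))/truncnS_gt.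
by exists m => //; apply/andP.
Qed.

Lemma coord_measurable (i : I) : measurable_fun setT (fun f : coords => f i).
Proof.
apply: measurable_fun_le2 => a; apply: sub_sigma_algebra.
exists [:: i], (fun=> a); apply/seteqP; split => f /=; first by move=> fa k [<-|].
by move=> fa; apply: (fa i); left.
Qed.

Lemma le2_measurable a0 : measurable [set x : R * R | le2 x a0].
Proof.
rewrite (_ : [set _ | _] = `]-oo, a0.1]%classic `*` `]-oo, a0.2]%classic).
  by apply: measurableX.
by apply/seteqP; split => x /=; rewrite !in_itv/= => /andP.
Qed.

Context (d : measure_display) (T : measurableType d) (P : probability T R).
Implicit Types xi : I -> T -> R * R.

Lemma family_measurable xi : (forall i, measurable_fun setT (xi i)) ->
  measurable_fun setT (fun w => (fun i => xi i w) : coords).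
Proof.
move=> mxi; apply: (@measurability _ _ T coords setT _ orthants erefl) => _ [_ [J [a ->]] <-].
rewrite setTI; elim: J => [|i J IH].
  by rewrite (_ : _ @^-1` _ = setT)//; apply/seteqP; split => // w _ i [].
rewrite (_ : _ @^-1` _ = xi i @^-1` [set x | le2 x (a i)] `&`
  (fun w i => xi i w) @^-1` [set f | forall i, List.In i J -> le2 (f i) (a i)]).
  apply: measurableI => //; rewrite -[X in measurable X]setTI.
  by apply: mxi => //; exact: le2_measurable.
apply/seteqP; split => w /=.
  by move=> h; split => [|k kJ]; apply: h; [left|right].
by case=> h1 h2 k [<-//|/h2].
Qed.

Lemma rv_eventsT d' (U : measurableType d') (X : T -> U) : rv_events X setT.
Proof. by exists setT => //=; exact: measurableT. Qed.

Lemma rv_eventsI d' (U : measurableType d') (X : T -> U) :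
  setI_closed (rv_events X).
Proof.
by move=> _ _ [A mA <-] [B mB <-]; exists (A `&` B) => //; exact: measurableI.
Qed.

Lemma rv_events_measurable d' (U : measurableType d') (X : T -> U) :
  measurable_fun setT X -> rv_events X `<=` measurable.
Proof.
by move=> mX _ [B mB <-]; rewrite -[X in measurable X]setTI; exact: mX.
Qed.

(** On an orthant independence gives a product of marginal values, which agree; orthants are a
    π-system generating the coordinates. *)
Lemma joint_law_unique xi xi' (S : set coords) :
  (forall i, measurable_fun setT (xi i)) -> (forall i, measurable_fun setT (xi' i)) ->
  mutual_indep P (fun i => rv_events (xi i)) ->
  mutual_indep P (fun i => rv_events (xi' i)) ->
  (forall i a, P [set w | le2 (xi i w) a] = P [set w | le2 (xi' i w) a]) ->
  measurable S ->
  P [set w | S (fun i => xi i w)] = P [set w | S (fun i => xi' i w)].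
Proof.
move=> mxi mxi' ind ind' eqP mS.
pose X : {mfun T >-> coords} := mfun_Sub (mem_set (family_measurable mxi)).
pose X' : {mfun T >-> coords} := mfun_Sub (mem_set (family_measurable mxi')).
apply: (@g_sigma_algebra_measure_unique _ _ coords orthants _ (fun=> setT) _ _
  (distribution P X) (distribution P X') orthantsI _ _ S mS).
- by move=> A GA; exact: sub_sigma_algebra.
- move=> _; exists nil, (fun=> 0); apply/seteqP; split => // f _ i [].
- by apply/seteqP; split => // f _; exists 0%N.
- move=> _ [J0 [a ->]].
  have [J [ndJ JJ0]] := nodup_exists J0.
  have E (x : I -> T -> R * R) :
      [set w | forall i, List.In i J0 -> le2 (x i w) (a i)] =
      \bigcap_(i in [set i | List.In i J]) (x i @^-1` [set y | le2 y (a i)]).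
    by apply/seteqP; split => w h i /JJ0 iJ; exact: h.
  transitivity (\prod_(i <- J) P [set w | le2 (xi i w) (a i)])%E.
    rewrite -ind//; last first.
      by move=> i _; exists [set y | le2 y (a i)] => //; exact: le2_measurable.
    by rewrite -[RHS](congr1 P (E xi)).
  transitivity (\prod_(i <- J) P [set w | le2 (xi' i w) (a i)])%E.
    by apply: eq_bigr => i _.
  rewrite -ind'//; last first.
    by move=> i _; exists [set y | le2 y (a i)] => //; exact: le2_measurable.
  by rewrite -[LHS](congr1 P (E xi')).
- by move=> _; rewrite -[X in (X < _)%E]/(P setT) probability_setT ltry.
Qed.

End joint_law.

(** * A branching node *)

Section rank_measurability.
Context (R : realType) (d : measure_display) (T : measurableType d).

Lemma sets_measurable_fbool (b : T -> bool) :
  measurable_fun setT b -> sets_measurable b.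
Proof.
move=> mb; apply: sets_measurable_bool.
rewrite (_ : [set w | b w] = setT `&` b @^-1` [set true]); first exact: mb.
by rewrite setTI; apply/seteqP; split => w.
Qed.

Lemma sets_measurable_key_lt (x t : nat -> T -> R) j k :
  (forall i, measurable_fun setT (x i)) -> (forall i, measurable_fun setT (t i)) ->
  sets_measurable (fun w => key_lt (x^~ w) (t^~ w) j k).
Proof.
move=> mx mt; rewrite /key_lt.
have mlt (y : nat -> T -> R) : (forall i, measurable_fun setT (y i)) ->
    sets_measurable (fun w => y j w < y k w).
  by move=> my; apply: sets_measurable_fbool; exact: measurable_fun_ltr.
have meq (y : nat -> T -> R) : (forall i, measurable_fun setT (y i)) ->
    sets_measurable (fun w => y j w == y k w).
  by move=> my; apply: sets_measurable_fbool; exact: measurable_fun_eqr.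
apply: (sets_measurable2 orb); first exact: mlt.
apply: (sets_measurable2 andb); first exact: meq.
apply: (sets_measurable2 orb); first exact: mlt.
apply: (sets_measurable2 andb); first exact: meq.
exact: sets_measurable_cst.
Qed.

Lemma sets_measurable_rank n (x t : nat -> T -> R) k :
  (forall i, measurable_fun setT (x i)) -> (forall i, measurable_fun setT (t i)) ->
  sets_measurable (fun w => rank n (x^~ w) (t^~ w) k).
Proof.
move=> mx mt; apply: (@sets_measurable_count _ _ (fun j w => key_lt (x^~ w) (t^~ w) j k)) => j.
exact: sets_measurable_key_lt.
Qed.

Lemma sets_measurable_invrank n (x t : nat -> T -> R) r :
  (forall i, measurable_fun setT (x i)) -> (forall i, measurable_fun setT (t i)) ->
  sets_measurable (fun w => invrank n (x^~ w) (t^~ w) r).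
Proof.
move=> mx mt.
apply: (@sets_measurable_find _ _ (fun j w => rank n (x^~ w) (t^~ w) j == r)) => j.
apply: (sets_measurable2 (fun a b : nat => a == b)); last exact: sets_measurable_cst.
exact: sets_measurable_rank.
Qed.

Lemma sets_measurable_sigma n (x1 t1 u1 u2 x2 t2 : nat -> T -> R) j :
  (forall i, measurable_fun setT (x1 i)) -> (forall i, measurable_fun setT (t1 i)) ->
  (forall i, measurable_fun setT (u1 i)) -> (forall i, measurable_fun setT (u2 i)) ->
  (forall i, measurable_fun setT (x2 i)) -> (forall i, measurable_fun setT (t2 i)) ->
  sets_measurable (fun w => sigma_perm n (x1^~ w) (t1^~ w) (u1^~ w) (u2^~ w)
    (x2^~ w) (t2^~ w) j).
Proof.
move=> mx1 mt1 mu1 mu2 mx2 mt2; rewrite /sigma_perm.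
have m0 (i : nat) : measurable_fun setT (fun=> 0 : R) by exact: measurable_cst.
apply: (@sets_measurable_bind _ _ _ _
  (fun w => rank n (u2^~ w) (fun=> 0) (invrank n (u1^~ w) (fun=> 0)
      (rank n (x1^~ w) (t1^~ w) j)))
  (fun r w => invrank n (x2^~ w) (t2^~ w) r)); last first.
  by move=> r; exact: sets_measurable_invrank.
apply: (@sets_measurable_bind _ _ _ _
  (fun w => invrank n (u1^~ w) (fun=> 0) (rank n (x1^~ w) (t1^~ w) j))
  (fun r w => rank n (u2^~ w) (fun=> 0) r)); last first.
  by move=> r; exact: (@sets_measurable_rank _ _ (fun _ _ => 0)).
apply: (@sets_measurable_bind _ _ _ _
  (fun w => rank n (x1^~ w) (t1^~ w) j)
  (fun r w => invrank n (u1^~ w) (fun=> 0) r)); last first.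
  by move=> r; exact: (@sets_measurable_invrank _ _ (fun _ _ => 0)).
exact: sets_measurable_rank.
Qed.

End rank_measurability.

(* The randomness of one branching node: payload of the first child (whose value is
   the sum of its two components), its tie breaker, copula sample, value and tie
   breaker of the second child. Scalars are stored in the first component. *)
Inductive node_src := NY of nat | NT of nat | NW of nat | NZ of nat | NS of nat.

Definition src_pos (s : node_src) : nat :=
  match s with NY i | NT i | NW i | NZ i | NS i => i end.

Section node.
Context (R : realType).
Implicit Types f : node_src -> R * R.

Definition node_sigma n f :=
  sigma_perm n (fun i => (f (NY i)).1 + (f (NY i)).2) (fun i => (f (NT i)).1)
    (fun i => (f (NW i)).1) (fun i => (f (NW i)).2)
    (fun i => (f (NZ i)).1) (fun i => (f (NS i)).1).

Definition node_out n f (j : nat) : R * R * R :=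
  (f (NY j), (f (NZ (node_sigma n f j))).1).

Lemma measurable_node_out d (T : measurableType d) (xi : node_src -> T -> R * R) n j :
  (forall s, measurable_fun setT (xi s)) ->
  measurable_fun setT (fun w => node_out n (xi^~ w) j).
Proof.
move=> mxi; have m1 s : measurable_fun setT (fun w => (xi s w).1).
  exact: measurableT_comp measurable_fst (mxi s).
have m2 s : measurable_fun setT (fun w => (xi s w).2).
  exact: measurableT_comp measurable_snd (mxi s).
apply: measurable_fun_pair => //.
apply: (@sets_measurable_fun _ _ _ _ _ (fun w => node_sigma n (xi^~ w) j)
  (fun i w => (xi (NZ i) w).1)) => //.
apply: (@sets_measurable_sigma _ _ _ n (fun i w => (xi (NY i) w).1 + (xi (NY i) w).2)
  (fun i w => (xi (NT i) w).1) (fun i w => (xi (NW i) w).1)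
  (fun i w => (xi (NW i) w).2) (fun i w => (xi (NZ i) w).1)
  (fun i w => (xi (NS i) w).1)) => // i.
exact: measurable_funD.
Qed.

Lemma eq_rank n (x t x' t' : nat -> R) k : (k < n)%N ->
  (forall i, (i < n)%N -> x i = x' i) -> (forall i, (i < n)%N -> t i = t' i) ->
  rank n x t k = rank n x' t' k.
Proof.
move=> kn xx' tt'; apply: eq_in_count => j; rewrite mem_iota add0n/= => jn.
by rewrite /key_lt !xx' ?tt'.
Qed.

Lemma eq_invrank n (x t x' t' : nat -> R) r :
  (forall i, (i < n)%N -> x i = x' i) -> (forall i, (i < n)%N -> t i = t' i) ->
  invrank n x t r = invrank n x' t' r.
Proof.
move=> xx' tt'; apply: eq_in_find => j; rewrite mem_iota add0n/= => jn.
by rewrite (eq_rank jn xx' tt').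
Qed.

(** Ranks read only positions below [n], and every position they lead to is again below [n]; sources
    at larger positions may therefore be replaced freely. *)
Lemma eq_node_out n f f' j : (j < n)%N ->
  (forall s, (src_pos s < n)%N -> f s = f' s) -> node_out n f j = node_out n f' j.
Proof.
move=> jn ff'; have NYf i : (i < n)%N -> f (NY i) = f' (NY i) by exact: (ff' (NY i)).
have NTf i : (i < n)%N -> f (NT i) = f' (NT i) by exact: (ff' (NT i)).
have NWf i : (i < n)%N -> f (NW i) = f' (NW i) by exact: (ff' (NW i)).
have NZf i : (i < n)%N -> f (NZ i) = f' (NZ i) by exact: (ff' (NZ i)).
have NSf i : (i < n)%N -> f (NS i) = f' (NS i) by exact: (ff' (NS i)).
have sE : node_sigma n f j = node_sigma n f' j.
  rewrite /node_sigma /sigma_perm.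
  rewrite (@eq_rank n _ _ (fun i => (f' (NY i)).1 + (f' (NY i)).2)
    (fun i => (f' (NT i)).1) j) => [|//|i /NYf ->//|i /NTf ->//].
  rewrite (@eq_invrank n (fun i => (f (NW i)).1) _ (fun i => (f' (NW i)).1) (fun=> 0))
    => [|i /NWf ->//|//].
  rewrite (@eq_invrank n (fun i => (f (NZ i)).1) _ (fun i => (f' (NZ i)).1)
    (fun i => (f' (NS i)).1)) => [|i /NZf ->//|i /NSf ->//].
  congr (invrank _ _ _ _).
  set r := rank _ _ _ j.
  have rn : (r < n)%N by exact: (@rank_lt R n _ _ (Ordinal jn)).
  have [k [kE _]] := invrankP (fun i => (f' (NW i)).1) (fun=> 0) (Ordinal rn).
  rewrite [invrank _ _ _ _]kE.
  by apply: eq_rank => // i /NWf ->.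
rewrite /node_out sE NYf// NZf//.
exact: (@sigma_perm_lt R n _ _ _ _ _ _ (Ordinal jn)).
Qed.

End node.

Definition same_kind (s s' : node_src) : bool :=
  match s, s' with
  | NY _, NY _ | NT _, NT _ | NW _, NW _ | NZ _, NZ _ | NS _, NS _ => true
  | _, _ => false
  end.

(** * Exchangeability of the positions of a batch *)

Section exchange.
Context (R : realType) (d : measure_display) (T : measurableType d).
Variable P : probability T R.

Lemma mutual_indep2 (I : Type) (E : I -> set (set T)) i j A B :
  mutual_indep P E -> i <> j -> E i A -> E j B -> P (A `&` B) = (P A * P B)%E.
Proof.
move=> indE ij EA EB.
pose C k := if `[< k = i >] then A else B.
have Ci : C i = A by rewrite /C asboolT.
have Cj : C j = B by rewrite /C asboolF// => /esym.
have := @indE [:: i; j] C; rewrite !big_cons big_nil mule1 Ci Cj => <-.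
- congr (P _); apply/seteqP; split => [w [Aw Bw] k /= [<-|[<-|//]]|w h].
  + by rewrite Ci.
  + by rewrite Cj.
  + by split; [rewrite -Ci; apply: h; left|rewrite -Cj; apply: h; right; left].
- by constructor => [[/esym//|//]|]; constructor => //; constructor.
- by move=> k [<-|[<-|//]]; rewrite ?Ci ?Cj.
Qed.

(** Cut the unit interval into [m + 1] cells: a tie puts both variables into one cell, with
    probability [(m + 1)^-2] each, so ties have probability at most [1 / (m + 1)] for every [m]. The
    induction on [r] adds the cells from the left. *)
Lemma tie_null (t t' : T -> R) :
  unif01 P t -> unif01 P t' ->
  (forall A B, measurable A -> measurable B ->
     P (t @^-1` A `&` t' @^-1` B) = (P (t @^-1` A) * P (t' @^-1` B))%E) ->
  P [set w | t w = t' w] = 0.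
Proof.
move=> [mt ut] [mt' ut'] ind.
have mpre (s : T -> R) (A : set R) : measurable_fun setT s -> measurable A ->
    measurable (s @^-1` A).
  by move=> ms mA; rewrite -[X in measurable X]setTI; exact: ms.
have mle (s : T -> R) x : measurable_fun setT s -> measurable [set w | s w <= x].
  move=> ms; rewrite (_ : [set _ | _] = s @^-1` `]-oo, x]%classic); first exact: mpre.
  by apply/seteqP; split => w /=; rewrite in_itv.
have mtie : measurable [set w | t w = t' w].
  rewrite (_ : [set _ | _] = setT `&` (fun w => t w == t' w) @^-1` [set true]).
    by apply: measurable_fun_eqr.
  by rewrite setTI; apply/seteqP; split => w /eqP.
have cell (s : T -> R) a b : unif01 P s -> 0 <= a -> a <= b -> b <= 1 ->
    pr P (s @^-1` `]a, b]%classic) = b - a.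
  move=> [ms us] a0 ab b1.
  have := @pr_setID _ _ _ P _ _ (mle s b ms) (mle s a ms).
  rewrite (_ : [set w | s w <= b] `&` _ = [set w | s w <= a]); last first.
    by apply/seteqP; split => w /=; [case|move=> sa; split => //; exact: le_trans sa ab].
  rewrite (_ : _ `\` _ = s @^-1` `]a, b]%classic); last first.
    apply/seteqP; split => w /=; rewrite in_itv/= ltNge.
      by case=> -> /negP ->.
    by case/andP => /negP ? ->.
  have -> : pr P [set w | s w <= b] = b by rewrite /pr us// b1 (le_trans a0).
  have -> : pr P [set w | s w <= a] = a by rewrite /pr us// a0 (le_trans ab).
  by move=> e; apply/eqP; rewrite eq_sym subr_eq addrC; apply/eqP.
suff le m : pr P [set w | t w = t' w] <= m.+1%:R^-1.
  have : pr P [set w | t w = t' w] <= 0.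
    apply/ler_addgt0Pr => e e0; rewrite add0r.
    apply: le_trans (le (Num.truncn e^-1)) _.
    by rewrite invf_ple ?posrE// ltW// truncnS_gt.
  by move=> le0; rewrite prE//; congr EFin; apply/le_anti; rewrite le0 pr_ge0.
have m0 : 0 < m.+1%:R :> R by rewrite ltr0n.
have step r : (r <= m.+1)%N ->
    pr P [set w | t w = t' w /\ t w <= r%:R / m.+1%:R] <= r%:R / m.+1%:R ^+ 2.
  elim: r => [|r IH] rm.
    have p0 : pr P [set w | t w <= 0] = 0 by rewrite /pr (ut 0)// lexx ler01.
    rewrite !mul0r -[leRHS]p0.
    by apply: pr_le; [apply: measurableI => //; exact: mle|exact: mle|move=> w []].
  pose a : R := r%:R / m.+1%:R; pose b : R := r.+1%:R / m.+1%:R.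
  have ba : b - a = m.+1%:R^-1 by rewrite /a /b -mulrBl -natr1 addrC addKr mul1r.
  have a0 : 0 <= a by rewrite divr_ge0.
  have ab : a <= b by rewrite -subr_ge0 ba invr_ge0.
  have b1 : b <= 1 by rewrite /b ler_pdivrMr// mul1r ler_nat.
  have mc (s : T -> R) : measurable_fun setT s -> measurable (s @^-1` `]a, b]%classic).
    by move=> ms; exact: mpre.
  apply: (@le_trans _ _ (pr P ([set w | t w = t' w /\ t w <= a] `|`
      (t @^-1` `]a, b]%classic `&` t' @^-1` `]a, b]%classic)))).
    apply: pr_le; first by apply: measurableI => //; exact: mle.
      by apply: measurableU; apply: measurableI => //; [exact: mle|exact: mc|exact: mc].
    move=> w [tt' tb] /=; rewrite -tt' in_itv/=.
    by have [ta|ta] := leP (t w) a; [left|right; rewrite tb].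
  apply: le_trans (pr_setU _ _ _) _.
  - by apply: measurableI => //; exact: mle.
  - by apply: measurableI; exact: mc.
  rewrite (@pr_indep _ _ _ _ (t @^-1` _)); [|exact: mc|exact: mc|by apply: ind].
  rewrite !cell// ba -[r.+1%:R]natr1 mulrDl lerD//; first exact/IH/ltnW.
  by rewrite expr2 invfM mul1r.
rewrite (pr_setID P mtie (mle t 1 mt)).
have -> : pr P ([set w | t w = t' w] `\` [set w | t w <= 1]) = 0.
  apply/le_anti; rewrite pr_ge0 andbT.
  have p0 : pr P (~` [set w | t w <= 1]) = 0.
    by rewrite pr_setC; [rewrite /pr ut ?subrr// ler01 lexx|exact: mle].
  rewrite -[leRHS]p0; apply: pr_le; [by apply: measurableD => //; exact: mle| |by move=> w []].
  by apply: measurableC; exact: mle.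
rewrite addr0; have := step m.+1 (leqnn _).
rewrite divff ?gt_eqF// (_ : _ / _ = m.+1%:R^-1)//.
by rewrite expr2 invfM mulrA divff ?mul1r// gt_eqF.
Qed.

Definition node_family (xi : node_src -> T -> R * R) :=
  (forall s, measurable_fun setT (xi s)) /\
  mutual_indep P (fun s => rv_events (xi s)).

Let swap (j j' i : nat) : nat := if i == j then j' else if i == j' then j else i.

Let swapK j j' : involutive (swap j j').
Proof.
move=> i; rewrite /swap; have [->|ij] := eqVneq i j.
  by rewrite eqxx; case: eqVneq => //.
have [->|ij'] := eqVneq i j'; first by rewrite eqxx.
by rewrite (negbTE ij) (negbTE ij').
Qed.

Let swap_lt j j' n i : (j < n)%N -> (j' < n)%N -> (i < n)%N -> (swap j j' i < n)%N.
Proof. by rewrite /swap => jn jn' i_n; do 2?case: ifP. Qed.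

(** Only the first child's entries and tie breakers are exchanged. A position enters the reordering
    solely through the rank of its key, so the output at [j] after the swap is the output at [j']
    before it. *)
Let swap_src j j' (s : node_src) : node_src :=
  match s with NY i => NY (swap j j' i) | NT i => NT (swap j j' i) | _ => s end.

Let swap_srcK j j' : involutive (swap_src j j').
Proof. by case=> //= i; rewrite swapK. Qed.

Let node_out_swap n (f : node_src -> R * R) j j' : (j < n)%N -> (j' < n)%N ->
  (forall i, (i < n)%N -> i != j' -> (f (NT i)).1 <> (f (NT j')).1) ->
  node_out n (f \o swap_src j j') j = node_out n f j'.
Proof.
move=> jn jn' noties; rewrite /node_out.
have -> : node_sigma n (f \o swap_src j j') j = node_sigma n f j'.
  rewrite /node_sigma /sigma_perm /=; congr (invrank _ _ _ (rank _ _ _ (invrank _ _ _ _))).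
  pose pi (i : 'I_n) : 'I_n := Ordinal (swap_lt jn jn' (ltn_ord i)).
  have pi_inj : injective pi.
    by move=> i k [] /(can_inj (@swapK j j')) /val_inj.
  have pij : pi (Ordinal jn) = Ordinal jn' by apply: val_inj; rewrite /= /swap eqxx.
  have := @rank_relabel R n (fun i => (f (NY i)).1 + (f (NY i)).2)
    (fun i => (f (NT i)).1) pi (swap j j') (Ordinal jn) pi_inj (fun=> erefl).
  rewrite pij /= => -> // i ij [_]; apply: noties => //.
by rewrite /= /swap eqxx.
Qed.

(** Marginal laws are compared only at positions below [n], whereas [joint_law_unique] asks for all
    sources; the remaining ones are set to 0. *)
Let truncate n (xi : node_src -> T -> R * R) s w :=
  if (src_pos s < n)%N then xi s w else 0.

Let truncate_family n xi rho : node_family xi -> involutive rho ->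
  node_family (fun s => truncate n xi (rho s)).
Proof.
move=> [mxi ind] rhoK; split.
  move=> s; rewrite /truncate; case: ltnP => _; first exact: mxi.
  exact: measurable_cst.
apply: (@mutual_indep_groups _ _ _ _ _ _ _ _ _ ind _ rho).
- by move=> s; exact: rv_eventsT.
- by move=> s; exact: rv_eventsI.
- by move=> s; exact: rv_events_measurable.
move=> s _ [B mB <-]; rewrite /truncate; case: ltnP => _.
  by apply: sub_sigma_algebra; exists (rho s); [exact: rhoK|exists B].
have [B0|nB0] := pselect (B (0 : R * R)).
  rewrite (_ : _ @^-1` B = setT); last by apply/seteqP; split.
  exact: (@measurableT _ (g_sigma_algebraType (subgen (fun s => rv_events (xi s)) _))).
rewrite (_ : _ @^-1` B = set0); last by apply/seteqP; split.
exact: sigma_algebra0.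
Qed.

(** Swapping [j] and [j'] in [xi'] gives a family with the joint law of [xi], and off ties the swap
    moves the output from [j'] to [j]. The statement serves both for two positions of one family and
    for two different iterations. *)
Lemma node_exchange n (xi xi' : node_src -> T -> R * R) j j' (A : set (R * R * R)) :
  (j < n)%N -> (j' < n)%N -> node_family xi -> node_family xi' ->
  (forall i, (i < n)%N -> unif01 P (fun w => (xi' (NT i) w).1)) ->
  (forall s s', (src_pos s < n)%N -> (src_pos s' < n)%N -> same_kind s s' ->
     forall a, P [set w | le2 (xi s w) a] = P [set w | le2 (xi' s' w) a]) ->
  measurable A ->
  P [set w | A (node_out n (xi^~ w) j)] = P [set w | A (node_out n (xi'^~ w) j')].
Proof.
move=> jn jn' fam fam' unif law mA.
have [mt ind] := truncate_family n fam (fun s => erefl : id (id s) = s).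
have [mt' ind'] := truncate_family n fam' (@swap_srcK j j').
have mS : measurable ([set f | A (node_out n f j)] : set (coords R node_src)).
  rewrite -[X in measurable X]setTI.
  apply: (@measurable_node_out _ _ (coords R node_src) (fun s f => f s)) => //.
  exact: coord_measurable.
have trE (zeta : node_src -> T -> R * R) i : (i < n)%N ->
    [set w | A (node_out n (zeta^~ w) i)] =
    [set w | A (node_out n ((truncate n zeta)^~ w) i)].
  move=> i_n; apply/funext => w; rewrite /mkset.
  rewrite (@eq_node_out _ n _ ((truncate n zeta)^~ w))// => s sn.
  by rewrite /truncate sn.
rewrite (trE xi)//.
transitivity (P [set w | A (node_out n ((fun s => truncate n xi' (swap_src j j' s))^~ w) j)]).
  apply: (joint_law_unique mt mt' ind ind' _ mS) => s a.
  have spos : (src_pos (swap_src j j' s) < n)%N = (src_pos s < n)%N.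
    have H i : (swap j j' i < n)%N = (i < n)%N.
      apply/idP/idP => [h|]; last exact: swap_lt.
      by rewrite -(swapK j j' i); exact: swap_lt.
    by case: s => //= i; exact: H.
  rewrite /truncate spos; case: ltnP => // sn; apply: law => //.
  by rewrite spos.
  by case: s sn {spos}.
(* The null event that some tie breaker coincides with the one at [j']; off [N] relabelling the
   batch does not change the rank. *)
pose N := \big[setU/set0]_(i < n | i != j' :> nat)
  [set w | (xi' (NT i) w).1 = (xi' (NT j') w).1].
have mNT i : measurable_fun setT (fun w => (xi' (NT i) w).1).
  exact: measurableT_comp measurable_fst (fam'.1 _).
have mtie (i k : nat) : measurable [set w | (xi' (NT i) w).1 = (xi' (NT k) w).1].
  rewrite (_ : [set _ | _] = setT `&` (fun w => (xi' (NT i) w).1 == (xi' (NT k) w).1)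
     @^-1` [set true]); first exact: measurable_fun_eqr.
  by rewrite setTI; apply/seteqP; split => w /eqP.
have mN : measurable N by apply: bigsetU_measurable => i _.
have PN : measurable N /\ pr P N = 0.
  rewrite /N; elim/big_ind: _ => [|B C [mB PB] [mC PC]|i ij].
  - by rewrite pr_set0; split.
  - split; first exact: measurableU.
    by apply/le_anti; rewrite pr_ge0 (le_trans (pr_setU P mB mC))// PB PC addr0.
  - split => //; rewrite /pr tie_null//; [exact: unif|exact: unif|].
    move=> B C mB mC.
    apply: (mutual_indep2 fam'.2 (i := NT i) (j := NT j')).
    + by case=> /eqP; rewrite (negbTE ij).
    + by exists (fst @^-1` B) => //; rewrite -[fst @^-1` B]setTI; exact: measurable_fst.
    + by exists (fst @^-1` C) => //; rewrite -[fst @^-1` C]setTI; exact: measurable_fst.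
have mE : measurable [set w | A (node_out n
    ((fun s => truncate n xi' (swap_src j j' s))^~ w) j)].
  rewrite -[X in measurable X]setTI.
  exact: (measurable_node_out n j mt').
have mE' : measurable [set w | A (node_out n (xi'^~ w) j')].
  by rewrite -[X in measurable X]setTI; apply: measurable_node_out => //; exact: fam'.1.
rewrite !prE//; congr EFin.
rewrite (pr_setID P mE mN) (pr_setID P mE' mN).
have null B : measurable B -> pr P (B `&` N) = 0.
  move=> mB; apply/le_anti; rewrite pr_ge0 andbT -[leRHS]PN.2.
  by apply: pr_le => //; exact: measurableI.
rewrite !null// !add0r; congr (pr P _).
have outE w : (~` N) w ->
    node_out n ((fun s => truncate n xi' (swap_src j j' s))^~ w) j =
    node_out n (xi'^~ w) j'.
  move=> nN; rewrite (@eq_node_out _ n (xi'^~ w) ((truncate n xi')^~ w))//; last first.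
    by move=> s sn; rewrite /truncate sn.
  apply: (@node_out_swap n ((truncate n xi')^~ w)) => // i i_n ij.
  rewrite /truncate /= i_n jn' => tt'; apply: nN.
  by rewrite /N (bigD1 (Ordinal i_n))//=; left.
by apply/seteqP; split => w [Aw nN]; split => //; move: Aw; rewrite /= outE.
Qed.

End exchange.

(** * Convergence at a node *)

Section node_limit.
Context (R : realType) (d : measure_display) (T : measurableType d).
Variable P : probability T R.

(** Take the expectation of the number of occurring events, which is at most [K] off [B] and at most
    [n] on [B]. *)
Lemma sum_pr_le n (E : nat -> T -> bool) (B : set T) (K : R) :
  (forall j, measurable [set w | E j w]) -> measurable B -> 0 <= K ->
  (forall w, ~ B w -> (count (E^~ w) (iota 0 n))%:R <= K) ->
  \sum_(j < n) pr P [set w | E j w] <= K + n%:R * pr P B.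
Proof.
move=> mE mB K0 EK.
pose f w : R := \sum_(j < n) \1_[set w | E j w] w.
pose g w : R := K + n%:R * \1_B w.
have n0 : 0 <= n%:R :> R by [].
have fg w : f w <= g w.
  rewrite /f /g; have -> : \sum_(j < n) \1_[set w | E j w] w =
      (count (E^~ w) (iota 0 n))%:R :> R.
    rewrite count_iota_sum; apply: eq_bigr => j _; rewrite indicE; congr (nat_of_bool _)%:R.
    by apply/idP/idP; rewrite inE.
  have [Bw|nBw] := pselect (B w).
    rewrite indicE mem_set// mulr1 -[leLHS]add0r lerD// ler_nat.
    exact: count_le_n.
  by rewrite indicE memNset// mulr0 addr0 EK.
have mf1 j : measurable_fun setT (fun w => (\1_[set w | E j w] w)%:E : \bar R).
  by apply/measurable_EFinP; exact: measurable_indic.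
have le : (\int[P]_w (f w)%:E <= \int[P]_w (g w)%:E)%E.
  apply: ge0_le_integral => //.
  - by move=> w _; rewrite lee_fin sumr_ge0.
  - apply/measurable_EFinP; apply: measurable_sum => j.
    exact: measurable_indic.
  - apply/measurable_EFinP; apply: measurable_funD => //.
    by apply: measurable_funM => //; exact: measurable_indic.
  - by move=> w _; rewrite lee_fin.
rewrite -lee_fin; move: le; congr (_ <= _)%E.
  rewrite /f; under eq_integral do rewrite -sumEFin.
  rewrite ge0_integral_sum//.
  rewrite -sumEFin; apply: eq_bigr => j _.
  by rewrite integral_indic// setIT -prE.
rewrite /g; under eq_integral do rewrite EFinD EFinM.
rewrite ge0_integralD//.
- rewrite integral_cst//= probability_setT mule1 ge0_integralZl//; first last.
  + by apply/measurable_EFinP; exact: measurable_indic.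
  + by rewrite integral_indic// setIT EFinD EFinM -(prE P mB).
- apply/measurable_EFinP; apply: measurable_funM => //; exact: measurable_indic.
Qed.

Lemma count_predC_iota n (a : pred nat) :
  (count (predC a) (iota 0 n))%:R = n%:R - (count a (iota 0 n))%:R :> R.
Proof.
apply/eqP; rewrite eq_sym subr_eq -natrD addnC count_predC size_iota.
by [].
Qed.

Lemma sum_pr_approx n (E : nat -> T -> bool) (B : set T) (c delta : R) :
  (forall j, measurable [set w | E j w]) -> measurable B ->
  0 <= c <= 1 -> 0 <= delta ->
  (forall w, ~ B w -> `|(count (E^~ w) (iota 0 n))%:R - n%:R * c| <= n%:R * delta) ->
  `|\sum_(j < n) pr P [set w | E j w] - n%:R * c| <= n%:R * (delta + pr P B).
Proof.
move=> mE mB /andP[c0 c1] d0 H; have n0 : 0 <= n%:R :> R by [].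
have mC j : measurable [set w | ~~ E j w].
  rewrite (_ : [set _ | _] = ~` [set w | E j w]); first exact: measurableC.
  by apply/seteqP; split => w /negP.
rewrite ler_distl; apply/andP; split.
  (* The lower bound is the upper bound for the complementary events. *)
  have := @sum_pr_le n (fun j w => ~~ E j w) B (n%:R * (1 - c + delta)) mC mB.
  have -> : \sum_(j < n) pr P [set w | ~~ E j w] =
      n%:R - \sum_(j < n) pr P [set w | E j w].
    rewrite -[in X in X - _](card_ord n) -sum1_card natr_sum -sumrB.
    apply: eq_bigr => j _; rewrite -pr_setC//; congr (pr P _).
    by apply/seteqP; split => w /negP.
  move=> h; have : n%:R - \sum_(j < n) pr P [set w | E j w] <=
      n%:R * (1 - c + delta) + n%:R * pr P B.
    apply: h; first by rewrite mulr_ge0// addr_ge0// subr_ge0.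
    move=> w /H; rewrite ler_distl => /andP[h1 _].
    rewrite (count_predC_iota n (E^~ w)); lra.
  by lra.
have := @sum_pr_le n E B (n%:R * (c + delta)) mE mB.
move=> h; have : \sum_(j < n) pr P [set w | E j w] <= n%:R * (c + delta) + n%:R * pr P B.
  apply: h; first by rewrite mulr_ge0// addr_ge0.
  move=> w /H; rewrite ler_distl => /andP[_ h1]; lra.
by lra.
Qed.

(** Weak inequality for [true], strict for [false]: both cut out down-closed sets of positions, and
    the four corners they form determine an atom. *)
Definition below (b : bool) (a x : R) := if b then x <= a else x < a.

Lemma measurable_below b a : measurable [set x | below b a x].
Proof.
case: b => /=.
  by rewrite (_ : [set _ | _] = `]-oo, a]%classic)//; apply/seteqP; split => x; rewrite /= in_itv.
by rewrite (_ : [set _ | _] = `]-oo, a[%classic)//; apply/seteqP; split => x; rewrite /= in_itv.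
Qed.

Lemma below_down_closed n x t b a : @down_closed R n x t (fun j => below b a (x j)).
Proof.
move=> j k; rewrite /key_lt /below; case: b => xk /orP[jk|/andP[/eqP -> _]//].
  exact: ltW (lt_le_trans jk xk).
exact: lt_trans jk xk.
Qed.

Definition node_key (f : node_src -> R * R) i : R := (f (NY i)).1 + (f (NY i)).2.

(** Off five bad events, the counts for both children, both copula margins and the copula corner lie
    within [n eps] of their means. Exchanging a child's count for a margin's costs [3 n eps] (two
    deviations and the gap between [p1] and [u], or [p2] and [v]), the corner one more: hence the 7,
    while 5 is the union bound. The gap is allowed because at the root the first child has its
    limiting law only approximately. *)
Lemma node_limit n (xi : node_src -> T -> R * R) b1 b2 a1 a2 p1 p2 u v c eps j :
  (j < n)%N -> node_family P xi ->
  (forall i, (i < n)%N -> unif01 P (fun w => (xi (NT i) w).1)) ->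
  (forall s s', (src_pos s < n)%N -> (src_pos s' < n)%N -> same_kind s s' ->
     forall a, P [set w | le2 (xi s w) a] = P [set w | le2 (xi s' w) a]) ->
  (forall i, (i < n)%N -> pr P [set w | below b1 a1 (node_key (xi^~ w) i)] = p1) ->
  (forall i, (i < n)%N -> pr P [set w | below b2 a2 (xi (NZ i) w).1] = p2) ->
  (forall i, (i < n)%N -> pr P [set w | (xi (NW i) w).1 <= u] = u) ->
  (forall i, (i < n)%N -> pr P [set w | (xi (NW i) w).2 <= v] = v) ->
  (forall i, (i < n)%N ->
     pr P [set w | ((xi (NW i) w).1 <= u) && ((xi (NW i) w).2 <= v)] = c) ->
  0 < eps -> `|p1 - u| <= eps -> `|p2 - v| <= eps ->
  `|pr P [set w | below b1 a1 (node_key (xi^~ w) j) &&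
                  below b2 a2 (node_out n (xi^~ w) j).2] - c|
    <= 7 * eps + 5 * (eps ^+ 4 * n%:R ^+ 2)^-1.
Proof.
move=> jn fam unif law hp1 hp2 hu hv hc e0 p1u p2v.
have n0 : (0 < n)%N by exact: leq_ltn_trans jn.
have n0R : 0 < n%:R :> R by rewrite ltr0n.
have [mxi ind] := fam.
have m1 s : measurable_fun setT (fun w => (xi s w).1).
  exact: measurableT_comp measurable_fst (mxi s).
have m2 s : measurable_fun setT (fun w => (xi s w).2).
  exact: measurableT_comp measurable_snd (mxi s).
pose S1 : set (R * R) := [set y | below b1 a1 (y.1 + y.2)].
pose S2 : set (R * R) := [set y | below b2 a2 y.1].
pose S3 : set (R * R) := [set y | y.1 <= u].
pose S4 : set (R * R) := [set y | y.2 <= v].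
pose S5 : set (R * R) := [set y | (y.1 <= u) && (y.2 <= v)].
have mS1 : measurable S1.
  apply: (@measurable_preimage _ _ _ _ (fun y : R * R => y.1 + y.2) _ _ (measurable_below b1 a1)).
  by apply: measurable_funD; [exact: measurable_fst|exact: measurable_snd].
have mS2 : measurable S2.
  apply: (@measurable_preimage _ _ _ _ (fun y : R * R => y.1) _ _ (measurable_below b2 a2)).
  exact: measurable_fst.
have mS3 : measurable S3.
  apply: (@measurable_preimage _ _ _ _ (fun y : R * R => y.1) _ _ (measurable_below true u)).
  exact: measurable_fst.
have mS4 : measurable S4.
  apply: (@measurable_preimage _ _ _ _ (fun y : R * R => y.2) _ _ (measurable_below true v)).
  exact: measurable_snd.
have mS5 : measurable S5.
  rewrite (_ : S5 = S3 `&` S4); first exact: measurableI.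
  by apply/seteqP; split => y /andP.
have conc (k : nat -> node_src) (S : pred (R * R)) (p : R) :
    injective k -> measurable [set y | S y] ->
    (forall i, (i < n)%N -> pr P [set w | S (xi (k i) w)] = p) ->
    measurable [set w | eps * n%:R <= `|(count (fun i => S (xi (k i) w)) (iota 0 n))%:R - n%:R * p|]
    /\ pr P [set w | eps * n%:R <= `|(count (fun i => S (xi (k i) w)) (iota 0 n))%:R - n%:R * p|]
      <= (eps ^+ 4 * n%:R ^+ 2)^-1.
  move=> kinj mS hp.
  have mSk i : measurable [set w | S (xi (k i) w)] by exact: (measurable_preimage (mxi (k i)) mS).
  split.
    apply: (@sets_measurable_count _ _ (fun i w => S (xi (k i) w)) (iota 0 n) _
      [set r : nat | eps * n%:R <= `|r%:R - n%:R * p|]) => i.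
    exact: sets_measurable_bool.
  apply: count_concentration => //; last first.
    by rewrite -(hp 0%N n0) pr_ge0 pr_le1.
  apply: (mutual_indep_inj kinj _ ind) => i _ ->.
  by exists [set y | S y].
pose N1 w := (count (fun i => below b1 a1 (node_key (xi^~ w) i)) (iota 0 n))%:R : R.
pose N2 w := (count (fun i => below b2 a2 (xi (NZ i) w).1) (iota 0 n))%:R : R.
pose N3 w := (count (fun i => (xi (NW i) w).1 <= u) (iota 0 n))%:R : R.
pose N4 w := (count (fun i => (xi (NW i) w).2 <= v) (iota 0 n))%:R : R.
pose N5 w := (count (fun i => ((xi (NW i) w).1 <= u) && ((xi (NW i) w).2 <= v))
  (iota 0 n))%:R : R.
pose bad (N : T -> R) p := [set w | eps * n%:R <= `|N w - n%:R * p|].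
have [mB1 B1] : measurable (bad N1 p1) /\ pr P (bad N1 p1) <= (eps ^+ 4 * n%:R ^+ 2)^-1.
  by apply: (conc NY (fun y => below b1 a1 (y.1 + y.2))) => // i k [].
have [mB2 B2] : measurable (bad N2 p2) /\ pr P (bad N2 p2) <= (eps ^+ 4 * n%:R ^+ 2)^-1.
  by apply: (conc NZ (fun y => below b2 a2 y.1)) => // i k [].
have [mB3 B3] : measurable (bad N3 u) /\ pr P (bad N3 u) <= (eps ^+ 4 * n%:R ^+ 2)^-1.
  by apply: (conc NW (fun y => y.1 <= u)) => // i k [].
have [mB4 B4] : measurable (bad N4 v) /\ pr P (bad N4 v) <= (eps ^+ 4 * n%:R ^+ 2)^-1.
  by apply: (conc NW (fun y => y.2 <= v)) => // i k [].
have [mB5 B5] : measurable (bad N5 c) /\ pr P (bad N5 c) <= (eps ^+ 4 * n%:R ^+ 2)^-1.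
  by apply: (conc NW (fun y => (y.1 <= u) && (y.2 <= v))) => // i k [].
pose B := bad N1 p1 `|` (bad N2 p2 `|` (bad N3 u `|` (bad N4 v `|` bad N5 c))).
have mB : measurable B by do 4!apply: measurableU => //.
have PB : pr P B <= 5 * (eps ^+ 4 * n%:R ^+ 2)^-1.
  have := @pr_setU _ _ _ P _ _ mB1
    (measurableU _ _ mB2 (measurableU _ _ mB3 (measurableU _ _ mB4 mB5))).
  have := @pr_setU _ _ _ P _ _ mB2 (measurableU _ _ mB3 (measurableU _ _ mB4 mB5)).
  have := @pr_setU _ _ _ P _ _ mB3 (measurableU _ _ mB4 mB5).
  have := @pr_setU _ _ _ P _ _ mB4 mB5.
  by rewrite /B; lra.
pose E i w := below b1 a1 (node_key (xi^~ w) i) && below b2 a2 (node_out n (xi^~ w) i).2.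
pose SE : set (R * R * R) := [set z | below b1 a1 (z.1.1 + z.1.2) && below b2 a2 z.2].
have mSE : measurable SE.
  rewrite (_ : SE = (fst @^-1` S1) `&` (snd @^-1` [set x | below b2 a2 x])); last first.
    by apply/seteqP; split => z /andP.
  apply: measurableI; rewrite -[X in measurable X]setTI.
    exact: measurable_fst.
  by apply: measurable_snd => //; exact: measurable_below.
have mE i : measurable [set w | E i w].
  apply: (@measurable_preimage _ _ _ _ (fun w => node_out n (xi^~ w) i) SE) => //.
  exact: measurable_node_out.
(* Exchangeability turns a bound on the average over positions into one at the single position
   [j]. *)
have Ej i : (i < n)%N -> pr P [set w | E i w] = pr P [set w | E j w].
  by move=> i_n; congr fine; exact: (@node_exchange _ _ _ P n xi xi i j SE).
have c01 : 0 <= c <= 1.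
  by rewrite -(hc 0%N n0) pr_ge0 pr_le1//; exact: (measurable_preimage (mxi (NW 0)) mS5).
have := @sum_pr_approx n E B c (7 * eps) mE mB c01.
have -> : \sum_(i < n) pr P [set w | E i w] = n%:R * pr P [set w | E j w].
  rewrite (eq_bigr (fun=> pr P [set w | E j w])); last by move=> i _; exact: Ej.
  by rewrite sumr_const card_ord mulr_natl.
move=> H; have : `|n%:R * pr P [set w | E j w] - n%:R * c| <=
    n%:R * (7 * eps + pr P B).
  apply: H; first by rewrite mulr_ge0// ltW.
  move=> w nBw.
  have good (N : T -> R) p : ~ bad N p w -> `|N w - n%:R * p| <= n%:R * eps.
    by move=> /negP; rewrite -ltNge [n%:R * eps]mulrC => /ltW.
  have g1 : `|N1 w - n%:R * p1| <= n%:R * eps by apply: good => ?; apply: nBw; left.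
  have g2 : `|N2 w - n%:R * p2| <= n%:R * eps by apply: good => ?; apply: nBw; right; left.
  have g3 : `|N3 w - n%:R * u| <= n%:R * eps by apply: good => ?; apply: nBw; right; right; left.
  have g4 : `|N4 w - n%:R * v| <= n%:R * eps.
    by apply: good => ?; apply: nBw; right; right; right; left.
  have g5 : `|N5 w - n%:R * c| <= n%:R * eps.
    by apply: good => ?; apply: nBw; right; right; right; right.
  have apx : `|(count (E^~ w) (iota 0 n))%:R - N5 w| <=
      `|N1 w - N3 w| + `|N2 w - N4 w|.
    apply: (@count_sigma_approx R n _ _ _ _ _ _
      (fun i => below b1 a1 (node_key (xi^~ w) i)) (fun i => below b2 a2 (xi (NZ i) w).1)
      (fun i => (xi (NW i) w).1 <= u) (fun i => (xi (NW i) w).2 <= v)).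
    - exact: below_down_closed.
    - exact: below_down_closed.
    - exact: (@below_down_closed _ _ _ true).
    - exact: (@below_down_closed _ _ _ true).
  have np1 : `|n%:R * p1 - n%:R * u| <= n%:R * eps.
    by rewrite -mulrBr normrM (ger0_norm (ltW n0R)) ler_pM2l.
  have np2 : `|n%:R * p2 - n%:R * v| <= n%:R * eps.
    by rewrite -mulrBr normrM (ger0_norm (ltW n0R)) ler_pM2l.
  move: g1 g2 g3 g4 g5 apx np1 np2; rewrite !ler_distl.
  set cE := (count (E^~ w) (iota 0 n))%:R.
  move=> /andP[? ?] /andP[? ?] /andP[? ?] /andP[? ?] /andP[? ?].
  case: (ger0P (N1 w - N3 w)) => ?; case: (ger0P (N2 w - N4 w)) => ?;
    by move=> /andP[? ?] /andP[? ?] /andP[? ?]; apply/andP; split; lra.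
rewrite -mulrBr normrM (ger0_norm (ltW n0R)) (ler_pM2l n0R) => h.
by rewrite (le_trans h)// lerD2l.
Qed.

End node_limit.

(** * Conditional independence at a node *)

(** The reordering sees the first child's payload only through its sum; this is the source of
    conditional independence given the sum. *)
Lemma eq_node_sigma (R : realType) n (f f' : node_src -> R * R) j :
  (forall i, node_key f i = node_key f' i) -> (forall i, f (NT i) = f' (NT i)) ->
  (forall i, f (NW i) = f' (NW i)) -> (forall i, f (NZ i) = f' (NZ i)) ->
  (forall i, f (NS i) = f' (NS i)) -> node_sigma n f j = node_sigma n f' j.
Proof.
move=> /funext eK eT eW eZ eS; rewrite /node_sigma -!/(node_key _ _).
have {}eT : (fun i => (f (NT i)).1) = (fun i => (f' (NT i)).1).
  by apply/funext => i; rewrite eT.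
have eW1 : (fun i => (f (NW i)).1) = (fun i => (f' (NW i)).1).
  by apply/funext => i; rewrite eW.
have eW2 : (fun i => (f (NW i)).2) = (fun i => (f' (NW i)).2).
  by apply/funext => i; rewrite eW.
have {}eZ : (fun i => (f (NZ i)).1) = (fun i => (f' (NZ i)).1).
  by apply/funext => i; rewrite eZ.
have {}eS : (fun i => (f (NS i)).1) = (fun i => (f' (NS i)).1).
  by apply/funext => i; rewrite eS.
by rewrite [X in sigma_perm _ X]eK eT eW1 eW2 eZ eS.
Qed.

Section node_conditional.
Context (R : realType) (d : measure_display) (T : measurableType d).
Variable P : probability T R.

(* On [node_key = z] the second output is a function of [z] and of the sources other
   than [NY j], hence is independent of the payload [NY j]. *)
Lemma node_cond_indep n (xi : node_src -> T -> R * R) j (A : set (R * R)) (B : set R) z :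
  node_family P xi -> measurable A -> measurable B ->
  let K := [set w | node_key (xi^~ w) j = z] in
  let EA := [set w | A (xi (NY j) w)] in
  let EB := [set w | B (node_out n (xi^~ w) j).2] in
  (P (EA `&` EB `&` K) * P K = P (EA `&` K) * P (EB `&` K))%E.
Proof.
move=> [mxi ind] mA mB K EA EB.
(* The payload [(z, 0)] has key [z], so on [K] the substitution leaves the reordering unchanged,
   while [H] does not involve [NY j]. *)
pose xiz s w := if `[< s = NY j >] then (z, 0) else xi s w.
pose H := [set w | B (node_out n (xiz^~ w) j).2].
pose E s := rv_events (xi s).
have indep U V : <<s subgen E [set s | s = NY j] >> U ->
    <<s subgen E [set s | s <> NY j] >> V -> P (U `&` V) = (P U * P V)%E.
  apply: indep_disjoint_groups => //.
  - by move=> s; exact: rv_eventsT.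
  - by move=> s; exact: rv_eventsI.
  - by move=> s; exact: rv_events_measurable.
have sH : <<s subgen E [set s | s <> NY j] >> H.
  pose T' := g_sigma_algebraType (subgen E [set s | s <> NY j]).
  have mxiz s : measurable_fun setT (xiz s : T' -> R * R).
    rewrite /xiz; case: asboolP => sj; first exact: measurable_cst.
    move=> _ C mC; rewrite setTI; apply: sub_sigma_algebra.
    by exists s => //; exists C.
  have := @measurable_preimage _ _ T' _ (fun w => (node_out n (xiz^~ w) j).2) B.
  apply => //; apply: measurableT_comp; first exact: measurable_snd.
  exact: measurable_node_out.
have EBK : EB `&` K = H `&` K.
  have outE w : K w -> (node_out n (xi^~ w) j).2 = (node_out n (xiz^~ w) j).2.
    rewrite /K /= => Kw; have -> : node_sigma n (xi^~ w) j = node_sigma n (xiz^~ w) j.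
      apply: eq_node_sigma => i; rewrite ?/node_key /xiz; case: asboolP => // -[->].
      by rewrite addr0.
    rewrite /= /xiz; case: asboolP => [e|_]; last by [].
    by discriminate e.
  have EH w : K w -> EB w = H w by move=> /outE e; rewrite /EB /H /mkset e.
  apply/seteqP; split => w [Hw Kw]; split; [|exact: Kw| |exact: Kw].
    by rewrite -EH.
  by rewrite EH.
have mkey : measurable_fun setT (fun y : R * R => y.1 + y.2).
  by apply: measurable_funD; [exact: measurable_fst|exact: measurable_snd].
have sub1 (C : set (R * R)) : measurable C ->
    <<s subgen E [set s | s = NY j] >> (xi (NY j) @^-1` C).
  by move=> mC; apply: sub_sigma_algebra; exists (NY j) => //; exists C.
have mz : measurable [set y : R * R | y.1 + y.2 = z].
  exact: (@measurable_preimage _ _ _ _ (fun y : R * R => y.1 + y.2) [set z]).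
have sK := sub1 _ mz.
have sEAK := sub1 _ (measurableI _ _ mA mz).
rewrite -setIA EBK (setIC H) setIA (indep _ _ sEAK sH) (indep _ _ sK sH).
by rewrite -!muleA; congr (_ * _)%E; rewrite muleC.
Qed.

Lemma node_cond_indep_discrete n (xi : node_src -> T -> R * R) j :
  node_family P xi ->
  cond_indep_discrete P
    (fun w => let o := node_out n (xi^~ w) j in (o.1.1, o.1.2, o.1.1 + o.1.2))
    (fun w => let o := node_out n (xi^~ w) j in (o.2, o.1.1 + o.1.2 + o.2))
    (fun w => let o := node_out n (xi^~ w) j in o.1.1 + o.1.2).
Proof.
move=> fam A B z mA mB.
pose A' := [set y : R * R | A (y.1, y.2, y.1 + y.2)].
(* On [K] the total is [z] plus the second output, so the second vector becomes a function of that
   output alone. *)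
pose B' := [set x : R | B (x, z + x)].
have mA' : measurable A'.
  apply: (@measurable_preimage _ _ _ _ (fun y : R * R => (y.1, y.2, y.1 + y.2)) A) => //.
  apply: measurable_fun_pair.
    by apply: measurable_fun_pair; [exact: measurable_fst|exact: measurable_snd].
  by apply: measurable_funD; [exact: measurable_fst|exact: measurable_snd].
have mB' : measurable B'.
  apply: (@measurable_preimage _ _ _ _ (fun x : R => (x, z + x)) B) => //.
  by apply: measurable_fun_pair => //; exact: measurable_funD.
have := @node_cond_indep n xi j A' B' z fam mA' mB'.
set K := [set w | _]; set EA := [set w | _]; set EB := [set w | _] => /= H.
pose O w := node_out n (xi^~ w) j.
have KE : (fun w => (O w).1.1 + (O w).1.2) @^-1` [set z] = K by [].
have AK : (fun w => ((O w).1.1, (O w).1.2, (O w).1.1 + (O w).1.2)) @^-1` A = EA by [].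
have BK : (fun w => ((O w).2, (O w).1.1 + (O w).1.2 + (O w).2)) @^-1` B `&` K = EB `&` K.
  have BE w : K w -> ((fun w => ((O w).2, (O w).1.1 + (O w).1.2 + (O w).2)) @^-1` B) w = EB w.
    by move=> Kw; rewrite /preimage /mkset /EB /B' /mkset -{1}Kw.
  apply/seteqP; split => w [Hw Kw]; split; [|exact: Kw| |exact: Kw].
    by rewrite -BE.
  by rewrite BE.
rewrite KE AK -setIA BK setIA; exact: H.
Qed.

End node_conditional.

(** * The blocks of the MRA *)

Section distribution_functions.
Context (R : realType) (d : measure_display) (T : measurableType d).
Variable P : probability T R.

Lemma measurable_le (X : T -> R) x : measurable_fun setT X -> measurable [set w | X w <= x].
Proof. by move=> mX; exact: (measurable_preimage mX (measurable_below true x)). Qed.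

Lemma unif01_cdf X x : unif01 P X ->
  P [set w | X w <= x] = (if x < 0 then 0 else Num.min x 1)%:E.
Proof.
move=> [mX uX]; case: ltP => x0.
  rewrite (prE P (measurable_le _ mX)); congr EFin; apply/le_anti; rewrite pr_ge0 andbT.
  have p0 : pr P [set w | X w <= 0] = 0 by rewrite /pr uX// lexx ler01.
  rewrite -[leRHS]p0; apply: pr_le; [exact: measurable_le|exact: measurable_le|].
  by move=> w /= Xx; exact: le_trans Xx (ltW x0).
have [x1|x1] := leP x 1; first by rewrite uX// x0.
rewrite (prE P (measurable_le _ mX)); congr EFin; apply/le_anti.
rewrite pr_le1/=; last exact: measurable_le.
have p1 : pr P [set w | X w <= 1] = 1 by rewrite /pr uX// ler01 lexx.
rewrite -[leLHS]p1; apply: pr_le; [exact: measurable_le|exact: measurable_le|].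
by move=> w /= Xx; exact: le_trans Xx (ltW x1).
Qed.

(** [has_copula] prescribes values on the unit square only, but comparing joint laws needs every
    corner. [C 1 1 = 1] leaves no mass beyond 1, and [C 1 0 = C 0 1 = 0] none below 0. *)
Lemma has_copula_cdf C X Y u1 u2 : is_copula C -> has_copula P X Y C ->
  P [set w | X w <= u1 /\ Y w <= u2] =
  (if (u1 < 0) || (u2 < 0) then 0 else C (Num.min u1 1) (Num.min u2 1))%:E.
Proof.
move=> [bd _] [mX [mY cXY]].
have i01 : 0 <= (1 : R) <= 1 by rewrite ler01 lexx.
have i00 : 0 <= (0 : R) <= 1 by rewrite ler01 lexx.
pose Q a b := [set w | X w <= a /\ Y w <= b].
have mQ a b : measurable (Q a b) by apply: measurableI; exact: measurable_le.
have Q11 : pr P (Q 1 1) = 1.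
  by rewrite /pr cXY//; have [_ [_ [_ ->]]] := bd 1 i01.
have Q10 : pr P (Q 1 0) = 0 by rewrite /pr cXY//; have [-> _] := bd 1 i01.
have Q01 : pr P (Q 0 1) = 0 by rewrite /pr cXY//; have [_ [-> _]] := bd 1 i01.
have cut A : measurable A -> pr P A = pr P (A `&` Q 1 1).
  move=> mA; rewrite (pr_setID P mA (mQ 1 1)).
  suff -> : pr P (A `\` Q 1 1) = 0 by rewrite addr0.
  apply/le_anti; rewrite pr_ge0 andbT.
  have p0 : pr P (~` Q 1 1) = 0 by rewrite pr_setC// Q11 subrr.
  rewrite -[leRHS]p0; apply: pr_le; [exact: measurableD|exact: measurableC|by move=> w []].
rewrite (prE P (mQ u1 u2)) cut//; congr EFin.
have -> : Q u1 u2 `&` Q 1 1 = Q (Num.min u1 1) (Num.min u2 1).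
  apply/seteqP; split => w; rewrite /Q /= !le_min.
    by move=> [[-> ->] [-> ->]].
  by move=> [/andP[-> ->] /andP[-> ->]].
case: ltP => u10 /=.
  apply/le_anti; rewrite pr_ge0 andbT -[leRHS]Q01; apply: pr_le => // w [].
  by rewrite !le_min => /andP[h _] /andP[_ ?]; split => //; exact: le_trans h (ltW u10).
case: ltP => u20 /=.
  apply/le_anti; rewrite pr_ge0 andbT -[leRHS]Q10; apply: pr_le => // w [].
  by rewrite !le_min => /andP[_ ?] /andP[h _]; split => //; exact: le_trans h (ltW u20).
by rewrite /pr cXY//= ?le_min ?ge_min ?u10 ?u20 ?lexx ?ler01 ?orbT.
Qed.

Lemma scalar_le2 (X : T -> R) a : P [set w | le2 (X w, 0) a] =
  if 0 <= a.2 then P [set w | X w <= a.1] else 0%E.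
Proof.
rewrite /le2 /=; case: ifP => _.
  by congr (P _); apply/funext => w; rewrite /mkset andbT.
rewrite (_ : [set w | _] = set0) ?measure0//.
by apply/seteqP; split => // w /=; rewrite andbF.
Qed.

End distribution_functions.

(** * Independence and common law of the MRA outputs *)

Section mra.
Context (R : realType) (d : measure_display) (Omega : measurableType d).
Variables (P : probability Omega R) (M : mra_rand R Omega).

Definition leaf_block n l j (s : node_src) (w : Omega) : R * R :=
  match s with
  | NY i => (rA M n l j i w, 0)
  | NT i => (rTA M n l j i w, 0)
  | NW i => (rV1 M n l j i w, rV2 M n l j i w)
  | NZ i => (rB M n l j i w, 0)
  | NS i => (rTB M n l j i w, 0)
  end.

(** Entry [i] of the batch of node (1) uses only that node's iteration [i], so the sources [NY i]
    rest on disjoint randomness for distinct [i]. *)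
Definition root_block n k (s : node_src) (w : Omega) : R * R :=
  match s with
  | NY i => node1_out M n k i w
  | NT i => (rT1 M n k i w, 0)
  | NW i => (rW1 M n k i w, rW2 M n k i w)
  | NZ i => (rD M n k i w, 0)
  | NS i => (rTD M n k i w, 0)
  end.

Lemma node1_outE n l j w :
  node1_out M n l j w =
  let o := node_out n ((leaf_block n l j)^~ w) j in (o.1.1, o.2).
Proof.
rewrite /node1_out /node_out /=; congr (_, rB M n l j _ w).
rewrite /node_sigma /=.
by have -> : (fun i => rA M n l j i w + 0) = (fun i => rA M n l j i w)
  by apply/funext => i; rewrite addr0.
Qed.

Lemma mra_outE n k w : mra_out M n k w = node_out n ((root_block n k)^~ w) k.
Proof.
by rewrite /mra_out /node_out; congr (_, _); rewrite -surjective_pairing.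
Qed.

Variables (F11 F12 F2 : R -> R) (C1 C0 : R -> R -> R).
Hypotheses (hC1 : is_copula C1) (hC0 : is_copula C0).
Hypothesis hM : mra_law P F11 F12 F2 C1 C0 M.

Let mA n l j i : measurable_fun setT (rA M n l j i).
Proof. by have [h _ _] := hM; have [[]] := h n l j i. Qed.
Let mTA n l j i : measurable_fun setT (rTA M n l j i).
Proof. by have [h _ _] := hM; have [_ [_ [[]]]] := h n l j i. Qed.
Let mB n l j i : measurable_fun setT (rB M n l j i).
Proof. by have [h _ _] := hM; have [_ [[]]] := h n l j i. Qed.
Let mTB n l j i : measurable_fun setT (rTB M n l j i).
Proof. by have [h _ _] := hM; have [_ [_ [_ [[]]]]] := h n l j i. Qed.
Let mV n l j i : measurable_fun setT (fun w => (rV1 M n l j i w, rV2 M n l j i w)).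
Proof.
have [h _ _] := hM; have [_ [_ [_ [_ [m1 [m2 _]]]]]] := h n l j i.
exact: measurable_fun_pair.
Qed.
Let mD n l i : measurable_fun setT (rD M n l i).
Proof. by have [_ h _] := hM; have [[]] := h n l i. Qed.
Let mTD n l i : measurable_fun setT (rTD M n l i).
Proof. by have [_ h _] := hM; have [_ [[]]] := h n l i. Qed.
Let mT1 n l i : measurable_fun setT (rT1 M n l i).
Proof. by have [_ h _] := hM; have [_ [_ [[]]]] := h n l i. Qed.
Let mW n l i : measurable_fun setT (fun w => (rW1 M n l i w, rW2 M n l i w)).
Proof.
have [_ h _] := hM; have [_ [_ [_ [m1 [m2 _]]]]] := h n l i.
exact: measurable_fun_pair.
Qed.

Let indM : mutual_indep P (mra_events M). Proof. by case: hM. Qed.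

Let eventsT s : mra_events M s setT.
Proof. by case: s => *; exact: rv_eventsT. Qed.

Let eventsI s : setI_closed (mra_events M s).
Proof. by case: s => *; exact: rv_eventsI. Qed.

Let events_measurable s : mra_events M s `<=` measurable.
Proof. by case: s => *; exact: rv_events_measurable. Qed.

(** Measurability is established relative to the sigma-algebra of a group [D] of sources, as
    [mutual_indep_groups] requires; ordinary measurability then follows by [measurable_from_sub]. *)
Let sub_measurable (D : set mra_src) d' (U : measurableType d') (f : Omega -> U) s :
  D s -> rv_events f `<=` mra_events M s ->
  measurable_fun setT (f : g_sigma_algebraType (subgen (mra_events M) D) -> U).
Proof.
move=> Ds fs _ A mA'; rewrite setTI; apply: sub_sigma_algebra.
by exists s => //; apply: fs; exists A.
Qed.

Let scalar_measurable d' (T' : measurableType d') (f : T' -> R) :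
  measurable_fun setT f -> measurable_fun setT (fun w => (f w, 0 : R)).
Proof. by move=> mf; apply: measurable_fun_pair. Qed.

Let scalar_events (X : Omega -> R) :
  rv_events (fun w => (X w, 0 : R)) `<=` rv_events X.
Proof.
move=> _ [B mB' <-]; exists [set x | B (x, 0)] => //.
exact: (measurable_preimage (scalar_measurable (@measurable_id _ _ setT))).
Qed.

Let leaf_src n l j (s : node_src) : mra_src :=
  match s with
  | NY i => SA n l j i | NT i => STA n l j i | NW i => SV n l j i
  | NZ i => SB n l j i | NS i => STB n l j i
  end.

Let leaf_block_events n l j s :
  rv_events (leaf_block n l j s) `<=` mra_events M (leaf_src n l j s).
Proof. by case: s => i //=; exact: scalar_events. Qed.

Lemma leaf_block_family n l j : node_family P (leaf_block n l j).
Proof.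
split; last first.
  apply: (mutual_indep_inj (k := leaf_src n l j)) indM; last exact: leaf_block_events.
  by case=> i [] k //= [->].
case=> i.
- exact: scalar_measurable.
- exact: scalar_measurable.
- exact: mV.
- exact: scalar_measurable.
- exact: scalar_measurable.
Qed.

Let measurable_drop12 : measurable_fun setT (fun z : R * R * R => (z.1.1, z.2)).
Proof.
apply: measurable_fun_pair; last exact: measurable_snd.
exact: measurableT_comp measurable_fst measurable_fst.
Qed.

Let leaf_block_sub (D : set mra_src) n l j : (forall s, D (leaf_src n l j s)) ->
  measurable_fun setT (node1_out M n l j :
    g_sigma_algebraType (subgen (mra_events M) D) -> R * R).
Proof.
move=> Dl; have -> : node1_out M n l j =
    (fun w => let o := node_out n ((leaf_block n l j)^~ w) j in (o.1.1, o.2)).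
  by apply/funext => w; rewrite node1_outE.
have mo : measurable_fun setT ((fun w => node_out n ((leaf_block n l j)^~ w) j) :
    g_sigma_algebraType (subgen (mra_events M) D) -> R * R * R).
  apply: measurable_node_out => s; apply: sub_measurable (Dl s) _.
  exact: leaf_block_events.
exact: measurableT_comp measurable_drop12 mo.
Qed.

Let root_block_sub (D : set mra_src) n k s :
  (forall j s', s = NY j -> D (leaf_src n k j s')) ->
  (forall i, s = NT i -> D (ST1 n k i)) -> (forall i, s = NW i -> D (SW n k i)) ->
  (forall i, s = NZ i -> D (SD n k i)) -> (forall i, s = NS i -> D (STD n k i)) ->
  measurable_fun setT (root_block n k s :
    g_sigma_algebraType (subgen (mra_events M) D) -> R * R).
Proof.
case: s => i DY DT DW DZ DS /=.
- by apply: leaf_block_sub => s'; exact: DY.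
- by apply: (@sub_measurable _ _ _ _ (ST1 n k i)); [exact: DT|exact: scalar_events].
- by apply: (@sub_measurable _ _ _ _ (SW n k i)); [exact: DW|].
- by apply: (@sub_measurable _ _ _ _ (SD n k i)); [exact: DZ|exact: scalar_events].
- by apply: (@sub_measurable _ _ _ _ (STD n k i)); [exact: DS|exact: scalar_events].
Qed.

Let measurable_from_sub (D : set mra_src) d' (U : measurableType d') (f : Omega -> U) :
  measurable_fun setT (f : g_sigma_algebraType (subgen (mra_events M) D) -> U) ->
  measurable_fun setT f.
Proof.
move=> mf _ A mA'; rewrite setTI.
have : <<s subgen (mra_events M) D >> (f @^-1` A).
  by rewrite -[X in <<s _ >> X]setTI; exact: mf.
apply: smallest_sub; first exact: sigma_algebra_measurable.
by move=> X [s _]; exact: events_measurable.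
Qed.

Let root_src (s : mra_src) : node_src :=
  match s with
  | SA _ _ j _ | STA _ _ j _ | SB _ _ j _ | STB _ _ j _ | SV _ _ j _ => NY j
  | SD _ _ i => NZ i | STD _ _ i => NS i | SW _ _ i => NW i | ST1 _ _ i => NT i
  end.

(** Sources are grouped by the root source they feed: all samples drawn at node (1) or its leaves in
    inner iteration [j] belong to [NY j]. *)
Lemma root_block_family n k : node_family P (root_block n k).
Proof.
split=> [s|].
  apply: (@measurable_from_sub setT); exact: root_block_sub.
apply: (mutual_indep_groups eventsT eventsI events_measurable indM (gamma := root_src)).
move=> s _ [B mB' <-].
rewrite -[X in <<s _ >> X]setTI.
apply: (@root_block_sub [set i | root_src i = s]) => //.
by move=> j s' ->; case: s'.
Qed.

Let outer (s : mra_src) : nat :=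
  match s with
  | SA _ l _ _ | STA _ l _ _ | SB _ l _ _ | STB _ l _ _ | SV _ l _ _ => l
  | SD _ l _ | STD _ l _ | SW _ l _ | ST1 _ l _ => l
  end.

(** The [k]-th output uses only samples of root iteration [k], so the grouping is by the outer
    iteration index. *)
Lemma mra_out_indep n : mutual_indep P (fun k : nat => rv_events (mra_out M n k)).
Proof.
apply: (mutual_indep_groups eventsT eventsI events_measurable indM (gamma := outer)).
move=> k _ [B mB' <-]; rewrite -[X in <<s _ >> X]setTI.
have mo : measurable_fun setT ((fun w => node_out n ((root_block n k)^~ w) k) :
   g_sigma_algebraType (subgen (mra_events M) [set s | outer s = k]) -> R * R * R).
  apply: measurable_node_out => s; apply: root_block_sub => // j s' _.
  by case: s'.
have -> : mra_out M n k = (fun w => node_out n ((root_block n k)^~ w) k).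
  by apply/funext => w; rewrite mra_outE.
exact: mo.
Qed.

Lemma mra_out_measurable n k : measurable_fun setT (mra_out M n k).
Proof.
have -> : mra_out M n k = (fun w => node_out n ((root_block n k)^~ w) k).
  by apply/funext => w; rewrite mra_outE.
by apply: measurable_node_out => s; have [m _] := root_block_family n k.
Qed.

Lemma leaf_block_law n l j l' j' s s' a : same_kind s s' ->
  P [set w | le2 (leaf_block n l j s w) a] = P [set w | le2 (leaf_block n l' j' s' w) a].
Proof.
have [h _ _] := hM.
case: s => i; case: s' => // i' ss' /=; rewrite ?scalar_le2.
- have [[_ ->] _] := h n l j i; by have [[_ ->] _] := h n l' j' i'.
- have [_ [_ [u _]]] := h n l j i; have [_ [_ [u' _]]] := h n l' j' i'.
  by rewrite (unif01_cdf _ u) (unif01_cdf _ u').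
- have [_ [_ [_ [_ c]]]] := h n l j i; have [_ [_ [_ [_ c']]]] := h n l' j' i'.
  have e (X Y : Omega -> R) : [set w | le2 (X w, Y w) a] = [set w | X w <= a.1 /\ Y w <= a.2].
    by apply/seteqP; split => w /andP.
  by rewrite !e (has_copula_cdf _ _ hC1 c) (has_copula_cdf _ _ hC1 c').
- have [_ [[_ ->] _]] := h n l j i; by have [_ [[_ ->] _]] := h n l' j' i'.
- have [_ [_ [_ [u _]]]] := h n l j i; have [_ [_ [_ [u' _]]]] := h n l' j' i'.
  by rewrite (unif01_cdf _ u) (unif01_cdf _ u').
Qed.

Let leaf_unif n l j i : unif01 P (fun w => (leaf_block n l j (NT i) w).1).
Proof. by have [h _ _] := hM; have [_ [_ [u _]]] := h n l j i. Qed.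

Let root_unif n k i : unif01 P (fun w => (root_block n k (NT i) w).1).
Proof. by have [_ h _] := hM; have [_ [_ [u _]]] := h n k i. Qed.

(** Each entry is read at its own position of its own iteration, so equality in law needs
    exchangeability and not only identical iterations. It makes the batch entering the root
    identically distributed. *)
Lemma node1_out_law n l j l' j' (A : set (R * R)) : (j < n)%N -> (j' < n)%N ->
  measurable A ->
  P [set w | A (node1_out M n l j w)] = P [set w | A (node1_out M n l' j' w)].
Proof.
move=> jn jn' mA'.
pose B := (fun z : R * R * R => (z.1.1, z.2)) @^-1` A.
have mB' : measurable B.
  exact: measurable_preimage measurable_drop12 mA'.
have E i l0 : [set w | A (node1_out M n l0 i w)] =
    [set w | B (node_out n ((leaf_block n l0 i)^~ w) i)].
  by apply/funext => w; rewrite /mkset node1_outE.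
rewrite !E; apply: node_exchange => //.
- exact: leaf_block_family.
- exact: leaf_block_family.
- by move=> s s' sn sn' k a; exact: leaf_block_law.
Qed.

Lemma root_block_law n k k' s s' a : (src_pos s < n)%N -> (src_pos s' < n)%N ->
  same_kind s s' ->
  P [set w | le2 (root_block n k s w) a] = P [set w | le2 (root_block n k' s' w) a].
Proof.
have [_ h _] := hM.
case: s => i; case: s' => // i' i_n i_n' ss'; last first.
- have [_ [u _]] := h n k i; have [_ [u' _]] := h n k' i'.
  by rewrite /= !scalar_le2 (unif01_cdf _ u) (unif01_cdf _ u').
- rewrite /= !scalar_le2.
  have [[_ ->] _] := h n k i; by have [[_ ->] _] := h n k' i'.
- have [_ [_ [_ c]]] := h n k i; have [_ [_ [_ c']]] := h n k' i'.
  have e (X Y : Omega -> R) : [set w | le2 (X w, Y w) a] = [set w | X w <= a.1 /\ Y w <= a.2].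
    by apply/seteqP; split => w /andP.
  by rewrite /= !e (has_copula_cdf _ _ hC0 c) (has_copula_cdf _ _ hC0 c').
- have [_ [_ [u _]]] := h n k i; have [_ [_ [u' _]]] := h n k' i'.
  by rewrite /= !scalar_le2 (unif01_cdf _ u) (unif01_cdf _ u').
- by apply: (@node1_out_law n k i k' i' [set x | le2 x a]) => //; exact: le2_measurable.
Qed.

Lemma mra_out_law n k k' (A : set (R * R * R)) : (k < n)%N -> (k' < n)%N ->
  measurable A -> P (mra_out M n k @^-1` A) = P (mra_out M n k' @^-1` A).
Proof.
move=> kn kn' mA'.
have E i : mra_out M n i @^-1` A = [set w | A (node_out n ((root_block n i)^~ w) i)].
  by apply/funext => w; rewrite /preimage /mkset mra_outE.
rewrite !E; apply: node_exchange => //.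
- exact: root_block_family.
- exact: root_block_family.
- by move=> s s' sn sn' k0 a; exact: root_block_law.
Qed.

Lemma mra_out_cond_indep n k : cond_indep_discrete P
  (fun w => ((mra_out M n k w).1.1, (mra_out M n k w).1.2,
             (mra_out M n k w).1.1 + (mra_out M n k w).1.2))
  (fun w => ((mra_out M n k w).2,
             (mra_out M n k w).1.1 + (mra_out M n k w).1.2 + (mra_out M n k w).2))
  (fun w => (mra_out M n k w).1.1 + (mra_out M n k w).1.2).
Proof.
have -> : mra_out M n k = (fun w => node_out n ((root_block n k)^~ w) k).
  by apply/funext => w; rewrite mra_outE.
exact: node_cond_indep_discrete (root_block_family n k).
Qed.

End mra.

(** * Distribution functions and copulas *)

Section left_limits.
Context (R : realType) (d : measure_display) (T : measurableType d).
Variable P : probability T R.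

Lemma below_measurable b a (X : T -> R) : measurable_fun setT X ->
  measurable [set w | below b a (X w)].
Proof. by move=> mX; exact: (measurable_preimage mX (measurable_below b a)). Qed.

(** Continuity from below along [a - 1 / (m + 1)]. The bound holds for all [y] from [x] up to [a],
    so several such approximations can be evaluated at one common point. *)
Lemma left_approx (X : T -> R) (E : set T) a eps :
  measurable_fun setT X -> measurable E -> 0 < eps ->
  exists2 x, x < a & forall y, x <= y -> y < a ->
    `|pr P (E `&` [set w | X w <= y]) - pr P (E `&` [set w | X w < a])| <= eps.
Proof.
move=> mX mE e0.
pose F (m : nat) := E `&` [set w | X w <= a - m.+1%:R^-1].
have mF m : measurable (F m).
  by apply: measurableI => //; exact: (@below_measurable true).
have UF : \bigcup_m F m = E `&` [set w | X w < a].
  apply/seteqP; split => w.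
    move=> [m _ [Ew Xw]]; split => //=; apply: le_lt_trans Xw _.
    by rewrite ltrBlDr ltrDl invr_gt0 ltr0n.
  move=> [Ew /= Xw]; have aX : 0 < a - X w by rewrite subr_gt0.
  exists (Num.truncn (a - X w)^-1) => //; split => //=.
  rewrite lerBrDl -lerBrDr invf_ple ?posrE ?ltr0n//.
  exact/ltW/truncnS_gt.
have mUF : measurable (\bigcup_m F m) by exact: bigcupT_measurable.
have ndF : nondecreasing_seq F.
  move=> m k mk; apply/subsetPset => w [Ew Xw]; split => //=.
  apply: le_trans Xw _; rewrite lerD2l lerN2 lef_pV2 ?posrE ?ltr0n//.
  by rewrite ler_nat ltnS.
have cF : (fun m => pr P (F m)) @ \oo --> pr P (\bigcup_m F m).
  rewrite /pr; have := nondecreasing_cvg_mu (mu := P) mF mUF ndF.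
  rewrite -[X in _ --> X]fineK; last by rewrite fin_num_measure.
  by move=> /fine_cvgP[].
have /cvgrPdist_le /(_ _ e0)[m _ /(_ m (leqnn _))] := cF.
rewrite UF => le; exists (a - m.+1%:R^-1).
  by rewrite ltrBlDr ltrDl invr_gt0 ltr0n.
move=> y xy ya.
have mle z : measurable (E `&` [set w | X w <= z]).
  by apply: measurableI => //; exact: (@below_measurable true).
have mlt : measurable (E `&` [set w | X w < a]).
  by apply: measurableI => //; exact: (@below_measurable false).
have h1 : pr P (F m) <= pr P (E `&` [set w | X w <= y]).
  by apply: pr_le => // w [Ew Xw]; split => //; exact: le_trans Xw xy.
have h2 : pr P (E `&` [set w | X w <= y]) <= pr P (E `&` [set w | X w < a]).
  by apply: pr_le => // w [Ew Xw]; split => //; exact: le_lt_trans Xw ya.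
move: le; rewrite ger0_norm ?subr_ge0//; last exact: le_trans h2.
by rewrite distrC ger0_norm ?subr_ge0//; apply: le_trans; rewrite lerD2l lerN2.
Qed.

End left_limits.

Lemma eq_of_dist_le (R : realType) (x y c : R) :
  (forall eps, 0 < eps -> `|x - y| <= c * eps) -> x = y.
Proof.
move=> h; apply/eqP; rewrite -subr_eq0 -normr_eq0 eq_le normr_ge0 andbT.
apply/ler_addgt0Pr => e e0; rewrite add0r.
have c0 : 0 < `|c| + 1 by rewrite ltr_wpDl.
apply: le_trans (h (e / (`|c| + 1)) (divr_gt0 e0 c0)) _.
rewrite mulrA ler_pdivrMr// mulrC ler_pM2l//.
by rewrite (le_trans (ler_norm c))// lerDl.
Qed.

Lemma eq_cdf_below (R : realType) d (T : measurableType d) (P : probability T R)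
    d' (T' : measurableType d') (Q : probability T' R) (X : T -> R) (Z : T' -> R) b a :
  measurable_fun setT X -> measurable_fun setT Z ->
  (forall x, P [set w | X w <= x] = Q [set w | Z w <= x]) ->
  pr P [set w | below b a (X w)] = pr Q [set w | below b a (Z w)].
Proof.
move=> mX mZ XZ; case: b => /=; first by rewrite /pr XZ.
apply: (@eq_of_dist_le _ _ _ 2) => e e0.
have [x xa hx] := left_approx P a mX measurableT e0.
have [z za hz] := left_approx Q a mZ measurableT e0.
have ma : Num.max x z < a by rewrite gt_max xa za.
have := hx (Num.max x z); have := hz (Num.max x z).
rewrite !le_max !lexx orbT !setTI => /(_ isT ma) h1 /(_ isT ma).
rewrite {1}/pr XZ -/(pr Q _) => h2.
rewrite distrC in h2; apply: le_trans (ler_distD (pr Q [set w | Z w <= Num.max x z]) _ _) _.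
by rewrite mulrDl mul1r lerD.
Qed.

Section copulas.
Context (R : realType) (C : R -> R -> R).
Hypothesis hC : is_copula C.

(** The rectangle inequality on [[u, u'] x [0, t]] gives monotonicity; on [[u, u'] x [t, 1]] it
    bounds the increment by [u' - u]. *)
Lemma copula_lipschitz_l (u u' t : R) : 0 <= u <= 1 -> 0 <= u' <= 1 -> 0 <= t <= 1 ->
  `|C u t - C u' t| <= `|u - u'|.
Proof.
wlog uu' : u u' / u <= u'.
  move=> H h h' ht; have [/H|/ltW /H] := leP u u'; first exact.
  by rewrite (distrC (C u t)) (distrC u); apply.
have [bd inc] := hC; move=> /andP[u0 u1] /andP[u'0 u'1] /andP[t0 t1].
have i01 (x : R) : 0 <= x -> x <= 1 -> 0 <= x <= 1 by move=> -> ->.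
have [Cu0 [_ [Cu1 _]]] := bd u (i01 _ u0 u1).
have [Cu'0 [_ [Cu'1 _]]] := bd u' (i01 _ u'0 u'1).
have := inc u 0 u' t u0 (lexx 0) u'1 t1 uu' t0.
have := inc u t u' 1 u0 t0 u'1 (lexx 1) uu' t1.
rewrite Cu0 Cu'0 Cu1 Cu'1 => h1 h2.
by rewrite ler0_norm ?ler0_norm; lra.
Qed.

Lemma copula_lipschitz_r (u u' t : R) : 0 <= u <= 1 -> 0 <= u' <= 1 -> 0 <= t <= 1 ->
  `|C t u - C t u'| <= `|u - u'|.
Proof.
wlog uu' : u u' / u <= u'.
  move=> H h h' ht; have [/H|/ltW /H] := leP u u'; first exact.
  by rewrite (distrC (C t u)) (distrC u); apply.
have [bd inc] := hC; move=> /andP[u0 u1] /andP[u'0 u'1] /andP[t0 t1].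
have i01 (x : R) : 0 <= x -> x <= 1 -> 0 <= x <= 1 by move=> -> ->.
have [_ [C0u [_ C1u]]] := bd u (i01 _ u0 u1).
have [_ [C0u' [_ C1u']]] := bd u' (i01 _ u'0 u'1).
have := inc 0 u t u' (lexx 0) u0 t1 u'1 t0 uu'.
have := inc t u 1 u' t0 u0 (lexx 1) u'1 t1 uu'.
rewrite C0u C0u' C1u C1u' => h1 h2.
by rewrite ler0_norm ?ler0_norm; lra.
Qed.

(** The identity passes from weak to strict corners by left limits, one coordinate at a time; the
    Lipschitz bound carries the limit into the argument of [C]. *)
Lemma copula_below d (T : measurableType d) (Q : probability T R) (Z Z' : T -> R) :
  measurable_fun setT Z -> measurable_fun setT Z' ->
  (forall x x', Q [set w | Z w <= x /\ Z' w <= x'] =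
    (C (pr Q [set w | Z w <= x]) (pr Q [set w | Z' w <= x']))%:E) ->
  forall b b' a a', pr Q [set w | below b a (Z w) && below b' a' (Z' w)] =
    C (pr Q [set w | below b a (Z w)]) (pr Q [set w | below b' a' (Z' w)]).
Proof.
move=> mZ mZ' h b b' a a'.
pose B c x := [set w | below c x (Z w)]; pose B' c x := [set w | below c x (Z' w)].
have mB c x : measurable (B c x) by exact: below_measurable.
have mB' c x : measurable (B' c x) by exact: below_measurable.
have p01 A : measurable A -> 0 <= pr Q A <= 1 by move=> mA; rewrite pr_ge0 pr_le1.
have E c c' x x' : [set w | below c x (Z w) && below c' x' (Z' w)] = B' c' x' `&` B c x.
  by apply/seteqP; split => [w /andP[]|w [h1 h2]] //; apply/andP.
rewrite E -/(B b a) -/(B' b' a').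
have step1 x' : pr Q (B' true x' `&` B b a) = C (pr Q (B b a)) (pr Q (B' true x')).
  have base x : pr Q (B' true x' `&` B true x) = C (pr Q (B true x)) (pr Q (B' true x')).
    rewrite /pr -/(pr Q (B true x)) -/(pr Q (B' true x')) setIC.
    by rewrite [Q _](h x x').
  case: (b) => //; apply: (@eq_of_dist_le _ _ _ 2) => e e0.
  have [x xa hx] := left_approx Q a mZ (mB' true x') e0.
  have [y ya hy] := left_approx Q a mZ measurableT e0.
  have ma : Num.max x y < a by rewrite gt_max xa ya.
  have := hx (Num.max x y); have := hy (Num.max x y).
  rewrite !le_max !lexx orbT !setTI => /(_ isT ma) h1 /(_ isT ma).
  rewrite distrC => h2.
  apply: le_trans (ler_distD (pr Q (B' true x' `&` B true (Num.max x y))) _ _) _.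
  rewrite mulrDl mul1r lerD// base; apply: le_trans _ h1.
  by apply: copula_lipschitz_l; exact: p01.
case: (b'); first exact: step1.
apply: (@eq_of_dist_le _ _ _ 2) => e e0.
have [x xa hx] := left_approx Q a' mZ' (mB b a) e0.
have [y ya hy] := left_approx Q a' mZ' measurableT e0.
have ma : Num.max x y < a' by rewrite gt_max xa ya.
have := hx (Num.max x y); have := hy (Num.max x y).
rewrite !le_max !lexx orbT !setTI => /(_ isT ma) h1 /(_ isT ma).
rewrite distrC => h2; rewrite setIC.
apply: le_trans (ler_distD (pr Q (B b a `&` B' true (Num.max x y))) _ _) _.
rewrite mulrDl mul1r lerD// setIC step1; apply: le_trans _ h1.
by apply: copula_lipschitz_r; exact: p01.
Qed.

End copulas.

(** * Total variation of discrete laws *)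

Section total_variation.
Context (R : realType) (X : eqType).

(* The finite additivity that both laws and empirical measures enjoy. *)
Definition mass (F : set (set X)) (nu : set X -> R) :=
  [/\ forall A, F A -> F (~` A), forall A, F A -> nu A + nu (~` A) = 1 &
      forall A (Z : seq X), F A -> uniq Z ->
        \sum_(z <- Z | `[< A z >]) nu [set z] <= nu A].

(** Passing to the complement, [q B] is at most [eps] plus its atoms in [Z] inside [B], and these
    exceed [nu B] by at most the atom distance. Taking [B] to be [A] and then its complement gives
    both signs, so only [q] has to be concentrated on [Z]. *)
Lemma mass_dist_le F nu q (Z : seq X) eps A : mass F nu -> mass F q ->
  uniq Z -> 1 - eps <= \sum_(z <- Z) q [set z] -> F A ->
  `|nu A - q A| <= \sum_(z <- Z) `|nu [set z] - q [set z]| + eps.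
Proof.
move=> [FC nuC nus] [_ qC qs] uZ Zq FA.
set D := \sum_(z <- Z) _.
have half B : F B -> q B <= eps + D + nu B.
  move=> FB; have FCB := FC _ FB.
  have hq : q B = 1 - q (~` B) by rewrite -(qC _ FB) addrK.
  have sp : \sum_(z <- Z) q [set z] = \sum_(z <- Z | `[< B z >]) q [set z] +
      \sum_(z <- Z | `[< (~` B) z >]) q [set z].
    rewrite (bigID (fun z => `[< B z >]))/=; congr (_ + _).
    by apply: eq_bigl => z; apply/asboolPn/asboolP.
  have cB := qs _ Z FCB uZ; have nB := nus _ Z FB uZ.
  have dB : \sum_(z <- Z | `[< B z >]) q [set z] <=
      \sum_(z <- Z | `[< B z >]) nu [set z] + D.
    rewrite -lerBlDl -sumrB /D [leRHS](bigID (fun z => `[< B z >]))/= -[leLHS]addr0 lerD//.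
      by apply: ler_sum => z _; rewrite distrC ler_norm.
    exact: sumr_ge0.
  by rewrite hq; lra.
rewrite ler_distl; have h1 := half _ FA; have h2 := half _ (FC _ FA).
have := nuC _ FA; have := qC _ FA => e1 e2.
by apply/andP; split; lra.
Qed.

(** Atoms are tested only in [L], so that for random measures countably many candidates can suffice;
    the threshold [N] is common to all [A]. *)
Lemma mass_cvg F (nu : nat -> set X -> R) q (L : set X) :
  (forall n, (0 < n)%N -> mass F (nu n)) -> mass F q ->
  (forall eps, 0 < eps -> exists Z : seq X,
     [/\ uniq Z, forall z, z \in Z -> L z & 1 - eps <= \sum_(z <- Z) q [set z]]) ->
  (forall z, L z -> forall eps, 0 < eps -> exists N, forall n, (N <= n)%N -> (0 < n)%N ->
     `|nu n [set z] - q [set z]| <= eps) ->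
  forall eps, 0 < eps -> exists N, forall n, (N <= n)%N -> (0 < n)%N -> forall A, F A ->
     `|nu n A - q A| <= eps.
Proof.
move=> mnu mq tight cv eps e0.
have e2 : 0 < eps / 2 by rewrite divr_gt0.
have [Z [uZ ZL Zq]] := tight _ e2.
have pt : forall delta, 0 < delta -> exists N, forall n, (N <= n)%N -> (0 < n)%N ->
    \sum_(z <- Z) `|nu n [set z] - q [set z]| <= delta.
  elim: Z ZL {uZ Zq} => [|z Z IH] ZL delta d0.
    by exists 0%N => n _ _; rewrite big_nil ltW.
  have d2 : 0 < delta / 2 by rewrite divr_gt0.
  have [N1 h1] := cv z (ZL z (mem_head _ _)) _ d2.
  have [y yZ|N2 h2] := IH _ _ d2; first by apply: ZL; rewrite inE yZ orbT.
  exists (maxn N1 N2) => n; rewrite geq_max => /andP[n1 n2] n0.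
  by rewrite big_cons [leRHS](splitr delta) lerD ?h1 ?h2.
have [N h] := pt _ e2; exists N => n Nn n0 A FA.
rewrite (splitr eps); apply: le_trans (mass_dist_le (mnu n n0) mq uZ Zq FA) _.
by rewrite lerD2r h.
Qed.

End total_variation.

Section laws.
Context (R : realType) (d : measure_display) (T : measurableType d).
Variable P : probability T R.

Lemma pr_mem_seq d' (U : measurableType d') (X : T -> U) (Z : seq U) :
  measurable_fun setT X -> (forall z : U, measurable [set z]) -> uniq Z ->
  measurable (X @^-1` [set z | z \in Z]) /\
  pr P (X @^-1` [set z | z \in Z]) = \sum_(z <- Z) pr P (X @^-1` [set z]).
Proof.
move=> mX m1; elim: Z => [_|z Z IH /= /andP[zZ uZ]].
  rewrite big_nil (_ : _ @^-1` _ = set0); last by apply/seteqP; split.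
  by rewrite pr_set0.
have [mZ prZ] := IH uZ.
have -> : X @^-1` [set y | y \in z :: Z] = X @^-1` [set z] `|` X @^-1` [set y | y \in Z].
  apply/seteqP; split => w /=; rewrite inE; first by case/orP => [/eqP|]; [left|right].
  by case=> ->; rewrite ?eqxx ?orbT.
have mz : measurable (X @^-1` [set z]) by exact: measurable_preimage.
split; first exact: measurableU.
rewrite big_cons -prZ pr_setU_disj//.
by apply/seteqP; split => // w [/= -> h]; rewrite h in zZ.
Qed.

Lemma law_mass d' (U : measurableType d') (X : T -> U) :
  measurable_fun setT X -> (forall z : U, measurable [set z]) ->
  mass measurable (fun B => pr P (X @^-1` B)).
Proof.
move=> mX m1; split.
- by move=> A; exact: measurableC.
- move=> A mA; rewrite preimage_setC pr_setC ?subrKC//.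
  exact: measurable_preimage.
- move=> A Z mA uZ; rewrite -big_filter.
  have [mZ <-] := pr_mem_seq mX m1 (filter_uniq (fun z => `[< A z >]) uZ).
  apply: pr_le => //; first exact: measurable_preimage.
  by move=> w /=; rewrite mem_filter => /andP[/asboolP].
Qed.

(** The mass listed at [v] is at most the jump of [F] there, hence at most the atom of [X], and
    finitely many terms already carry [1 - eps]. The list [a] comes from [F] alone and may repeat
    values. *)
Lemma discrete_support (F : R -> R) : discrete_cdf F -> exists a : nat -> R,
  forall X : T -> R, has_cdf P X F -> forall eps, 0 < eps -> exists s : seq R,
  [/\ uniq s, forall v, v \in s -> range a v & 1 - eps <= pr P (X @^-1` [set v | v \in s])].
Proof.
move=> [a [p [p0 [psum pF]]]]; exists a => X [mX XF] eps e0.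
have /cvgrPdist_le /(_ _ e0)[N _ /(_ N (leqnn _))] := psum.
rewrite ler_distl => /andP[_ hN].
pose s := undup [seq a i | i <- iota 0 N].
have us : uniq s by exact: undup_uniq.
exists s; split => //.
  by move=> v; rewrite mem_undup => /mapP[i _ ->]; exists i.
have [ms ->] := pr_mem_seq mX (@measurable_set1 R) us.
have atom v : \sum_(i < N | a i == v) p i <= pr P (X @^-1` [set v]).
  apply/ler_addgt0Pr => e e0'.
  have [x xv /(_ x (lexx _) xv)] := left_approx P v mX measurableT e0'.
  rewrite !setTI ler_distl => /andP[hx _].
  have mlt : measurable [set w | X w < v] by exact: (@below_measurable _ _ _ false).
  have mle y : measurable [set w | X w <= y] by exact: (@below_measurable _ _ _ true).
  have mv : measurable (X @^-1` [set v]) by exact: measurable_preimage.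
  have sp : pr P [set w | X w <= v] = pr P [set w | X w < v] + pr P (X @^-1` [set v]).
    rewrite -pr_setU_disj//.
      congr (pr P _); apply/seteqP; split => w /=; rewrite le_eqVlt.
        by case/orP => [/eqP|]; [right|left].
      by case=> [->|->]; rewrite ?eqxx ?orbT.
    by apply/seteqP; split => // w [/= + Xv]; rewrite Xv ltxx.
  (* Terms with [a i = v] count fully because [x < v], and all others are nonnegative; so the first
     [N] terms bound every longer partial sum, and its limit, from below. *)
  have gap : \sum_(i < N | a i == v) p i <= F v - F x.
    pose f K := \sum_(i < K) (if a i <= v then p i else 0) -
      \sum_(i < K) (if a i <= x then p i else 0).
    have cf : f @ \oo --> F v - F x by apply: cvgB; exact: pF.
    rewrite -(cvg_lim (@Rhausdorff R) cf).
    apply: limr_ge; first by apply/cvg_ex; exists (F v - F x).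
    have step_ge0 i : 0 <= (if a i <= v then p i else 0) - (if a i <= x then p i else 0).
      have [aix|aix] := leP (a i) x; first by rewrite (le_trans aix (ltW xv)) subrr.
      by rewrite subr0; case: ifP.
    exists N => // K /= NK; rewrite /f -sumrB.
    rewrite -(big_mkord (fun i => a i == v) p).
    rewrite -(big_mkord xpredT
      (fun i => (if a i <= v then p i else 0) - (if a i <= x then p i else 0))).
    rewrite (big_cat_nat (leq0n N) NK)/= big_mkcond/= -[leLHS]addr0 lerD//.
      apply: ler_sum => i _; case: eqP => [->|_].
        by rewrite lexx (lt_geF xv) subr0.
      exact: step_ge0.
    by apply: sumr_ge0 => i _; exact: step_ge0.
  have Fv y : F y = pr P [set w | X w <= y] by rewrite /pr XF.
  by rewrite !Fv in gap; lra.
apply: le_trans (_ : \sum_(v <- s) \sum_(i < N | a i == v) p i <= _); last first.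
  by apply: ler_sum => v _; exact: atom.
(* Each [a i] occurs exactly once in the duplicate-free [s], so the double sum collapses to the
   partial sum of [p]. *)
rewrite (exchange_big_dep xpredT)//= (eq_bigr (fun i : 'I_N => p i)); first by lra.
move=> i _; rewrite big_const_seq.
have -> : count (fun v => a i == v) s = 1%N.
  rewrite (eq_count (a2 := pred1 (a i))); last by move=> v; rewrite /= eq_sym.
  rewrite count_uniq_mem// mem_undup map_f// mem_iota add0n/= ltn_ord//.
by rewrite /= addr0.
Qed.

End laws.

(** * Limits of the MRA output *)

Section atoms.
Context (R : realType) (d : measure_display) (T : measurableType d).
Variable P : probability T R.

Definition corner (X Y : T -> R) a b c c' :=
  pr P [set w | below c a (X w) && below c' b (Y w)].

(** Inclusion-exclusion at one point: strict is subtracted from weak first in [X], then in [Y]. *)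
Lemma atom_corners (X Y : T -> R) a b :
  measurable_fun setT X -> measurable_fun setT Y ->
  pr P [set w | X w = a /\ Y w = b] =
  corner X Y a b true true - corner X Y a b false true
  - corner X Y a b true false + corner X Y a b false false.
Proof.
move=> mX mY; pose B c c' := [set w | below c a (X w) && below c' b (Y w)].
have mB c c' : measurable (B c c').
  rewrite (_ : B c c' = [set w | below c a (X w)] `&` [set w | below c' b (Y w)]).
    by apply: measurableI; exact: below_measurable.
  by apply/seteqP; split => [w /andP[]|w [h1 h2]] //; apply/andP.
have weak c x y : below false x y -> below c x y by case: c => //; exact: ltW.
have nbelow x y : below true x y -> ~~ below false x y -> y = x.
  by move=> /= h; rewrite -leNgt => h'; apply/le_anti; rewrite h h'.
have row c' : pr P (B true c') =
    pr P (B false c') + pr P [set w | X w = a /\ below c' b (Y w)].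
  rewrite (pr_setID P (mB true c') (mB false c')); congr (_ + _).
    congr (pr P _); apply/seteqP; split => [w []//|w /= h]; split => //.
    by case/andP: h => /weak h h'; apply/andP.
  congr (pr P _); apply/seteqP; split => w.
    move=> [/andP[h1 h2] /negP]; rewrite /B /mkset h2 andbT => h3.
    by split => //; exact: nbelow.
  move=> [Xa h]; split; first by rewrite /B /mkset h andbT Xa /= lexx.
  by rewrite /B => /andP[]; rewrite Xa /= ltxx.
have mXa : measurable [set w | X w = a].
  by apply: (@measurable_preimage _ _ _ _ X [set a]).
have col : pr P [set w | X w = a /\ below true b (Y w)] =
    pr P [set w | X w = a /\ below false b (Y w)] + pr P [set w | X w = a /\ Y w = b].
  have mm c' : measurable [set w | X w = a /\ below c' b (Y w)].
    by apply: measurableI => //; exact: below_measurable.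
  rewrite (pr_setID P (mm true) (mm false)); congr (_ + _).
    congr (pr P _); apply/seteqP; split => [w []//|w [h1 h2]]; split => //.
    by split => //; exact: weak h2.
  congr (pr P _); apply/seteqP; split => w.
    move=> [[Xa h1] h2]; split => //; apply: nbelow => //.
    by apply/negP => h3; apply: h2.
  move=> [Xa Yb]; split; first by split => //; rewrite Yb /= lexx.
  by move=> [_]; rewrite Yb /= ltxx.
have := row true; have := row false; rewrite /corner -!/(B _ _) col => -> ->; ring.
Qed.

(** Conditional independence is tested on [X1 = a], [X2 = b] against [X3 = c] at the sum [a + b];
    the first two equations already imply the conditioning event. *)
Lemma cond_indep_atom (X1 X2 X3 : T -> R) a b c :
  cond_indep_discrete P (fun w => (X1 w, X2 w, X1 w + X2 w))
    (fun w => (X3 w, X1 w + X2 w + X3 w)) (fun w => X1 w + X2 w) ->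
  measurable_fun setT X1 -> measurable_fun setT X2 -> measurable_fun setT X3 ->
  pr P [set w | (X1 w, X2 w, X3 w) = (a, b, c)] * pr P [set w | X1 w + X2 w = a + b] =
  pr P [set w | (X1 w, X2 w) = (a, b)] *
  pr P [set w | X1 w + X2 w = a + b /\ X3 w = c].
Proof.
move=> ci m1 m2 m3.
have msum : measurable_fun setT (fun w => X1 w + X2 w) by exact: measurable_funD.
have meq (X : T -> R) x : measurable_fun setT X -> measurable [set w | X w = x].
  by move=> mX; apply: (@measurable_preimage _ _ _ _ X [set x]).
have mA : measurable [set y : R * R * R | y.1.1 = a /\ y.1.2 = b].
  apply: measurableI.
    apply: (@measurable_preimage _ _ _ _ (fun y : R * R * R => y.1.1) [set a]) => //.
    exact: measurableT_comp measurable_fst measurable_fst.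
  apply: (@measurable_preimage _ _ _ _ (fun y : R * R * R => y.1.2) [set b]) => //.
  exact: measurableT_comp measurable_snd measurable_fst.
have mB : measurable [set y : R * R | y.1 = c].
  apply: (@measurable_preimage _ _ _ _ (fun y : R * R => y.1) [set c]) => //.
  exact: measurable_fst.
have := ci _ _ (a + b) mA mB; rewrite /=.
have -> : (fun w => (X1 w, X2 w, X1 w + X2 w)) @^-1` [set y | y.1.1 = a /\ y.1.2 = b] `&`
   (fun w => (X3 w, X1 w + X2 w + X3 w)) @^-1` [set y | y.1 = c] `&`
   (fun w => X1 w + X2 w) @^-1` [set a + b] = [set w | (X1 w, X2 w, X3 w) = (a, b, c)].
  apply/seteqP; split => w /=; first by move=> [[[-> ->] ->] _].
  by case=> -> -> ->.
have -> : (fun w => (X1 w, X2 w, X1 w + X2 w)) @^-1` [set y | y.1.1 = a /\ y.1.2 = b] `&`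
   (fun w => X1 w + X2 w) @^-1` [set a + b] = [set w | (X1 w, X2 w) = (a, b)].
  apply/seteqP; split => w /=; first by move=> [[-> ->] _].
  by case=> -> ->.
have -> : (fun w => (X3 w, X1 w + X2 w + X3 w)) @^-1` [set y | y.1 = c] `&`
   (fun w => X1 w + X2 w) @^-1` [set a + b] = [set w | X1 w + X2 w = a + b /\ X3 w = c].
  by apply/seteqP; split => w /= [].
have mab : measurable [set w | (X1 w, X2 w) = (a, b)].
  rewrite (_ : [set _ | _] = [set w | X1 w = a] `&` [set w | X2 w = b]).
    by apply: measurableI; exact: meq.
  by apply/seteqP; split => w /= [-> ->].
have mabc : measurable [set w | (X1 w, X2 w, X3 w) = (a, b, c)].
  rewrite (_ : [set _ | _] = [set w | (X1 w, X2 w) = (a, b)] `&` [set w | X3 w = c]).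
    by apply: measurableI => //; exact: meq.
  by apply/seteqP; split => w /=; [move=> [-> -> ->]|move=> [[-> ->] ->]].
have msc : measurable [set w | X1 w + X2 w = a + b /\ X3 w = c].
  by apply: measurableI; exact: meq.
by move=> /(congr1 fine); rewrite !prE//; exact: meq.
Qed.

End atoms.

Section tends.
Context (R : realType).

(** The guard [0 < n] sets aside the empty batch, which has neither a position 0 nor an empirical
    law. *)
Definition tends (f : nat -> R) (l : R) :=
  forall eps, 0 < eps -> exists N, forall n, (N <= n)%N -> (0 < n)%N -> `|f n - l| <= eps.

Lemma tendsP f l : tends f l <-> f @ \oo --> l.
Proof.
split=> [h|/cvgrPdist_le h eps e0].
  apply/cvgrPdist_le => eps e0; have [N hN] := h _ e0.
  exists (maxn N 1) => // n /=; rewrite geq_max => /andP[Nn n0].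
  by rewrite distrC hN.
by have [N _ hN] := h _ e0; exists N => n Nn _; rewrite distrC hN.
Qed.

Lemma tends_atom (F : bool -> bool -> nat -> R) (G : bool -> bool -> R) :
  (forall c c', tends (F c c') (G c c')) ->
  tends (fun n => F true true n - F false true n - F true false n + F false false n)
        (G true true - G false true - G true false + G false false).
Proof.
move=> h; have {}h c c' : F c c' n @[n --> \oo] --> G c c' by apply/tendsP.
by apply/tendsP; apply: cvgD => //; apply: cvgB => //; exact: cvgB.
Qed.

(** If [s'] is nonzero, [p] is eventually [y r / s]. Otherwise [y'] and [p'] vanish and [p] is
    squeezed between 0 and [y]. *)
Lemma tends_cond (p s y r : nat -> R) p' s' y' r' :
  (forall n, p n * s n = y n * r n) -> p' * s' = y' * r' ->
  (forall n, 0 <= p n <= y n) -> 0 <= p' <= y' -> 0 <= y' <= s' ->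
  tends s s' -> tends y y' -> tends r r' -> tends p p'.
Proof.
move=> e e' py py' ys hs hy hr.
have [s0|s0] := eqVneq s' 0.
  have y0 : y' = 0 by apply/le_anti; rewrite -{1}s0 andbC.
  have p0 : p' = 0 by apply/le_anti; rewrite -{1}y0 andbC.
  move=> eps e0; have [N hN] := hy _ e0; exists N => n Nn n0.
  have := hN n Nn n0; rewrite y0 p0 !subr0; apply: le_trans.
  by have /andP[h1 h2] := py n; rewrite !ger0_norm// (le_trans h1).
move/tendsP in hs; move/tendsP in hy; move/tendsP in hr; apply/tendsP.
have pE : p' = y' * r' * s'^-1 by rewrite -e' mulfK.
have cv : (fun n => y n * r n * (s n)^-1) @ \oo --> p'.
  by rewrite pE; apply: cvgM; [exact: cvgM|exact: cvgV].
have [N _ hN] := cvgr_neq0 _ hs s0.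
have eqN : {near \oo, (fun n => y n * r n * (s n)^-1) =1 p}.
  by exists N => // n /= /hN sn; rewrite -e mulfK.
exact: cvg_trans (near_eq_cvg eqN) cv.
Qed.

End tends.

(** * Convergence at node (1) and at the root *)

Section mra_limits.
Context (R : realType) (d : measure_display) (Omega : measurableType d).
Variables (P : probability Omega R) (M : mra_rand R Omega).
Variables (F11 F12 F2 F1 : R -> R) (C1 C0 : R -> R -> R).
Hypotheses (hC1 : is_copula C1) (hC0 : is_copula C0).
Hypothesis hM : mra_law P F11 F12 F2 C1 C0 M.
Context (d' : measure_display) (T' : measurableType d').
Variables (Q : probability T' R) (Z11 Z12 Z2 : T' -> R).
Hypothesis hQ : tree_dependent Q F11 F12 F2 F1 C1 C0 Z11 Z12 Z2.
Hypotheses (hF11 : discrete_cdf F11) (hF12 : discrete_cdf F12) (hF2 : discrete_cdf F2).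
Hypothesis hF1 : sum_cdf_under F11 F12 C1 F1.

Let m11 : measurable_fun setT Z11. Proof. by case: hQ => -[]. Qed.
Let m12 : measurable_fun setT Z12. Proof. by case: hQ => -[_ []]. Qed.
Let m2 : measurable_fun setT Z2. Proof. by case: hQ => -[_ []]. Qed.
Let m1 : measurable_fun setT (fun w => Z11 w + Z12 w).
Proof. exact: measurable_funD. Qed.

Let cdf11 x : Q [set w | Z11 w <= x] = (F11 x)%:E. Proof. by case: hQ => _ []. Qed.
Let cdf12 x : Q [set w | Z12 w <= x] = (F12 x)%:E. Proof. by case: hQ => _ [_ []]. Qed.
Let cdf2 x : Q [set w | Z2 w <= x] = (F2 x)%:E. Proof. by case: hQ => _ [_ []]. Qed.
Let cdf1 x : Q [set w | Z11 w + Z12 w <= x] = (F1 x)%:E.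
Proof. by case: hQ => _ _ h _ _; exact: hF1. Qed.

Let corner_leaf_limit a b c c' :
  corner Q Z11 Z12 a b c c' =
  C1 (pr Q [set w | below c a (Z11 w)]) (pr Q [set w | below c' b (Z12 w)]).
Proof.
apply: (copula_below hC1) => // x x'; case: hQ => _ _ h _ _.
by rewrite h /pr cdf11 cdf12.
Qed.

Let corner_root_limit a b c c' :
  corner Q (fun w => Z11 w + Z12 w) Z2 a b c c' =
  C0 (pr Q [set w | below c a (Z11 w + Z12 w)]) (pr Q [set w | below c' b (Z2 w)]).
Proof.
apply: (copula_below hC0) => // x x'; case: hQ => _ _ _ h _.
by rewrite h /pr cdf1 cdf2.
Qed.

Let rate (delta : R) : 0 < delta -> exists eps, 0 < eps /\ exists N : nat,
  forall n, (N <= n)%N -> (0 < n)%N -> 7 * eps + 5 * (eps ^+ 4 * n%:R ^+ 2)^-1 <= delta.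
Proof.
(* [7 eps] takes half of [delta]; [K] is such that [n >= K] gives [5 / (eps^4 n^2) <= delta / 2],
   through [n <= n^2]. *)
move=> d0; pose eps := delta / 14.
have e0 : 0 < eps by rewrite divr_gt0.
exists eps; split => //; pose K := 10 * (eps ^+ 4)^-1 * delta^-1.
exists (Num.truncn K).+1 => n Kn n0.
have nR : 1 <= n%:R :> R by rewrite ler1n.
have n0R : 0 < n%:R :> R by rewrite ltr0n.
have Kn' : K <= n%:R.
  by apply: le_trans (ltW (truncnS_gt K)) _; rewrite ler_nat.
have e4 : 0 < eps ^+ 4 by rewrite exprn_gt0.
have h : 5 * (eps ^+ 4 * n%:R ^+ 2)^-1 <= delta / 2.
  rewrite ler_pdivrMr ?mulr_gt0 ?exprn_gt0//.
  have : K <= n%:R ^+ 2 by rewrite (le_trans Kn')// expr2 ler_peMr// ltW.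
  rewrite /K ler_pdivrMr// ler_pdivrMr//; lra.
have -> : delta = 7 * eps + delta / 2 by rewrite /eps; field.
by rewrite lerD2l.
Qed.

Let p01 (b : bool) (a : R) (X : T' -> R) : measurable_fun setT X ->
  0 <= pr Q [set w | below b a (X w)] <= 1.
Proof. by move=> mX; rewrite pr_ge0 pr_le1//; exact: below_measurable. Qed.

Let copula_events (X Y : Omega -> R) C u v : is_copula C -> has_copula P X Y C ->
  0 <= u <= 1 -> 0 <= v <= 1 ->
  [/\ pr P [set w | X w <= u] = u, pr P [set w | Y w <= v] = v &
      pr P [set w | (X w <= u) && (Y w <= v)] = C u v].
Proof.
move=> hC hXY u01 v01; have [bd _] := hC.
have [mX [mY _]] := hXY.
have i01 : 0 <= (1 : R) <= 1 by rewrite ler01 lexx.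
have cov (Z : Omega -> R) (E : set Omega) : measurable E ->
    measurable_fun setT Z -> pr P [set w | Z w <= 1] = 1 ->
    pr P E = pr P (E `&` [set w | Z w <= 1]).
  move=> mE mZ Z1; rewrite (pr_setID P mE (measurable_le 1 mZ)).
  suff -> : pr P (E `\` [set w | Z w <= 1]) = 0 by rewrite addr0.
  have p0 : pr P (~` [set w | Z w <= 1]) = 0.
    by rewrite pr_setC ?Z1 ?subrr//; exact: measurable_le.
  apply/le_anti; rewrite pr_ge0 andbT -[leRHS]p0; apply: pr_le.
  - by apply: measurableD => //; exact: measurable_le.
  - by apply: measurableC; exact: measurable_le.
  - by move=> w [].
have [_ [_ cXY]] := hXY.
have both : pr P [set w | X w <= 1 /\ Y w <= 1] = 1.
  by rewrite /pr cXY//=; have [_ [_ [_ ->]]] := bd 1 i01.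
have mXY : measurable [set w | X w <= 1 /\ Y w <= 1].
  by apply: measurableI; exact: measurable_le.
have X1 : pr P [set w | X w <= 1] = 1.
  apply/le_anti; rewrite pr_le1/=; last exact: measurable_le.
  by rewrite -[leLHS]both; apply: pr_le => // [|w []//]; exact: measurable_le.
have Y1 : pr P [set w | Y w <= 1] = 1.
  apply/le_anti; rewrite pr_le1/=; last exact: measurable_le.
  by rewrite -[leLHS]both; apply: pr_le => // [|w []//]; exact: measurable_le.
split.
- rewrite (cov Y)//; last exact: measurable_le.
  rewrite /pr (_ : _ `&` _ = [set w | X w <= u /\ Y w <= 1])// cXY//=.
  by have [_ [_ [-> _]]] := bd u u01.
- rewrite (cov X)//; last exact: measurable_le.
  rewrite setIC /pr (_ : _ `&` _ = [set w | X w <= 1 /\ Y w <= v])// cXY//=.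
  by have [_ [_ [_ ->]]] := bd v v01.
- rewrite /pr (_ : [set w | _ && _] = [set w | X w <= u /\ Y w <= v]) ?cXY//.
  by apply/seteqP; split => w /andP.
Qed.

(** Leaf values have exactly the prescribed distribution functions, so [node_limit] applies with no
    gap between [p1] and [u] or [p2] and [v]. *)
Let leaf_corner a b c c' : tends (fun n =>
    corner P (fun w => (node1_out M n 0 0 w).1) (fun w => (node1_out M n 0 0 w).2) a b c c')
  (corner Q Z11 Z12 a b c c').
Proof.
move=> delta d0; have [eps [e0 [N hN]]] := rate d0.
exists N => n Nn n0; apply: le_trans (hN n Nn n0).
rewrite corner_leaf_limit; set u := pr Q _; set v := pr Q _.
have [h _ _] := hM.
have u01 : 0 <= u <= 1 by exact: p01.
have v01 : 0 <= v <= 1 by exact: p01.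
have hcop i : has_copula P (rV1 M n 0 0 i) (rV2 M n 0 0 i) C1.
  by have [_ [_ [_ [_ ]]]] := h n 0%N 0%N i.
have eA i : pr P [set w | below c a (node_key ((leaf_block M n 0 0)^~ w) i)] = u.
  rewrite /node_key /=; have [[mX cX] _] := h n 0%N 0%N i.
  rewrite (_ : [set _ | _] = [set w | below c a (rA M n 0 0 i w)]); last first.
    by apply/funext => w; rewrite /mkset addr0.
  by apply: eq_cdf_below => // x; rewrite cX cdf11.
have eB i : pr P [set w | below c' b (leaf_block M n 0 0 (NZ i) w).1] = v.
  have [_ [[mX cX] _]] := h n 0%N 0%N i.
  by apply: eq_cdf_below => // x; rewrite cX cdf12.
have := @node_limit _ _ _ P n (leaf_block M n 0 0) c c' a b u v u v (C1 u v) eps 0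
  n0 (leaf_block_family hM n 0 0).
rewrite /corner.
rewrite (_ : [set w | below c a (node1_out M n 0 0 w).1 && _] =
  [set w | below c a (node_key ((leaf_block M n 0 0)^~ w) 0) &&
           below c' b (node_out n ((leaf_block M n 0 0)^~ w) 0).2]); last first.
  by apply/funext => w; rewrite /mkset node1_outE /= /node_key /= addr0.
apply => //.
- by move=> i _; have [_ [_ [t _]]] := h n 0%N 0%N i.
- by move=> s s' sn sn' k x; exact: (leaf_block_law hC1 hM).
- by move=> i _; have [] := copula_events hC1 (hcop i) u01 v01.
- by move=> i _; have [] := copula_events hC1 (hcop i) u01 v01.
- by move=> i _; have [] := copula_events hC1 (hcop i) u01 v01.
- by rewrite subrr normr0 ltW.
- by rewrite subrr normr0 ltW.
Qed.

Let set1_pair d1 d2 (U1 : measurableType d1) (U2 : measurableType d2) (z : U1 * U2) :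
  (forall x : U1, measurable [set x]) -> (forall x : U2, measurable [set x]) ->
  measurable [set z].
Proof.
move=> h1 h2; rewrite (_ : [set z] = [set z.1] `*` [set z.2]); first exact: measurableX.
by case: z => a b; apply/seteqP; split => -[x y] /= [-> ->].
Qed.

Let set1_2 (z : R * R) : measurable [set z].
Proof. by apply: set1_pair. Qed.

Let set1_3 (z : R * R * R) : measurable [set z].
Proof. by apply: set1_pair. Qed.

Let mZ12 : measurable_fun setT (fun w => (Z11 w, Z12 w)).
Proof. exact: measurable_fun_pair. Qed.

Let mZ : measurable_fun setT (fun w => (Z11 w, Z12 w, Z2 w)).
Proof. exact: measurable_fun_pair. Qed.

Let mnode1 n : measurable_fun setT (node1_out M n 0 0).
Proof. by have [m _] := root_block_family hM n 0; exact: (m (NY 0)). Qed.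

Let leaf_atom z : tends (fun n => pr P (node1_out M n 0 0 @^-1` [set z]))
  (pr Q ((fun w => (Z11 w, Z12 w)) @^-1` [set z])).
Proof.
case: z => a b.
have -> : (fun w => (Z11 w, Z12 w)) @^-1` [set (a, b)] = [set w | Z11 w = a /\ Z12 w = b].
  by apply/seteqP; split => w /= [-> ->].
rewrite atom_corners//.
have mf n : measurable_fun setT (fun w => (node1_out M n 0 0 w).1).
  exact: measurableT_comp measurable_fst (mnode1 n).
have ms n : measurable_fun setT (fun w => (node1_out M n 0 0 w).2).
  exact: measurableT_comp measurable_snd (mnode1 n).
rewrite (_ : (fun n => _) = (fun n =>
    let c := corner P (fun w => (node1_out M n 0 0 w).1) (fun w => (node1_out M n 0 0 w).2) a b in
    c true true - c false true - c true false + c false false)).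
  exact: (@tends_atom _ (fun c c' n => corner P (fun w => (node1_out M n 0 0 w).1)
     (fun w => (node1_out M n 0 0 w).2) a b c c')).
apply/funext => n; rewrite /= -(atom_corners P a b (mf n) (ms n)); congr (pr P _).
apply/seteqP; split => w; rewrite /preimage /mkset; first by move=> ->.
by case: (node1_out M n 0 0 w) => x y /= [-> ->].
Qed.

Let support2 : exists a b : nat -> R, forall eps, 0 < eps -> exists Z : seq (R * R),
  [/\ uniq Z, forall z, z \in Z -> range a z.1 /\ range b z.2 &
      1 - eps <= pr Q ((fun w => (Z11 w, Z12 w)) @^-1` [set z | z \in Z])].
Proof.
have [a ha] := discrete_support Q hF11; have [b hb] := discrete_support Q hF12.
exists a, b => eps e0; have e2 : 0 < eps / 2 by rewrite divr_gt0.
have [s [us sa hs]] := ha Z11 (conj m11 cdf11) _ e2.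
have [t [ut tb ht]] := hb Z12 (conj m12 cdf12) _ e2.
exists [seq (x, y) | x <- s, y <- t]; split.
- by apply: allpairs_uniq => // -[x y] [x' y'] _ _ [-> ->].
- by move=> z /allpairsP[[x y] /= [xs yt ->]]; split; [exact: sa|exact: tb].
have [ms _] := pr_mem_seq Q m11 (@measurable_set1 R) us.
have [mt _] := pr_mem_seq Q m12 (@measurable_set1 R) ut.
rewrite (_ : _ @^-1` _ = Z11 @^-1` [set x | x \in s] `&` Z12 @^-1` [set y | y \in t]); last first.
  apply/seteqP; split => w; rewrite /preimage /mkset.
    by move=> /allpairsP[[x y] /= [xs yt [e1 e2']]]; rewrite /setI /mkset e1 e2'.
  by move=> [xs yt]; apply/allpairsP; exists (Z11 w, Z12 w).
have := pr_setU Q (measurableC ms) (measurableC mt); rewrite -setCI.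
by rewrite !pr_setC//; [lra|exact: measurableI].
Qed.

(** The candidate atoms come enumerated by triples of naturals; countability later allows one null
    set per atom. *)
Let support3 : exists L : nat * nat * nat -> R * R * R, forall eps, 0 < eps ->
  exists Z : seq (R * R * R), [/\ uniq Z, forall z, z \in Z -> range L z &
    1 - eps <= pr Q ((fun w => (Z11 w, Z12 w, Z2 w)) @^-1` [set z | z \in Z])].
Proof.
have [a [b hab]] := support2; have [c hc] := discrete_support Q hF2.
exists (fun i => (a i.1.1, b i.1.2, c i.2)) => eps e0.
have e2 : 0 < eps / 2 by rewrite divr_gt0.
have [s [us sab hs]] := hab _ e2.
have [t [ut tb ht]] := hc Z2 (conj m2 cdf2) _ e2.
exists [seq (x, y) | x <- s, y <- t]; split.
- by apply: allpairs_uniq => // -[x y] [x' y'] _ _ [-> ->].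
- move=> z /allpairsP[[[x1 x2] y] /= [/sab[/= [i _ <-] [j _ <-]] /tb[k _ <-] ->]].
  by exists (i, j, k).
have [ms _] := pr_mem_seq Q mZ12 set1_2 us.
have [mt _] := pr_mem_seq Q m2 (@measurable_set1 R) ut.
rewrite (_ : _ @^-1` _ = (fun w => (Z11 w, Z12 w)) @^-1` [set x | x \in s] `&`
  Z2 @^-1` [set y | y \in t]); last first.
  apply/seteqP; split => w; rewrite /preimage /mkset.
    move=> /allpairsP[[x y] /= [xs yt e]]; move: e => /pair_equal_spec[e1 e2'].
    by rewrite /setI /mkset e1 e2'.
  by move=> [xs yt]; apply/allpairsP; exists (Z11 w, Z12 w, Z2 w).
have := pr_setU Q (measurableC ms) (measurableC mt); rewrite -setCI.
by rewrite !pr_setC//; [lra|exact: measurableI].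
Qed.

(** The root needs this for events on the sum of the two leaf values, both half-lines and single
    points. *)
Let leaf_tv eps : 0 < eps -> exists N, forall n, (N <= n)%N -> (0 < n)%N ->
  forall A, measurable A -> `|pr P (node1_out M n 0 0 @^-1` A) -
    pr Q ((fun w => (Z11 w, Z12 w)) @^-1` A)| <= eps.
Proof.
apply: (@mass_cvg _ _ measurable (fun n A => pr P (node1_out M n 0 0 @^-1` A))
  (fun A => pr Q ((fun w => (Z11 w, Z12 w)) @^-1` A)) setT).
- by move=> n _; exact: law_mass.
- exact: law_mass.
- move=> e e0; have [a [b h]] := support2; have [Z [uZ _ hZ]] := h _ e0.
  by exists Z; split => //; have [_ <-] := pr_mem_seq Q mZ12 set1_2 uZ.
- by move=> z _; exact: leaf_atom.
Qed.

Let msum2 : measurable_fun setT (fun y : R * R => y.1 + y.2).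
Proof. by apply: measurable_funD; [exact: measurable_fst|exact: measurable_snd]. Qed.

Let O n w := mra_out M n 0 w.
Let S n w := (O n w).1.1 + (O n w).1.2.

Let O1 n w : (O n w).1 = node1_out M n 0 0 w.
Proof. by rewrite /O mra_outE. Qed.

Let mO n : measurable_fun setT (O n). Proof. exact: (mra_out_measurable hM). Qed.
Let mO1 n : measurable_fun setT (fun w => (O n w).1.1).
Proof.
by apply: (measurableT_comp measurable_fst); exact: measurableT_comp measurable_fst (mO n).
Qed.
Let mO2 n : measurable_fun setT (fun w => (O n w).1.2).
Proof.
by apply: (measurableT_comp measurable_snd); exact: measurableT_comp measurable_fst (mO n).
Qed.
Let mO3 n : measurable_fun setT (fun w => (O n w).2).
Proof. exact: measurableT_comp measurable_snd (mO n). Qed.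
Let mS n : measurable_fun setT (S n). Proof. exact: measurable_funD. Qed.

(** Here [p1] is the exact probability for the sum at node (1) with parameter [n]; by [leaf_tv] it
    is within [eps] of its limit [u], the slack that [node_limit] permits. *)
Let root_corner a b c c' : tends (fun n =>
    corner P (S n) (fun w => (O n w).2) a b c c')
  (corner Q (fun w => Z11 w + Z12 w) Z2 a b c c').
Proof.
move=> delta d0; have [eps [e0 [N1 hN1]]] := rate d0.
have [N2 hN2] := leaf_tv e0.
exists (maxn N1 N2) => n; rewrite geq_max => /andP[Nn1 Nn2] n0.
apply: le_trans (hN1 n Nn1 n0).
rewrite corner_root_limit; set u := pr Q _; set v := pr Q _.
have [_ h _] := hM.
have u01 : 0 <= u <= 1 by exact: (p01 c a m1).
have v01 : 0 <= v <= 1 by exact: p01.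
have hcop i : has_copula P (rW1 M n 0 i) (rW2 M n 0 i) C0.
  by have [_ [_ [_ ]]] := h n 0%N i.
pose A := [set y : R * R | below c a (y.1 + y.2)].
have mA : measurable A.
  exact: (@measurable_preimage _ _ _ _ (fun y : R * R => y.1 + y.2) _ msum2 (measurable_below c a)).
have eA i : (i < n)%N -> pr P [set w | below c a (node_key ((root_block M n 0)^~ w) i)] =
    pr P (node1_out M n 0 0 @^-1` A).
  by move=> i_n; rewrite /pr; congr fine; exact: (node1_out_law hC1 hM 0 0 i_n n0 mA).
have eB i : pr P [set w | below c' b (root_block M n 0 (NZ i) w).1] = v.
  have [[mX cX] _] := h n 0%N i.
  by apply: eq_cdf_below => // x; rewrite cX cdf2.
have := @node_limit _ _ _ P n (root_block M n 0) c c' a b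
  (pr P (node1_out M n 0 0 @^-1` A)) v u v (C0 u v) eps 0
  n0 (root_block_family hM n 0).
rewrite /corner (_ : [set w | below c a (S n w) && _] =
  [set w | below c a (node_key ((root_block M n 0)^~ w) 0) &&
           below c' b (node_out n ((root_block M n 0)^~ w) 0).2]); last first.
  by apply/funext => w; rewrite /mkset /S /O mra_outE.
apply => //.
- by move=> i _; have [_ [_ [t _]]] := h n 0%N i.
- by move=> s s' sn sn' k x; exact: (root_block_law hC1 hC0 hM).
- by move=> i _; have [] := copula_events hC0 (hcop i) u01 v01.
- by move=> i _; have [] := copula_events hC0 (hcop i) u01 v01.
- by move=> i _; have [] := copula_events hC0 (hcop i) u01 v01.
- exact: (hN2 n Nn2 n0 A mA).
- by rewrite subrr normr0 ltW.
Qed.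

Let root_atom a b : tends (fun n => pr P [set w | S n w = a /\ (O n w).2 = b])
  (pr Q [set w | Z11 w + Z12 w = a /\ Z2 w = b]).
Proof.
rewrite atom_corners//.
rewrite (_ : (fun n => _) = (fun n => let c := corner P (S n) (fun w => (O n w).2) a b in
    c true true - c false true - c true false + c false false)).
  exact: (@tends_atom _ (fun c c' n => corner P (S n) (fun w => (O n w).2) a b c c')).
by apply/funext => n; rewrite /= -(atom_corners P a b (mS n) (mO3 n)).
Qed.

Let mra_atom z : tends (fun n => pr P (O n @^-1` [set z]))
  (pr Q ((fun w => (Z11 w, Z12 w, Z2 w)) @^-1` [set z])).
Proof.
case: z => -[a b] c.
have ci n : cond_indep_discrete P
    (fun w => ((O n w).1.1, (O n w).1.2, (O n w).1.1 + (O n w).1.2))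
    (fun w => ((O n w).2, (O n w).1.1 + (O n w).1.2 + (O n w).2))
    (fun w => (O n w).1.1 + (O n w).1.2) by exact: (mra_out_cond_indep hM).
have e n := cond_indep_atom a b c (ci n) (mO1 n) (mO2 n) (mO3 n).
have [_ _ _ _ ciQ] := hQ.
have e' := cond_indep_atom a b c ciQ m11 m12 m2.
have OE n : O n @^-1` [set (a, b, c)] =
    [set w | ((O n w).1.1, (O n w).1.2, (O n w).2) = (a, b, c)].
  apply/seteqP; split => w; rewrite /preimage /mkset; first by move=> ->.
  by case: (O n w) => -[].
have -> : (fun n => pr P (O n @^-1` [set (a, b, c)])) = (fun n =>
    pr P [set w | ((O n w).1.1, (O n w).1.2, (O n w).2) = (a, b, c)]).
  by apply/funext => n; rewrite OE.
have leq_pr d1 (U : measurableType d1) (P1 : probability U R) (X1 X2 X3 : U -> R) :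
    measurable_fun setT X1 -> measurable_fun setT X2 -> measurable_fun setT X3 ->
    [/\ 0 <= pr P1 [set w | (X1 w, X2 w, X3 w) = (a, b, c)] <=
        pr P1 [set w | (X1 w, X2 w) = (a, b)] &
        0 <= pr P1 [set w | (X1 w, X2 w) = (a, b)] <= pr P1 [set w | X1 w + X2 w = a + b]].
  move=> mX1 mX2 mX3.
  have i1 := measurable_preimage (measurable_fun_pair (measurable_fun_pair mX1 mX2) mX3)
    (set1_3 (a, b, c)).
  have i2 := measurable_preimage (measurable_fun_pair mX1 mX2) (set1_2 (a, b)).
  have i3 := measurable_preimage (measurable_funD mX1 mX2) (@measurable_set1 R (a + b)).
  rewrite !pr_ge0; split; apply: pr_le => //.
    by move=> w /= [-> -> _].
  by move=> w /= [-> ->].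
have [q1 q2] := leq_pr _ _ Q _ _ _ m11 m12 m2.
(* The atom at [(a, b, c)] is recovered from the atom of the leaf pair, the law of its sum, and the
   root's joint atom at [(a + b, c)]. *)
apply: (tends_cond e e' _ q1 q2).
- by move=> n; have [] := leq_pr _ _ P _ _ _ (mO1 n) (mO2 n) (mO3 n).
- move=> eps e0; have [N hN] := leaf_tv e0; exists N => n Nn n0.
  have mA : measurable [set y : R * R | y.1 + y.2 = a + b].
    exact: (measurable_preimage msum2 (@measurable_set1 R (a + b))).
  rewrite (_ : [set w | (O n w).1.1 + (O n w).1.2 = a + b] =
      node1_out M n 0 0 @^-1` [set y | y.1 + y.2 = a + b]); first exact: hN.
  by apply/seteqP; split => w; rewrite /preimage /mkset O1.
- move=> eps e0; have [N hN] := leaf_atom (a, b) e0; exists N => n Nn n0.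
  rewrite (_ : [set w | ((O n w).1.1, (O n w).1.2) = (a, b)] =
      node1_out M n 0 0 @^-1` [set (a, b)]); first exact: hN.
  by apply/seteqP; split => w; rewrite /preimage /mkset O1 -surjective_pairing.
- exact: root_atom.
Qed.

Lemma mra_support : exists L : nat * nat * nat -> R * R * R, forall eps, 0 < eps ->
  exists Z : seq (R * R * R), [/\ uniq Z, forall z, z \in Z -> range L z &
    1 - eps <= \sum_(z <- Z) pr Q ((fun w => (Z11 w, Z12 w, Z2 w)) @^-1` [set z])].
Proof.
have [L hL] := support3; exists L => eps e0; have [Z [uZ ZL hZ]] := hL _ e0.
by exists Z; split => //; have [_ <-] := pr_mem_seq Q mZ set1_3 uZ.
Qed.

Lemma mra_atom_cvg z : tends (fun n => pr P (mra_out M n 0 @^-1` [set z]))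
  (pr Q ((fun w => (Z11 w, Z12 w, Z2 w)) @^-1` [set z])).
Proof. exact: mra_atom. Qed.

Lemma tree_law_mass : mass measurable (fun A => pr Q ((fun w => (Z11 w, Z12 w, Z2 w)) @^-1` A)).
Proof. exact: law_mass. Qed.

Lemma mra_total_variation eps : 0 < eps -> exists N, forall n, (N <= n)%N -> (0 < n)%N ->
  forall A, measurable A -> `|pr P (mra_out M n 0 @^-1` A) -
    pr Q ((fun w => (Z11 w, Z12 w, Z2 w)) @^-1` A)| <= eps.
Proof.
have [L hL] := mra_support.
apply: (@mass_cvg _ _ measurable (fun n A => pr P (mra_out M n 0 @^-1` A))
  (fun A => pr Q ((fun w => (Z11 w, Z12 w, Z2 w)) @^-1` A)) (range L)) => //.
- by move=> n _; apply: law_mass => //; exact: (mra_out_measurable hM).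
- exact: tree_law_mass.
- by move=> z _; exact: mra_atom_cvg.
Qed.

End mra_limits.

(** * Empirical measures *)

Section empirical.
Context (R : realType) (X : eqType) (n : nat) (x : nat -> X).

Definition empirical (A : set X) : R :=
  (count (fun k => `[< A (x k) >]) (iota 0 n))%:R / n%:R.

(** Each sample equals at most one point of the duplicate-free [Z], which bounds the sum of atoms.
    Empirical measures thus enter the same argument as laws. *)
Lemma empirical_mass F : (forall A, F A -> F (~` A)) -> (0 < n)%N -> mass F empirical.
Proof.
move=> FC n0; have nR : 0 < n%:R :> R by rewrite ltr0n.
split => // [A _|A Z _ uZ]; rewrite /empirical.
  rewrite -mulrDl -natrD.
  rewrite (eq_count (a1 := fun k => `[< (~` A) (x k) >])
    (a2 := predC (fun k => `[< A (x k) >]))); last first.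
    by move=> k /=; rewrite -asbool_neg.
  by rewrite count_predC size_iota divff// gt_eqF.
rewrite -mulr_suml ler_pM2r ?invr_gt0//.
under eq_bigr do rewrite count_iota_sum.
rewrite exchange_big/= count_iota_sum; apply: ler_sum => k _.
have [Ax|nAx] := asboolP (A (x k)); last first.
  rewrite big1// => z /asboolP Az; case: asboolP => // xz.
  by rewrite -xz in Az.
rewrite -natr_sum ler_nat.
apply: (@leq_trans (\sum_(z <- Z) (x k == z))%N).
  rewrite [leqRHS](bigID (fun z => `[< A z >]))/=; apply: leq_trans (leq_addr _ _).
  by apply: leq_sum => z _; case: asboolP => //= ->; rewrite eqxx.
have -> : (\sum_(z <- Z) (x k == z))%N = count_mem (x k) Z.
  rewrite -sum1_count [RHS]big_mkcond/=; apply: eq_bigr => z _.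
  by rewrite eq_sym; case: eqP.
by rewrite count_uniq_mem// leq_b1.
Qed.

End empirical.

(** Telescoping majorant: [1 / k^2 <= 2 / k - 2 / (k + 1)] for [k >= 1]. *)
Lemma sum_inv_sqr_le (R : realType) K :
  \sum_(m < K) (m.+1%:R ^+ 2)^-1 <= 2 - 2 / K.+1%:R :> R.
Proof.
elim: K => [|K IH]; first by rewrite big_ord0 invr1; lra.
rewrite big_ord_recr/=; apply: le_trans (lerD IH (lexx _)) _.
set k : R := K.+1%:R; have k1 : 1 <= k by rewrite ler1n.
rewrite (_ : K.+2%:R = k + 1); last by rewrite /k -natr1.
have -> : 2 - 2 / k + (k ^+ 2)^-1 = 2 - 2 / (k + 1) - (k - 1) / (k ^+ 2 * (k + 1)).
  by field; rewrite !gt_eqF//; lra.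
rewrite lerBlDr lerDl divr_ge0// ?subr_ge0// mulr_ge0//; [exact: sqr_ge0|lra].
Qed.

(** * Almost sure convergence by Borel-Cantelli *)

Section almost_sure.
Context (R : realType) (d : measure_display) (Omega : measurableType d).
Variables (P : probability Omega R) (M : mra_rand R Omega).
Variables (F11 F12 F2 F1 : R -> R) (C1 C0 : R -> R -> R).
Hypotheses (hC1 : is_copula C1) (hC0 : is_copula C0).
Hypothesis hM : mra_law P F11 F12 F2 C1 C0 M.
Context (d' : measure_display) (T' : measurableType d').
Variables (Q : probability T' R) (Z11 Z12 Z2 : T' -> R).
Hypothesis hQ : tree_dependent Q F11 F12 F2 F1 C1 C0 Z11 Z12 Z2.
Hypotheses (hF11 : discrete_cdf F11) (hF12 : discrete_cdf F12) (hF2 : discrete_cdf F2).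
Hypothesis hF1 : sum_cdf_under F11 F12 C1 F1.

Let D n z k w : bool := mra_out M n k w == z.

(** Index [m] stands for parameter [m + 1], skipping the empty batch. The deviation is from the
    exact atom at that parameter; its distance to the limit is left to [mra_atom_cvg]. *)
Let F z (eps : R) m : set Omega :=
  [set w | eps * m.+1%:R <= `|(count (fun k => D m.+1 z k w) (iota 0 m.+1))%:R -
    m.+1%:R * pr P (mra_out M m.+1 0 @^-1` [set z])|].

Let measurable_set1_3 (z : R * R * R) : measurable [set z].
Proof.
case: z => -[a b] c.
rewrite (_ : [set _] = ([set a] `*` [set b]) `*` [set c]).
  by apply: measurableX => //; exact: measurableX.
by apply/seteqP; split => -[[x y] z] /=; [case=> -> -> ->|move=> [[-> ->] ->]].
Qed.

Let DE n z k : [set w | D n z k w] = mra_out M n k @^-1` [set z].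
Proof. by apply/seteqP; split => w /eqP. Qed.

Let measurable_D n z k : measurable [set w | D n z k w].
Proof. by rewrite DE; apply: measurable_preimage => //; exact: (mra_out_measurable hM). Qed.

Let measurable_F z eps m : measurable (F z eps m).
Proof.
apply: (@sets_measurable_count _ _ (fun k w => D m.+1 z k w) (iota 0 m.+1) _
  [set r : nat | eps * m.+1%:R <= `|r%:R - m.+1%:R * pr P (mra_out M m.+1 0 @^-1` [set z])|]) => k.
exact: sets_measurable_bool.
Qed.

Let pr_F z eps m : 0 < eps -> pr P (F z eps m) <= (eps ^+ 4 * m.+1%:R ^+ 2)^-1.
Proof.
move=> e0; apply: (count_concentration (D := D m.+1 z)) => //.
- apply: (@mutual_indep_inj R d Omega P nat nat _ _ id _ _
    (mra_out_indep hM (n := m.+1))) => // k _ ->.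
  by exists [set z]; [exact: measurable_set1_3|exact/esym/DE].
- move=> k km; rewrite (DE m.+1 z k) /pr; congr fine.
  exact: (mra_out_law hC1 hC0 hM).
- rewrite pr_ge0 pr_le1//; apply: measurable_preimage => //.
  exact: (mra_out_measurable hM).
Qed.

(** The tail bounds sum to at most [2 / eps^4], so Borel-Cantelli applies. *)
Let limsup_F z eps : 0 < eps -> P (lim_sup_set (F z eps)) = 0.
Proof.
move=> e0; apply: lim_sup_set_cvg0; first by move=> k; exact: measurable_F.
apply: le_lt_trans (ltry (2 * (eps ^+ 4)^-1)).
apply: lime_le; first by apply: is_cvg_nneseries => m _ _.
apply: nearW => K; rewrite big_mkord.
apply: (@le_trans _ _ (\sum_(m < K) (pr P (F z eps m))%:E)%E).
  by apply: lee_sum => m _; rewrite -(prE P (measurable_F z eps m)).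
rewrite sumEFin lee_fin.
apply: (@le_trans _ _ ((eps ^+ 4)^-1 * \sum_(m < K) (m.+1%:R ^+ 2)^-1)).
  rewrite mulr_sumr; apply: ler_sum => m _.
  by apply: le_trans (pr_F _ _ e0) _; rewrite invfM.
rewrite mulrC ler_pM2r ?invr_gt0 ?exprn_gt0//.
by apply: le_trans (sum_inv_sqr_le R K) _; rewrite gerBl divr_ge0.
Qed.

Let good_empirical z w : (forall e : nat, ~ lim_sup_set (F z e.+1%:R^-1) w) ->
  tends (fun n => empirical R n (fun k => mra_out M n k w) [set z])
    (pr Q ((fun w => (Z11 w, Z12 w, Z2 w)) @^-1` [set z])).
Proof.
move=> h delta d0; have d2 : 0 < delta / 2 by rewrite divr_gt0.
have [N1 hN1] := mra_atom_cvg hC1 hC0 hM hQ hF11 hF12 hF1 z d2.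
(* This tolerance index makes [e] at most [delta / 2]; the other half of [delta] covers the distance
   of the atom at parameter [n] from its limit. *)
have {h} := h (Num.truncn (delta / 2)^-1).
set e := (Num.truncn (delta / 2)^-1).+1%:R^-1 => nl.
have ed : e <= delta / 2 by rewrite /e invf_ple ?posrE ?ltr0n//; exact/ltW/truncnS_gt.
have [N2 hN2] : exists N, forall m, (N <= m)%N -> ~ F z e m w.
  apply: contrapT => hn; apply: nl => N _; apply: contrapT => hn'; apply: hn.
  by exists N => m Nm Fm; apply: hn'; exists m.
exists (maxn N1 N2.+1) => -[//|n]; rewrite geq_max ltnS => /andP[n1 n2] _.
have nR : 0 < n.+1%:R :> R by rewrite ltr0n.
rewrite (splitr delta).
apply: le_trans (ler_distD (pr P (mra_out M n.+1 0 @^-1` [set z])) _ _) _.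
apply: lerD; last exact: hN1.
have /negP := hN2 n n2; rewrite -ltNge => /ltW h.
apply: le_trans ed; rewrite -(ler_pM2r nR); apply: le_trans h.
rewrite -[X in _ * X <= _](gtr0_norm nR) -normrM mulrBl /empirical divfK ?gt_eqF//.
rewrite mulrC le_eqVlt; apply/orP; left; apply/eqP; congr (`| _%:R - _|).
by apply: eq_count => k; rewrite /D; apply/asboolP/eqP.
Qed.

(** One null set serves all [A]: it is built from atoms and tolerances only, and [mass_cvg] is
    applied path by path outside it. *)
Lemma empirical_uniform_cvg : {ae P, forall w, forall eps : R, 0 < eps ->
  exists N : nat, forall n : nat, (N <= n)%N -> (0 < n)%N ->
  forall A, measurable A ->
   `|empirical R n (fun k => mra_out M n k w) A -
     pr Q ((fun w => (Z11 w, Z12 w, Z2 w)) @^-1` A)| <= eps}.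
Proof.
have [L hL] := mra_support hQ hF11 hF12 hF2.
(* Pairs of an atom index and a tolerance are coded by naturals; numbers that code no pair
   contribute the empty set. *)
pose G k : set Omega := if unpickle k is Some (i, e) then
  lim_sup_set (F (L i) e.+1%:R^-1) else set0.
have : P.-negligible (\bigcup_k G k).
  apply: negligible_bigcup => k; rewrite /G; case: unpickle => [[i e]|].
    apply/negligibleP; last by apply: limsup_F; rewrite invr_gt0 ltr0n.
    apply: bigcapT_measurable => j; apply: bigcup_measurable => m _.
    exact: measurable_F.
  exact: negligible_set0.
apply: negligibleS => w nw; apply: contrapT => nG; apply: nw => eps e0.
apply: (@mass_cvg _ _ measurable (fun n => empirical R n (fun k => mra_out M n k w))
  (fun A => pr Q ((fun w => (Z11 w, Z12 w, Z2 w)) @^-1` A)) (range L)) => //.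
- by move=> n n0; apply: empirical_mass => // A; exact: measurableC.
- exact: (tree_law_mass hQ).
- move=> _ [i _ <-]; apply: good_empirical => e hF; apply: nG.
  by exists (pickle (i, e)) => //; rewrite /G pickleK.
Qed.

End almost_sure.

Lemma measurable_le3 (R : realType) (x : R * R * R) : measurable [set y | le3 y x].
Proof.
rewrite (_ : [set y | le3 y x] =
    (`]-oo, x.1.1]%classic `*` `]-oo, x.1.2]%classic) `*` `]-oo, x.2]%classic).
  by apply: measurableX => //; exact: measurableX.
apply/seteqP; split => y; rewrite /le3 /= !in_itv/=.
  by move=> [-> [-> ->]].
by move=> [[-> ->] ->].
Qed.

Theorem theorem4p2 (R : realType)
  (F11 F12 F2 F1 : R -> R) (C1 C0 c1 c0 : R -> R -> R)
  (hF11 : discrete_cdf F11) (hF12 : discrete_cdf F12) (hF2 : discrete_cdf F2)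
  (hF1 : sum_cdf_under F11 F12 C1 F1)
  (hC1 : is_copula C1) (hC0 : is_copula C0)
  (hc1 : copula_density C1 c1) (hc0 : copula_density C0 c0)
  (hB1 : density_condition c1 F11 F12) (hB0 : density_condition c0 F1 F2)
  (d : measure_display) (Omega : measurableType d) (P : probability Omega R)
  (M : mra_rand R Omega) (hM : mra_law P F11 F12 F2 C1 C0 M) :
  (forall n : nat,
     (* the n output vectors are i.i.d. *)
     mutual_indep P (fun k : 'I_n => rv_events (mra_out M n k)) /\
     (forall (k k' : 'I_n) (A : set (R * R * R)), measurable A ->
        P (mra_out M n k @^-1` A) = P (mra_out M n k' @^-1` A)) /\
     (* conditional independence *)
     (forall k : 'I_n,
        cond_indep_discrete P
          (fun w => ((mra_out M n k w).1.1, (mra_out M n k w).1.2,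
                     (mra_out M n k w).1.1 + (mra_out M n k w).1.2))
          (fun w => ((mra_out M n k w).2,
                     (mra_out M n k w).1.1 + (mra_out M n k w).1.2
                       + (mra_out M n k w).2))
          (fun w => (mra_out M n k w).1.1 + (mra_out M n k w).1.2))) /\
  (forall (d' : measure_display) (T' : measurableType d')
          (Q : probability T' R) (Z11 Z12 Z2 : T' -> R),
     tree_dependent Q F11 F12 F2 F1 C1 C0 Z11 Z12 Z2 ->
     let Ftau := cdf3 Q (fun w => (Z11 w, Z12 w, Z2 w)) in
     (* convergence in distribution of X^(1:n) to X_root *)
     (forall x : R * R * R, {for x, continuous Ftau} ->
        (fun n => cdf3 P (mra_out M n 0) x) @ \oo --> Ftau x) /\
     (* a.s. uniform convergence of the empirical distribution function *)
     {ae P, forall w, forall eps : R, 0 < eps ->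
        exists N : nat, forall n : nat, (N <= n)%N ->
          forall x : R * R * R, `|empirical_cdf M n w x - Ftau x| <= eps}).
Proof.
split.
  move=> n; split; [|split].
  - apply: (mutual_indep_inj (k := @nat_of_ord n) _ _ (mra_out_indep hM (n := n))).
      exact: val_inj.
    by move=> k A.
  - by move=> k k' A mA; exact: (mra_out_law hC1 hC0 hM).
  - by move=> k; exact: (mra_out_cond_indep hM).
move=> d' T' Q Z11 Z12 Z2 hQ Ftau; split.
  move=> x _; apply/tendsP => eps e0.
  have [N hN] := mra_total_variation hC1 hC0 hM hQ hF11 hF12 hF2 hF1 e0.
  by exists N => n Nn n0; exact: (hN n Nn n0 _ (measurable_le3 x)).
have := empirical_uniform_cvg hC1 hC0 hM hQ hF11 hF12 hF2 hF1.
apply: filterS => w h eps e0; have [N hN] := h eps e0.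
(* Raising the threshold to 1 supplies the guard [0 < n]. *)
exists (maxn N 1) => n; rewrite geq_max => /andP[Nn n0] x.
have := hN n Nn n0 _ (measurable_le3 x).
rewrite /empirical count_iota_sum /empirical_cdf.
rewrite (eq_bigr (fun k : 'I_n => if `[< le3 (mra_out M n k w) x >] then 1 else 0))//.
by move=> k _; case: (`[< _ >]).
Qed.
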